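(* For every finite simple graph $G$ with at most $10$ vertices, the Betti numbers of $K[\Delta(G)]$ do not depend on the characteristic of the field $K$; that is, for all $i$ and $d$ the number $\beta_{i,d}^K(G)$ takes the same value for all fields $K$.
   Context: For a finite simple graph $G$ with vertex set $V(G)$ and edge set $E(G)$, and a field $K$, let $K(G)$ be the polynomial ring over $K$ whose variables are the vertices of $G$, and let $I(G)$ be the ideal generated by all monomials $uv$ with $(u,v)\in E(G)$. $\Delta(G)$ is the simplicial complex on $V(G)$ whose faces are the sets of vertices no two of which are joined by an edge of $G$, so that $K[\Delta(G)]=K(G)/I(G)$ is its Stanley-Reisner ring. $\beta_{i,d}^K(G)$ denotes the $i$th graded Betti number of degree $d$ of $K[\Delta(G)]$: in a graded minimal free resolution of $K[\Delta(G)]$ over $R=K(G)$, the $i$th free module is $\bigoplus_d R(-d)^{\beta_{i,d}^K(G)}$. *)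

(* Defs.v *)
From mathcomp Require Import all_boot all_order all_algebra.
From mathcomp Require Export mpoly.

Set Implicit Arguments.
Unset Strict Implicit.
Unset Printing Implicit Defensive.

Import GRing.Theory.
Local Open Scope ring_scope.

Definition ideal_gen (R : comNzRingType) (A : R -> Prop) (p : R) : Prop :=
  exists (m : nat) (c g : 'I_m -> R),
    (forall k, A (g k)) /\ p = \sum_k c k * g k.

(* A simple graph is a symmetric irreflexive relation [e] on a finite type [T].
   The ring K(G) is [{mpoly K[#|T|]}]: the vertex [v] is the variable of index
   [enum_rank v]. *)
Definition vertex_var (K : fieldType) (T : finType) (v : T) :
  {mpoly K[#|T|]} := 'X_(enum_rank v).

Definition edge_ideal (K : fieldType) (T : finType) (e : rel T) :
    {mpoly K[#|T|]} -> Prop :=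
  ideal_gen (fun p => exists u v : T,
    e u v /\ p = vertex_var K u * vertex_var K v).
Arguments edge_ideal K {T} e p.

Definition independence_complex (T : finType) (e : rel T) : {set {set T}} :=
  [set F : {set T} | [forall u in F, forall v in F, ~~ e u v]].

Definition stanley_reisner_ideal (K : fieldType) (T : finType)
    (D : {set {set T}}) : {mpoly K[#|T|]} -> Prop :=
  ideal_gen (fun p => exists F : {set T},
    F \notin D /\ p = \prod_(v in F) vertex_var K v).
Arguments stanley_reisner_ideal K {T} D p.

(* K(G)/I(G) is the Stanley-Reisner ring of the complex of independent sets. *)
Lemma stanley_reisner_edge_ideal (K : fieldType) (T : finType) (e : rel T)
    (e_irr : irreflexive e) (p : {mpoly K[#|T|]}) :
  stanley_reisner_ideal K (independence_complex e) p <-> edge_ideal K e p.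
Proof.
split=> -[m [c [g [Ag ->]]]].
- have AB k : exists h : {mpoly K[#|T|]} * {mpoly K[#|T|]},
      (exists u v : T, e u v /\ h.2 = vertex_var K u * vertex_var K v)
      /\ g k = h.1 * h.2.
    have [F [nF ->]] := Ag k; move: nF; rewrite inE negb_forall_in.
    case/exists_inP=> u uF; rewrite negb_forall_in => /exists_inP[v vF].
    rewrite negbK => euv.
    have vu : v != u by apply: contraTneq euv => ->; rewrite e_irr.
    exists (\prod_(w in F | (w != u) && (w != v)) vertex_var K w,
            vertex_var K u * vertex_var K v); split; first by exists u, v.
    rewrite (bigD1 u) //= (bigD1 v) /=; last by rewrite vF.
    rewrite mulrA mulrC; congr (_ * _); apply: eq_bigl => w.
    by rewrite -andbA.
  have [h hP] := fin_all_exists AB.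
  exists m, (fun k => c k * (h k).1), (fun k => (h k).2); split=> [k|].
    by have [] := hP k.
  by apply: eq_bigr => k _; have [_ ->] := hP k; rewrite mulrA.
- exists m, c, g; split=> // k.
  have [u [v [euv ->]]] := Ag k; exists [set u; v]; split.
    rewrite inE negb_forall_in; apply/exists_inP; exists u; first by rewrite set21.
    rewrite negb_forall_in; apply/exists_inP; exists v; first by rewrite set22.
    by rewrite negbK.
  have uv : u != v by apply: contraTneq euv => ->; rewrite e_irr.
  by rewrite big_setU1 ?inE //= big_set1.
Qed.

(* A graded minimal free resolution

     ... -> F_2 -> F_1 -> F_0 -> R/I -> 0,      R = K[x_0, ..., x_(n-1)],

   of R/I for a homogeneous ideal I.  The module F_i is the direct sum of the
   R(-d) with d = [res_deg j], for j : 'I_(res_rank i); its elements are row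
   vectors, on which matrices act from the right.  The map F_0 -> R/I is given
   by lifts to R of the images of the basis vectors; all maps preserve degrees
   (R/I being generated in degree 0, the degrees of the generators of the F_i
   are natural numbers).  No finiteness of the length is required. *)
Record graded_minimal_free_resolution (K : fieldType) (n : nat)
    (I : {mpoly K[n]} -> Prop) := GradedMinimalFreeResolution {
  res_rank : nat -> nat;
  res_deg : forall i, 'I_(res_rank i) -> nat;
  res_aug : 'cV[{mpoly K[n]}]_(res_rank 0);
  res_diff : forall i, 'M[{mpoly K[n]}]_(res_rank i.+1, res_rank i);
  res_aug_homog : forall j, res_aug j 0 \is (res_deg j).-homog;
  (* nonzero entries are homogeneous of degree [res_deg j - res_deg k] *)
  res_diff_homog : forall i j k m, m \in msupp (res_diff i j k) ->
    (mdeg m + res_deg k = res_deg j)%N;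
  res_aug_surj : forall p, exists v : 'rV_(res_rank 0),
    I (p - (v *m res_aug) 0 0);
  res_exact0 : forall v : 'rV_(res_rank 0),
    I ((v *m res_aug) 0 0) <-> exists w, v = w *m res_diff 0;
  res_exact : forall i (v : 'rV_(res_rank i.+1)),
    v *m res_diff i = 0 <-> exists w, v = w *m res_diff i.+1;
  (* the image of F_(i+1) is contained in (x_0, ..., x_(n-1)) F_i *)
  res_minimal : forall i j k, (res_diff i j k)@_0%MM = 0
}.

(* The multiplicity of R(-d) in F_i. *)
Definition graded_betti (K : fieldType) (n : nat) (I : {mpoly K[n]} -> Prop)
    (F : graded_minimal_free_resolution I) (i d : nat) : nat :=
  #|[set j : 'I_(res_rank F i) | res_deg j == d]|.

(* Main.v *)
Require Import Defs.
From mathcomp Require Import all_boot all_order all_algebra.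
From mathcomp Require Import ring zify.
From Stdlib Require Import Classical_Prop IndefiniteDescription.

(* A minimal resolution [F] and an explicit free resolution [G] of the same
   module are related by chain maps that are mutually inverse up to homotopy;
   modulo the variables, [F] has zero differential, so the Betti numbers are
   the dimensions of the homology of [G] modulo the variables.  For [G] we take
   the complex with generators [(W, F)], [F] an independent set disjoint from
   [W], and differential
     [(W, F) |-> \sum_(k in W) +- (x_k (W - k, F) - (W - k, F + k))].
   Modulo the variables it is the sum over all [X] of the reduced cochain
   complexes of the complexes of independent subsets of [X] (this is Hochster's
   formula), defined over the integers.  By the Smith normal form, the ranks do
   not depend on the field as soon as all cocycles modulo [p] lift to integral
   cocycles.
   Suppose that this fails on a set [X] with at most 10 vertices, chosen
   minimal, for cochains on faces with [s] elements.  Then for every vertex [v]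
   the link of [v] (its non-neighbours) has nonzero integral cohomology on
   [s]-element faces, hence at least [2 s] vertices, and induces a perfect
   matching if it has exactly [2 s]; the deletion of [v] has nonzero cohomology
   modulo [p]; and the neighbourhood of [v] is not a clique.  For [s = 2] the
   neighbourhood of [v] also has nonzero cohomology modulo [p] and is not
   contained in a link.  Counting vertices and edges, these conditions are
   contradictory. *)

Set Implicit Arguments.
Unset Strict Implicit.
Unset Printing Implicit Defensive.

Import GRing.Theory.

(** * Exterior algebra *)

(** The complex [G] comes from the decomposition of R/I as the direct sum, over independent sets F,
    of x_F K[x_v, v in F]. R/I receives one redundant generator [(set0, F)] for each face, mapped to
    the monomial x_F. The relations x_k x_F = x_(F + k), with right side 0 when F + k is not a face,
    give the first differential, and W is a Koszul direction. Exactness then reduces, face by face,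
    to Koszul complexes on the variables outside F. The modulus p runs over all nonzero integers
    because it is finally taken to be an elementary divisor of an integral differential. The bound
    10 enters through |X| = 1 + |link| + |neighbourhood|. There is no obstruction for s <= 1, and s
    >= 4 would need 1 + 8 + 2 = 11 vertices. For s = 3 a link has 6 or 7 vertices; for s = 2 a
    neighbourhood has at least 4, so a link has 4 or 5. *)

Lemma antisym_sum0 (I : finType) (V : zmodType) (a : I -> I -> V) :
    (forall i, a i i = 0%R) -> (forall i j, a i j = (- a j i)%R) ->
  (\sum_i \sum_j a i j = 0)%R.
Proof.
(* In characteristic 2 antisymmetry says nothing about the diagonal, hence the separate hypothesis
   [a0]; off the diagonal, (i, j) is paired with (j, i) through the order [r]. *)
move=> a0 aN; pose r (i : I) := enum_rank i : nat.
have -> : (\sum_i \sum_j a i j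
    = \sum_i \sum_(j | (r i < r j)%N) a i j + \sum_i \sum_(j | (r j < r i)%N) a i j)%R.
  rewrite -big_split /=; apply: eq_bigr => i _.
  rewrite (bigID (fun j => r i < r j)) /=; congr (_ + _)%R.
  rewrite (bigID (fun j => r j < r i)) /= [X in (_ + X)%R]big1 ?addr0.
    by apply: eq_bigl => j; rewrite -leqNgt andb_idl // => /ltnW.
  move=> j; rewrite -!leqNgt => /andP[ji ij].
  suff -> : j = i by apply: a0.
  by apply/enum_rank_inj/val_inj/eqP; rewrite eqn_leq ji.
rewrite [X in (_ + X)%R](exchange_big_dep predT) //= -big_split big1 // => i _.
rewrite -big_split big1 //= => j _; rewrite [X in (_ + X)%R]aN; exact: subrr.
Qed.

Section Exterior.
Local Open Scope ring_scope.
Variables (T : finType) (R : comNzRingType).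
Implicit Types (F W : {set T}) (u v w : T) (g h : {set T} -> R).

(** The exponent of the Koszul sign: the number of transpositions that bring [v] to its place among
    the elements of [F]. *)
Definition num_before v F := #|[set f in F | (enum_rank f < enum_rank v)%N]|.

Lemma num_beforeU v w F : w \notin F ->
  num_before v (w |: F) = ((enum_rank w < enum_rank v) + num_before v F)%N.
Proof.
move=> wF; rewrite /num_before; case wv: (enum_rank w < enum_rank v)%N => /=.
  have -> : [set f in w |: F | (enum_rank f < enum_rank v)%N]
      = w |: [set f in F | (enum_rank f < enum_rank v)%N].
    by apply/setP=> f; rewrite !inE; case: eqP => // ->; rewrite wv.
  by rewrite cardsU1 inE (negPf wF).
rewrite add0n; apply: eq_card => f; rewrite !inE.
by case: eqP => // ->; rewrite wv !andbF.
Qed.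

Lemma num_beforeD1 v w F : w \in F ->
  num_before v F = ((enum_rank w < enum_rank v) + num_before v (F :\ w))%N.
Proof. by move=> wF; rewrite -{1}(setD1K wF) num_beforeU // !inE eqxx. Qed.

Lemma sign_rank u v : u != v ->
  (-1) ^+ (enum_rank u < enum_rank v)%N
    = - (-1) ^+ (enum_rank v < enum_rank u)%N :> R.
Proof.
move=> uv; case: ltngtP => [||/val_inj/enum_rank_inj eq_uv]; rewrite ?expr0 ?expr1 ?opprK //.
by rewrite eq_uv eqxx in uv.
Qed.

Lemma sign_rank_swap u v (a b : nat) : u != v ->
  (-1) ^+ ((enum_rank v < enum_rank u)%N + a + b)
    = - (-1) ^+ ((enum_rank u < enum_rank v)%N + b + a) :> R.
Proof.
by move=> uv; rewrite addnAC -!addnA exprD sign_rank 1?eq_sym // mulNr -exprD.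
Qed.

(* [wedge v] and [contract v] are exterior multiplication and contraction by
   the basis vector [v], written on coefficient functions of the exterior
   algebra with basis [T]; they satisfy the canonical anticommutation
   relations. *)
Definition wedge v g F : R :=
  if v \in F then (-1) ^+ num_before v F * g (F :\ v) else 0.
Definition contract v g F : R :=
  if v \in F then 0 else (-1) ^+ num_before v F * g (v |: F).

Lemma wedgeC u v g F : wedge u (wedge v g) F = - wedge v (wedge u g) F.
Proof.
have [->|uv] := eqVneq u v.
  by rewrite /wedge !inE eqxx /= mulr0 if_same oppr0.
rewrite /wedge !inE [v == u]eq_sym uv /=.
case: ifP => uF; case: ifP => vF; rewrite ?mulr0 ?oppr0 //.
rewrite !mulrA -!exprD (num_beforeD1 u vF) (num_beforeD1 v uF) -mulNr.
rewrite [F :\ v :\ u]setDDl [F :\ u :\ v]setDDl setUC; congr (_ * _).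
exact: sign_rank_swap.
Qed.

Lemma contractC u v g F : contract u (contract v g) F = - contract v (contract u g) F.
Proof.
have [->|uv] := eqVneq u v.
  by rewrite /contract !inE eqxx /= mulr0 if_same oppr0.
rewrite /contract !inE [v == u]eq_sym (negPf uv) /=.
case: ifP => uF; case: ifP => vF; rewrite ?mulr0 ?oppr0 //.
rewrite !mulrA -!exprD !num_beforeU ?uF ?vF // -mulNr setUCA; congr (_ * _).
by rewrite addnC [in RHS]addnC; apply: sign_rank_swap; rewrite eq_sym.
Qed.

Lemma contract_wedge u v g F : u != v ->
  contract u (wedge v g) F = - wedge v (contract u g) F.
Proof.
move=> uv; rewrite /contract /wedge !inE [v == u]eq_sym (negPf uv) /=.
case: ifP => uF; case: ifP => vF; rewrite ?mulr0 ?oppr0 //.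
rewrite !mulrA -!exprD num_beforeU ?uF // (num_beforeD1 u vF) -mulNr.
have -> : (u |: F) :\ v = u |: F :\ v.
  by apply/setP=> x; rewrite !inE; case: (eqVneq x u) => // ->; rewrite uv.
congr (_ * _); rewrite sign_rank_swap // addnA addnn -addnA exprD.
by rewrite -[X in X * _]signr_odd odd_double mul1r.
Qed.

Lemma contract_wedge_id v g F : contract v (wedge v g) F + wedge v (contract v g) F = g F.
Proof.
have sq n : (-1) ^+ n * (-1) ^+ n = 1 :> R by rewrite -expr2 sqrr_sign.
rewrite /contract /wedge !inE eqxx /=; case: ifP => vF; rewrite ?add0r ?addr0 mulrA.
  by rewrite (num_beforeD1 v vF) ltnn add0n sq mul1r setD1K.
by rewrite num_beforeU ?vF // ltnn add0n sq mul1r setU1K ?vF.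
Qed.

(** Cochains are functions on all subsets. As subsets of independent sets are independent, the value
    at a face involves only faces, so no restriction is built in. *)
Definition cobd g F : R := \sum_(v in F) (-1) ^+ num_before v F * g (F :\ v).

Lemma cobdE g F : cobd g F = \sum_v wedge v g F.
Proof. by rewrite /cobd big_mkcond. Qed.

Lemma eq_wedge v g h F : (forall G, g G = h G) -> wedge v g F = wedge v h F.
Proof. by rewrite /wedge => ->. Qed.

Lemma eq_contract v g h F : (forall G, g G = h G) -> contract v g F = contract v h F.
Proof. by rewrite /contract => ->. Qed.

Lemma wedge_sum (I : finType) v (g : I -> {set T} -> R) F :
  wedge v (fun G => \sum_i g i G) F = \sum_i wedge v (g i) F.
Proof. by rewrite /wedge; case: ifP => _; (rewrite mulr_sumr || rewrite big1). Qed.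

Lemma contract_sum (I : finType) v (g : I -> {set T} -> R) F :
  contract v (fun G => \sum_i g i G) F = \sum_i contract v (g i) F.
Proof. by rewrite /contract; case: ifP => _; (rewrite mulr_sumr || rewrite big1). Qed.

Lemma cobd_cobd g F : cobd (cobd g) F = 0.
Proof.
rewrite cobdE; under eq_bigr => v _.
  rewrite (eq_wedge _ _ (cobdE g)) wedge_sum; over.
apply: antisym_sum0 => [v|u v]; last exact: wedgeC.
by rewrite /wedge !inE eqxx mulr0 if_same.
Qed.

Lemma cobd_wedge v g F : cobd (wedge v g) F = - wedge v (cobd g) F.
Proof.
rewrite cobdE (eq_wedge _ _ (cobdE g)) wedge_sum -sumrN.
by apply: eq_bigr => u _; rewrite wedgeC.
Qed.

(** Cartan's formula: on the full simplex, contraction by [v] is a homotopy from the identity to 0.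
    On an independence complex the argument is obstructed only at faces that cannot be enlarged by
    [v]; the vanishing and lifting lemmas control this defect. *)
Lemma cobd_contract v g F : cobd (contract v g) F + contract v (cobd g) F = g F.
Proof.
rewrite cobdE (eq_contract _ _ (cobdE g)) contract_sum -big_split /=.
rewrite (bigD1 v) //= big1 ?addr0 => [|u uv].
  by rewrite addrC contract_wedge_id.
by rewrite contract_wedge 1?eq_sym // subrr.
Qed.

Lemma cobdD g h F : cobd (fun G => g G + h G) F = cobd g F + cobd h F.
Proof. by rewrite -big_split; apply: eq_bigr => v _; rewrite mulrDr. Qed.

Lemma cobdN g F : cobd (fun G => - g G) F = - cobd g F.
Proof. by rewrite -sumrN; apply: eq_bigr => v _; rewrite mulrN. Qed.

Lemma cobdB g h F : cobd (fun G => g G - h G) F = cobd g F - cobd h F.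
Proof. by rewrite cobdD cobdN. Qed.

End Exterior.

(** * Cohomology of independence complexes *)

Section Cochains.
Local Open Scope ring_scope.
Variables (T : finType) (e : rel T).
Hypotheses (e_sym : symmetric e) (e_irr : irreflexive e).
Implicit Types (X Y F G N : {set T}) (s : nat) (u v : T) (g h k : {set T} -> int) (m p : int).

Local Notation indep := (independence_complex e).

Definition nbrs X v := [set u in X | e v u].
Definition link X v := [set u in X | (u != v) && ~~ e v u].

Lemma indepP F : reflect {in F &, forall u v, ~~ e u v} (F \in indep).
Proof.
rewrite inE; apply: (iffP forall_inP) => [H u v uF vF | H u uF].
  by move/forall_inP: (H u uF); apply.
by apply/forall_inP=> v vF; apply: H.
Qed.

Lemma indepS F G : G \subset F -> F \in indep -> G \in indep.
Proof. by move=> /subsetP GF /indepP H; apply/indepP=> u v uG vG; apply: H; apply: GF. Qed.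

Lemma indepU1 v F : F \in indep -> {in F, forall u, ~~ e v u} -> v |: F \in indep.
Proof.
move=> /indepP FI vF; apply/indepP => x y.
rewrite !inE => /predU1P[->|xF] /predU1P[->|yF]; rewrite ?e_irr ?vF //.
  by rewrite e_sym vF.
exact: FI.
Qed.

Definition face X s F := [&& F \subset X, F \in indep & #|F| == s].

Lemma faceD1 X s F v : v \in F -> face X s.+1 F -> face X s (F :\ v).
Proof.
move=> vF /and3P[FX FI /eqP cF]; apply/and3P; split.
- exact: subset_trans (subsetDl _ _) FX.
- exact: indepS (subsetDl _ _) FI.
- by move: cF; rewrite (cardsD1 v) vF add1n => -[->].
Qed.

Lemma face_link X s F v : v \in F -> face X s.+1 F -> face (link X v) s (F :\ v).
Proof.
move=> vF fF; have /and3P[FX FI cF] := faceD1 vF fF; apply/and3P; split=> //.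
apply/subsetP=> u uF; rewrite inE (subsetP FX) //=.
move: uF; rewrite !inE => /andP[-> uF] /=.
by have /and3P[_ /indepP -> ] := fF.
Qed.

Lemma face_subset X Y s F : X \subset Y -> face X s F -> face Y s F.
Proof. by move=> XY /and3P[FX FI cF]; apply/and3P; split=> //; apply: subset_trans XY. Qed.

Lemma face_setU1 X s F v : v \in X -> v \notin F -> {in F, forall u, ~~ e v u} ->
  face X s F -> face X s.+1 (v |: F).
Proof.
move=> vX vF vI /and3P[FX FI /eqP cF]; apply/and3P; split.
- by rewrite subUset sub1set vX.
- exact: indepU1.
- by rewrite cardsU1 vF cF.
Qed.

Lemma link_subset X v : link X v \subset X.
Proof. by apply/subsetP=> u; rewrite inE => /andP[]. Qed.

Lemma link_subsetD1 X v : link X v \subset X :\ v.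
Proof. by apply/subsetP=> u; rewrite !inE => /and3P[-> -> _]. Qed.

Lemma face_linkU1 X s F v : v \in X -> face (link X v) s F ->
  v \notin F /\ face X s.+1 (v |: F).
Proof.
move=> vX fF; have /and3P[/subsetP FX _ _] := fF.
have vF : v \notin F by apply/negP=> /FX; rewrite !inE eqxx andbF.
split=> //; apply: face_setU1 => //; last exact: face_subset (link_subset _ _) fF.
by move=> u /FX; rewrite inE => /and3P[].
Qed.

(* Reduced cohomology of the complex of independent subsets of [X], with
   coefficients in Z/m (in Z for [m = 0]) and integer-valued representatives;
   the degree of a cochain is recorded as the cardinality [s] of the faces on
   which it is evaluated, one more than their dimension. *)
Definition cocycle m X s g := forall F, face X s.+1 F -> (m %| cobd g F)%Z.
Definition coboundary m X s g :=
  exists k, forall F, face X s F -> (m %| g F - cobd k F)%Z.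
Definition acyclic m X s := forall g, cocycle m X s g -> coboundary m X s g.

Definition liftable p X s g := exists2 g', cocycle 0 X s g' &
  forall F, face X s F -> (p %| g' F - g F)%Z.
(* For [p] prime this says that the integral cohomology in the next degree has
   no [p]-torsion. *)
Definition cocycles_lift p X s := forall g, cocycle p X s g -> liftable p X s g.

Lemma cocycle_subset m X Y s g : X \subset Y -> cocycle m Y s g -> cocycle m X s g.
Proof. by move=> XY gY F /(face_subset XY)/gY. Qed.

Lemma coboundary_subset m X Y s g : X \subset Y -> coboundary m Y s g -> coboundary m X s g.
Proof. by move=> XY [k gY]; exists k => F /(face_subset XY)/gY. Qed.

Lemma cocycleB m X s g k : cocycle m X s g -> cocycle m X s (fun G => g G - cobd k G).
Proof. by move=> gX F fF; rewrite cobdB cobd_cobd subr0 gX. Qed.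

Lemma dvdz_sign m n (a : int) : (m %| (-1) ^+ n * a)%Z = (m %| a)%Z.
Proof. by rewrite -signr_odd; case: odd; rewrite ?expr0 ?expr1 ?mul1r ?mulN1r ?rpredN. Qed.

Lemma contract_cobd_dvd m X s F g v : v \in X -> {in F, forall u, ~~ e v u} ->
  cocycle m X s g -> face X s F -> (m %| contract v (cobd g) F)%Z.
Proof.
move=> vX vI gX fF; rewrite /contract; case: ifPn => // vF.
by rewrite dvdz_sign gX // face_setU1.
Qed.

(** The complex is a cone with apex [v], and contraction by [v] is its contracting homotopy. *)
Lemma acyclic_cone m X s v : v \in X -> nbrs X v = set0 -> acyclic m X s.
Proof.
move=> vX vN g gX; exists (contract v g) => F fF.
rewrite -[g F](cobd_contract v) addrC addKr; apply: contract_cobd_dvd gX _ => // u uF.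
have /and3P[/subsetP FX _ _] := fF.
by apply/negP=> vu; have := in_set0 u; rewrite -vN inE FX // vu.
Qed.

Lemma wedge_contract v g F : v \in F -> wedge v (contract v g) F = g F.
Proof.
move=> vF; have := contract_wedge_id v g F.
by rewrite {1}/contract vF add0r.
Qed.

(** This is the long exact sequence of link, [X] and deletion at its middle term. After subtraction
    of a primitive on the deletion, the cocycle vanishes modulo [m] off [v], so it is determined by
    its contraction, a cocycle of the link. *)
Lemma acyclic_del_link m X s v : v \in X ->
  acyclic m (X :\ v) s.+1 -> acyclic m (link X v) s -> acyclic m X s.+1.
Proof.
move=> vX adel alk g gX.
have [k kP] := adel g (cocycle_subset (subsetDl _ _) gX).
pose g1 G := g G - cobd k G.
have g1X : cocycle m X s.+1 g1 := cocycleB k gX.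
have [|l lP] := alk (contract v g1).
  move=> F fF; have [vF fvF] := face_linkU1 vX fF.
  have := cobd_contract v g1 F => /(canRL (addrK _)) ->.
  rewrite rpredB ?kP ?(face_subset (link_subsetD1 _ _) fF) //.
  by rewrite /contract (negPf vF) dvdz_sign g1X.
exists (fun G => k G - wedge v l G) => F fF.
rewrite cobdB cobd_wedge opprK opprD addrA -/(g1 F).
have [vF|vF] := boolP (v \in F); last first.
  rewrite /wedge (negPf vF) subr0 kP //; have /and3P[FX FI cF] := fF.
  by apply/and3P; split=> //; rewrite subsetD1 FX.
have := lP _ (face_link vF fF).
rewrite -(dvdz_sign _ (num_before v F)) mulrBr.
by have := wedge_contract g1 vF; rewrite {1}/wedge vF => ->; rewrite /wedge vF.
Qed.

Lemma card_link X v : v \in X -> (#|X| = (#|link X v| + #|nbrs X v|).+1)%N.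
Proof.
move=> vX; rewrite (cardsD1 v) vX add1n; congr _.+1.
rewrite -(cardsID [set u | e v u] (X :\ v)) addnC; congr addn.
  by apply: eq_card => u; rewrite !inE andbC -andbA andbCA.
apply: eq_card => u; rewrite !inE; case: eqP => [->|_] //=.
by rewrite e_irr andbF.
Qed.

Lemma nbrs0P X v : #|nbrs X v| = 0%N -> nbrs X v = set0.
Proof. by move/eqP; rewrite cards_eq0 => /eqP. Qed.

(** Passing to the link of a vertex with a neighbour loses at least two vertices while [s] drops by
    one; deleting it loses one vertex for the same [s]. A vertex without neighbours is a cone apex.
    The extremal case is the boundary of a cross-polytope, on [2 s] vertices. *)
Lemma acyclic_small m s X : (#|X| < s.*2)%N -> acyclic m X s.
Proof.
move: {2}#|X| (leqnn #|X|) => n; elim: s n X => // s IHs n.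
elim: n => [|n IHn] X leX ltX.
  move=> g _; exists g => F /and3P[FX _ /eqP cF].
  by move: (subset_leq_card FX); rewrite cF ltnNge (leq_trans leX).
have [X0|[v vX]] := set_0Vmem X; first by apply: IHn; rewrite X0 cards0.
have [/nbrs0P|nb] := posnP #|nbrs X v|; first exact: acyclic_cone.
have cX := card_link vX; have cXv := cardsD1 v X; rewrite vX add1n in cXv.
apply: (acyclic_del_link vX).
  by apply: IHn; rewrite -ltnS -cXv // ltnW.
apply: (IHs #|link X v|) => //; move: ltX; rewrite cX doubleS !ltnS => ltX.
by apply: leq_trans ltX; rewrite -addn1 leq_add2l.
Qed.

(** In the extremal case of [acyclic_small], a vertex without neighbours is a cone apex, and one
    with two or more has a link too small to carry cohomology. *)
Lemma acyclic_matching m s X v :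
  #|X| = s.*2 -> v \in X -> #|nbrs X v| != 1%N -> acyclic m X s.
Proof.
case: s => [/eqP|s cX vX]; first by rewrite cards_eq0 => /eqP->; rewrite inE.
case nb: #|nbrs X v| => [|[|n]] // _; first exact: acyclic_cone (nbrs0P nb).
have := card_link vX; have := cardsD1 v X; rewrite cX vX nb add1n => cXv cXl.
apply: (acyclic_del_link vX); apply: acyclic_small; first by rewrite -cXv.
move: cXl; rewrite doubleS !addnS => -[->].
by rewrite ltnS leq_addr.
Qed.

(** Deleting [y] isolates [x] and leaves a cone, so only the link of [y] can contribute. *)
Lemma acyclic_pendant m s X x y : x \in X -> nbrs X x = [set y] ->
  acyclic m (link X y) s -> acyclic m X s.+1.
Proof.
move=> xX xN; have : y \in nbrs X x by rewrite xN set11.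
rewrite inE => /andP[yX exy]; apply: acyclic_del_link => //.
have xy : x != y by apply: contraTneq exy => ->; rewrite e_irr.
apply: (@acyclic_cone _ _ _ x); first by rewrite !inE xy.
apply/setP=> u; have := congr1 (fun A : {set T} => u \in A) xN.
by rewrite !inE; case: eqP => // _ /=.
Qed.

(** If the integral cohomology of the link vanishes on faces of size s + 1, that of [X] on faces of
    size s + 2 embeds into that of the deletion, and torsion-freeness passes back. The proof carries
    this out on cochains, by gluing a lift on the deletion to values on faces through [v]. *)
Lemma lifts_del_link p X s v : p != 0 -> v \in X ->
    cocycles_lift p (X :\ v) s.+1 -> acyclic 0 (link X v) s.+1 ->
  cocycles_lift p X s.+1.
Proof.
move=> p0 vX ldel alk g gX.
have [g1 g1X g1g] := ldel g (cocycle_subset (subsetDl _ _) gX).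
pose f := contract v g.
(* The lift [g1] and the coboundary of [f] need only agree modulo [p] on the link. [chi] is the
   integral obstruction to gluing; its primitive corrects [f] by a multiple of [p], which leaves
   residues unchanged. *)
pose chi G := ((g1 G - cobd f G) %/ p)%Z.
have chiE F : face (link X v) s.+1 F -> g1 F - cobd f F = chi F * p.
  move=> fF; rewrite divzK //.
  have [vF fvF] := face_linkU1 vX fF.
  have := cobd_contract v g F => /(canRL (addrK _)) ->.
  rewrite opprB addrA addrAC rpredD ?g1g ?(face_subset (link_subsetD1 _ _) fF) //.
  by rewrite /contract (negPf vF) dvdz_sign gX.
have [|k kP] := alk chi.
  move=> F fF; rewrite dvd0z -(inj_eq (mulIf p0)) mul0r /cobd mulr_suml.
  under eq_bigr => x xF do rewrite -mulrA -chiE ?faceD1 //.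
  rewrite -/(cobd (fun G => g1 G - cobd f G) F) cobdB cobd_cobd subr0 -dvd0z.
  by rewrite g1X // (face_subset (link_subsetD1 _ _)).
pose h G := f G + k G * p.
pose g' G := if v \in G then wedge v h G else g1 G.
exists g' => F fF; last first.
  rewrite /g'; have [vF|vF] := boolP (v \in F); last first.
    by apply: g1g; have /and3P[FX FI cF] := fF; apply/and3P; rewrite subsetD1 FX.
  rewrite /wedge vF mulrDr.
  have := wedge_contract g vF; rewrite {1}/wedge vF => ->.
  by rewrite addrC addKr dvdz_sign dvdz_mull.
rewrite dvd0z; have [vF|vF] := boolP (v \in F); last first.
  have /and3P[FX FI cF] := fF; rewrite -dvd0z.
  have -> : cobd g' F = cobd g1 F.
    by apply: eq_bigr => x xF; rewrite /g' !inE (negPf vF) andbF.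
  by apply: g1X; apply/and3P; rewrite subsetD1 FX.
have fFv := face_link vF fF.
have -> : cobd g' F = (-1) ^+ num_before v F * g1 (F :\ v) + cobd (wedge v h) F.
  rewrite /cobd (bigD1 v) //= [in RHS](bigD1 v) //= /g' !inE eqxx /=; congr (_ + _).
  rewrite [X in X + _](_ : _ = 0) ?add0r; last by rewrite /wedge !inE eqxx mulr0.
  by apply: eq_bigr => x /andP[_ xv]; rewrite !inE eq_sym xv vF.
rewrite cobd_wedge /wedge vF -mulrBr mulf_eq0 signr_eq0 /=.
rewrite /h cobdD opprD addrA chiE //.
have := kP _ fFv; rewrite dvd0z subr_eq0 => /eqP ->; apply/eqP.
rewrite /cobd mulr_suml; apply/eqP; rewrite subr_eq0; apply/eqP.
by apply: eq_bigr => x _; rewrite mulrA.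
Qed.

(** A face contains at most one vertex of the clique [N]. Once the cocycle vanishes modulo [p] off
    [N], it splits into contractions to the links of the vertices of [N], which are lifted
    independently and wedged back. *)
Lemma lifts_clique p X s N : N \subset X ->
    {in N &, forall x y, x != y -> e x y} -> acyclic p (X :\: N) s.+1 ->
    {in N, forall y, cocycles_lift p (link X y) s} ->
  cocycles_lift p X s.+1.
Proof.
move=> NX Ncl adel llk g gX.
have [k kP] := adel g (cocycle_subset (subsetDl _ _) gX).
pose g1 G := g G - cobd k G.
have g1X : cocycle p X s.+1 g1 := cocycleB k gX.
have H y : exists f : {set T} -> int, y \in N -> cocycle 0 (link X y) s f /\
    forall F, face (link X y) s F -> (p %| f F - contract y g1 F)%Z.
  have [yN|] := boolP (y \in N); last by exists g1.
  have [|f f0 fg] := llk y yN (contract y g1); last by exists f.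
  move=> F fF; have [yF fyF] := face_linkU1 (subsetP NX _ yN) fF.
  have := cobd_contract y g1 F => /(canRL (addrK _)) ->.
  rewrite rpredB //; last by rewrite /contract (negPf yF) dvdz_sign g1X.
  have /and3P[/subsetP FX FI cF] := fF.
  apply/kP/and3P; split=> //; apply/subsetP=> u /FX; rewrite !inE.
  case/and3P=> -> uy yu; rewrite andbT; apply: contra yu => uN.
  by apply: Ncl => //; rewrite eq_sym.
have [f fP] := fin_all_exists H.
pose g' G := \sum_(y in N) wedge y (f y) G.
exists (fun G => g' G + cobd k G) => F fF.
  rewrite cobdD cobd_cobd addr0 /cobd.
  under eq_bigr do rewrite mulr_sumr.
  rewrite exchange_big /= rpred_sum // => y yN; rewrite -/(cobd (wedge y (f y)) F).
  rewrite cobd_wedge rpredN /wedge; case: ifP => // yF.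
  by rewrite dvdz_sign; apply: (fP y yN).1; apply: face_link.
rewrite -addrA -opprB -/(g1 F); have /and3P[/subsetP FX FI cF] := fF.
have [/existsP[y /andP[yF yN]]|noy] := boolP [exists y, (y \in F) && (y \in N)].
  rewrite /g' (bigD1 y) //= [X in _ + X - _]big1 ?addr0 => [|z /andP[zN zy]]; last first.
    rewrite /wedge ifN //; apply/negP=> zF.
    by have /indepP/(_ z y zF yF) := FI; rewrite Ncl.
  rewrite -(wedge_contract g1 yF) /wedge yF -mulrBr dvdz_sign.
  by apply: (fP y yN).2; apply: face_link.
rewrite /g' big1 ?sub0r ?rpredN => [|y yN].
  apply/kP/and3P; split=> //; apply/subsetP=> u uF; rewrite inE FX // andbT.
  by move: noy; rewrite negb_exists => /forallP/(_ u); rewrite uF.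
rewrite /wedge ifN //; apply/negP=> yF.
by move: noy; rewrite negb_exists => /forallP/(_ y); rewrite yF yN.
Qed.

End Cochains.

(** * Cochains on vertices, edges and triangles *)

Section LowDegree.
Local Open Scope ring_scope.
Variables (T : finType) (e : rel T).
Hypotheses (e_sym : symmetric e) (e_irr : irreflexive e).
Implicit Types (X F G M : {set T}) (s : nat) (a b c u v : T) (g h k : {set T} -> int) (m p : int).

Lemma num_before1 (a b : T) : num_before a [set b] = (enum_rank b < enum_rank a)%N.
Proof.
rewrite -[[set b]]setU0 num_beforeU ?inE // /num_before.
rewrite (_ : [set f in set0 | _] = set0) ?cards0 ?addn0 //.
by apply/setP=> f; rewrite !inE.
Qed.

Lemma cobd1 g a : cobd g [set a] = g set0.
Proof. by rewrite /cobd big_set1 num_before1 ltnn mul1r setDv. Qed.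

Lemma cobd2 g a b : a != b ->
  cobd g [set a; b] = (-1) ^+ (enum_rank b < enum_rank a)%N * (g [set b] - g [set a]).
Proof.
move=> ab; have aNb : a \notin [set b] by rewrite inE.
rewrite /cobd big_setU1 //= big_set1 !num_beforeU // !num_before1 ltnn add0n.
rewrite ltnn addn0 setU1K // [X in _ + X * _]sign_rank // mulNr -mulrBr.
congr (_ * (_ - g _)); apply/setP=> u; rewrite !inE.
by case: (eqVneq u a) => [->|]; rewrite ?ab //= andNb.
Qed.

(** The value on the edge oriented from [a] to [b], which frees triangle identities from the chosen
    order of vertices. *)
Definition edge_value g a b := (-1) ^+ (enum_rank b < enum_rank a)%N * g [set a; b].

Lemma edge_valueC g a b : a != b -> edge_value g a b = - edge_value g b a.
Proof. by move=> ab; rewrite /edge_value setUC sign_rank 1?eq_sym // mulNr. Qed.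

Lemma cobd3 g a b c : a != b -> b != c -> c != a ->
  exists n, cobd g [set a; b; c]
    = (-1) ^+ n * (edge_value g a b + edge_value g b c + edge_value g c a).
Proof.
move=> ab bc ca.
have bNc : b \notin [set c] by rewrite inE.
have aNbc : a \notin [set b; c] by rewrite !inE negb_or ab eq_sym.
have -> : [set a; b; c] = a |: [set b; c] by rewrite setUA.
rewrite /cobd big_setU1 //= big_setU1 //= big_set1 !num_beforeU //.
rewrite !num_before1 !ltnn setU1K //.
have -> : (a |: [set b; c]) :\ b = [set c; a].
  apply/setP=> u; rewrite !inE; case: (eqVneq u b) => [->|ub] /=.
    by rewrite (negPf bc) eq_sym (negPf ab).
  by rewrite orbC.
have -> : (a |: [set b; c]) :\ c = [set a; b].
  apply/setP=> u; rewrite !inE; case: (eqVneq u c) => [->|uc] /=.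
    by rewrite (negPf ca) eq_sym (negPf bc).
  by rewrite orbF.
rewrite /edge_value.
have r (u v : T) : u != v -> (enum_rank u < enum_rank v)%N = ~~ (enum_rank v < enum_rank u)%N.
  by move=> uv; rewrite -leqNgt ltn_neqAle (inj_eq val_inj) (inj_eq enum_rank_inj) uv.
(* The number of inversions of the triple (a, b, c), that is, the sign of its orientation of the
   triangle. *)
exists ((enum_rank b < enum_rank a) + (enum_rank c < enum_rank b)
       + (enum_rank c < enum_rank a))%N.
rewrite (r a b ab) (r b c bc) (r a c) 1?eq_sym //.
by case: (enum_rank b < _)%N; case: (enum_rank c < enum_rank b)%N;
  case: (enum_rank c < _)%N; rewrite /= ?addn0 ?add0n; ring.
Qed.

Lemma face1P X (x : T) : x \in X -> face e X 1 [set x].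
Proof.
move=> xX; rewrite /face sub1set xX cards1 eqxx andbT /=.
by apply/indepP=> u v; rewrite !inE => /eqP-> /eqP->; rewrite e_irr.
Qed.

Lemma face2E X (a b : T) : a \in X -> b \in X -> a != b -> ~~ e a b -> face e X 2 [set a; b].
Proof.
move=> aX bX ab eab; apply: face_setU1; rewrite ?inE // ?face1P //.
by move=> u; rewrite inE => /eqP->.
Qed.

(** On vertices, a cocycle has equal residues at both ends of each 1-face, and canonical residues
    turn this into equality. On the empty face, a cocycle is 0 modulo [p] as soon as there is a
    vertex. *)
Lemma liftable_small p X s g : (s < 2)%N -> cocycle e p X s g -> liftable e p X s g.
Proof.
case: s => [_ gX|[_ gX|]] //.
  exists (fun _ => if X == set0 then g set0 else 0) => F.
    case/and3P => FX _ /cards1P[x Fx]; have xX : x \in X by rewrite -sub1set -Fx.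
    by rewrite /cobd ifN ?big1 ?dvdz0 // => [u|]; rewrite ?mulr0 //; apply/set0Pn; exists x.
  case/and3P=> _ _; rewrite cards_eq0 => /eqP->; case: (set_0Vmem X) => [->|[x xX]].
    by rewrite eqxx subrr dvdz0.
  rewrite ifN; last by apply/set0Pn; exists x.
  by rewrite sub0r rpredN -(cobd1 g x) gX // face1P.
exists (fun G => (g G %% p)%Z) => F fF; last first.
  by rewrite -eqz_mod_dvd modz_mod.
have /and3P[_ _ /cards2P[a [b [ab Fab]]]] := fF; have := gX F fF.
rewrite Fab !cobd2 // !dvdz_sign -eqz_mod_dvd => /eqP ->.
by rewrite subrr dvdz0.
Qed.

Lemma cards3P F : #|F| = 3%N ->
  exists a b c, [/\ a != b, b != c, c != a & F = [set a; b; c]].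
Proof.
move=> cF; have : F != set0 by rewrite -card_gt0 cF.
case/set0Pn=> c cFin; have := cardsD1 c F; rewrite cF cFin add1n => -[/esym/eqP/cards2P].
case=> a [b [ab Fab]]; exists a, b, c.
have : c \notin F :\ c by rewrite !inE eqxx.
rewrite Fab !inE negb_or => /andP[ca cb]; split=> //; first by rewrite eq_sym.
by rewrite -(setD1K cFin) Fab setUC.
Qed.

End LowDegree.

(** * Lifting edge cocycles across a partition of the vertices *)

Section Split.
Local Open Scope ring_scope.
Variables (T : finType) (e : rel T).
Hypotheses (e_sym : symmetric e) (e_irr : irreflexive e).
Implicit Types (X F G M : {set T}) (s : nat) (a b c u v : T) (g h k : {set T} -> int) (m p : int).

(* Once the cocycle vanishes inside [M] and inside its complement, its values
   on the mixed edges are constant along mixed triangles, so that reducing them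
   modulo [p] gives an integral cocycle. *)
Lemma liftable_split p X M g : M \subset X -> acyclic e p (X :\: M) 2 ->
  coboundary e p M 2 g -> cocycle e p X 2 g -> liftable e p X 2 g.
Proof.
move=> MX acy [k2 k2P] gX.
have [k1 k1P] := acy g (cocycle_subset (subsetDl _ _) gX).
(* A single vertex lies on one side only, so the primitives of the two sides glue without
   conflict. *)
pose k G := if G \subset M then k2 G else k1 G.
pose g1 G := g G - cobd k G.
have g1X : cocycle e p X 2 g1 := cocycleB k gX.
pose r a b := (edge_value g1 a b %% p)%Z.
(* On a two-element face the double sum has one term if the face is mixed, oriented from outside [M]
   into [M], and none otherwise. *)
pose g' G := \sum_(c in G | c \notin M) \sum_(w in G | w \in M)
   (-1) ^+ (enum_rank w < enum_rank c)%N * r c w.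
have same a b F : F = [set a; b] -> a != b -> face e X 2 F -> (a \in M) = (b \in M) ->
    (p %| g1 F)%Z /\ g' F = 0.
  move=> -> ab /and3P[]; rewrite subUset !sub1set => /andP[aX bX] FI cF.
  case aM: (a \in M) => /esym bM; split.
  - have -> : g1 [set a; b] = g [set a; b] - cobd k2 [set a; b].
      by rewrite /g1 !cobd2 // /k !sub1set aM bM.
    by apply/k2P; rewrite /face FI cF subUset !sub1set aM bM.
  - rewrite /g' big_pred0 // => x; rewrite !inE.
    by case: eqP => [->|_]; rewrite ?aM // ; case: eqP => [->|_]; rewrite ?bM.
  - have -> : g1 [set a; b] = g [set a; b] - cobd k1 [set a; b].
      by rewrite /g1 !cobd2 // /k !sub1set aM bM.
    by apply/k1P; rewrite /face FI cF subUset !sub1set !inE aM bM aX bX.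
  - rewrite /g' big1 // => x _; rewrite big_pred0 // => y; rewrite !inE.
    by case: eqP => [->|_]; rewrite ?aM // ; case: eqP => [->|_]; rewrite ?bM.
have mixed a b : a \notin M -> b \in M ->
    g' [set a; b] = (-1) ^+ (enum_rank b < enum_rank a)%N * r a b.
  move=> aM bM; rewrite /g' (big_pred1 a) => [|x]; last first.
    rewrite !inE; case: eqP => [->|_] //=.
    by case: eqP => [->|_]; rewrite ?bM.
  rewrite (big_pred1 b) // => x; rewrite !inE.
  by case: (eqVneq x b) => [->|_]; rewrite ?orbT ?orbF //=; case: eqP => [->|_] //; rewrite (negPf aM).
have pair3 a b c F : face e X 3 F -> F = [set a; b; c] -> a != b -> b != c -> c != a ->
    [/\ face e X 2 [set a; b], face e X 2 [set b; c] & face e X 2 [set c; a]].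
  move=> /and3P[+ /indepP FI _] FE ab bc ca; rewrite FE !subUset !sub1set => /andP[/andP[aX bX] cX].
  by split; apply: face2E => //; apply: FI; rewrite FE !inE eqxx ?orbT.
have ev0 a b : face e X 2 [set a; b] -> a != b -> (a \in M) = (b \in M) ->
    (p %| edge_value g1 a b)%Z /\ edge_value g' a b = 0.
  move=> fF ab abM; have [pg g0] := same a b _ erefl ab fF abM.
  by rewrite /edge_value dvdz_sign g0 mulr0.
have evm a b : a \notin M -> b \in M -> edge_value g' a b = r a b.
  by move=> aM bM; rewrite /edge_value mixed // mulrA -expr2 sqrr_sign mul1r.
have evm' a b : a \in M -> b \notin M -> edge_value g' a b = - r b a.
  move=> aM bM; rewrite edge_valueC ?evm //.
  by apply: contraNneq bM => <-.
have tri a b c F : face e X 3 F -> F = [set a; b; c] -> a != b -> b != c -> c != a ->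
    (a \in M) = (b \in M) -> (p %| edge_value g1 b c + edge_value g1 c a)%Z.
  move=> fF FE ab bc ca abM; have [fab _ _] := pair3 a b c F fF FE ab bc ca.
  have := g1X F fF; have [n] := cobd3 g1 ab bc ca; rewrite -FE => ->; rewrite dvdz_sign.
  by rewrite -addrA rpredDl // (ev0 a b fab ab abM).1.
have rot a b c : [set a; b; c] = [set b; c; a] by rewrite -setUA setUC.
exists (fun G => g' G + cobd k G) => F fF; last first.
  have -> : g' F + cobd k F - g F = g' F - g1 F by rewrite /g1; ring.
  have /and3P[_ _ /cards2P[a [b [ab FE]]]] := fF.
  have mix x y : F = [set x; y] -> x \notin M -> y \in M -> (p %| g' F - g1 F)%Z.
    move=> -> xM yM; rewrite mixed // -(dvdz_sign _ (enum_rank y < enum_rank x)%N).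
    rewrite mulrBr mulrA -expr2 sqrr_sign mul1r.
    by rewrite -eqz_mod_dvd modz_mod.
  case aM: (a \in M); case bM: (b \in M).
  - by have [pg ->] := same a b F FE ab fF (etrans aM (esym bM)); rewrite sub0r rpredN.
  - by apply: (mix b a); rewrite ?bM // setUC.
  - by apply: (mix a b); rewrite ?aM.
  - by have [pg ->] := same a b F FE ab fF (etrans aM (esym bM)); rewrite sub0r rpredN.
rewrite cobdD cobd_cobd addr0 dvd0z.
have /and3P[_ _ /eqP /cards3P[a [b [c [ab bc ca FE]]]]] := fF.
have [n] := cobd3 g' ab bc ca; rewrite -FE => ->; rewrite mulf_eq0 signr_eq0 /=.
have [fab fbc fca] := pair3 a b c F fF FE ab bc ca.
have FE2 := etrans FE (rot a b c); have FE3 := etrans FE2 (rot b c a).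
have key x y z : F = [set x; y; z] -> x != y -> y != z -> z != x ->
   (x \in M) = (y \in M) -> (z \in M) = ~~ (x \in M) ->
   edge_value g' y z + edge_value g' z x = 0.
  move=> FE' xy yz zx xyM zM.
  have := tri x y z F fF FE' xy yz zx xyM.
  case xM: (x \in M); rewrite xM in xyM zM.
    rewrite evm' ?evm ?zM -?xyM ?xM //.
    rewrite edge_valueC // addrC -eqz_mod_dvd => /eqP rE.
    by rewrite addrC; apply/eqP; rewrite subr_eq0; apply/eqP; exact: rE.
  rewrite evm ?evm' ?zM -?xyM ?xM //.
  rewrite [edge_value g1 z x]edge_valueC // -eqz_mod_dvd => /eqP rE.
  by apply/eqP; rewrite subr_eq0; apply/eqP; exact: rE.
case aM: (a \in M); case bM: (b \in M); case cM: (c \in M).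
- by rewrite !(ev0 _ _ _ _ _).2 ?aM ?bM ?cM // eq_sym.
- by rewrite (ev0 a b _ _ _).2 ?aM ?bM // add0r key ?aM ?bM ?cM.
- by rewrite (ev0 c a _ _ _).2 ?aM ?bM ?cM // addr0 key ?aM ?bM ?cM // -FE3.
- by rewrite (ev0 b c _ _ _).2 ?aM ?bM ?cM // addr0 addrC key ?aM ?bM ?cM // -FE2.
- by rewrite (ev0 b c _ _ _).2 ?aM ?bM ?cM // addr0 addrC key ?aM ?bM ?cM // -FE2.
- by rewrite (ev0 c a _ _ _).2 ?aM ?bM ?cM // addr0 key ?aM ?bM ?cM // -FE3.
- by rewrite (ev0 a b _ _ _).2 ?aM ?bM // add0r key ?aM ?bM ?cM.
- by rewrite !(ev0 _ _ _ _ _).2 ?aM ?bM ?cM // eq_sym.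
Qed.

End Split.

(** * Minimal counterexamples *)

Section Combinatorics.
Variables (T : finType) (e : rel T).
Hypotheses (e_sym : symmetric e) (e_irr : irreflexive e).
Implicit Types (X S A B : {set T}) (s : nat) (a b c d u v w x y z : T).

Lemma in_nbrs X u v : (u \in nbrs e X v) = (u \in X) && e v u.
Proof. by rewrite inE. Qed.

Lemma in_link X u v : (u \in link e X v) = [&& u \in X, u != v & ~~ e v u].
Proof. by rewrite inE. Qed.

Lemma nbrs_inj S a b c : #|nbrs e S a| = 1 -> b \in S -> e a b -> c \in S -> e a c -> b = c.
Proof.
move=> /eqP/cards1P[d Sa] bS ab cS ac.
have : b \in nbrs e S a by rewrite in_nbrs bS.
have : c \in nbrs e S a by rewrite in_nbrs cS.
by rewrite Sa !inE => /eqP-> /eqP->.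
Qed.

Lemma nbrs_ex S a : #|nbrs e S a| = 1 -> exists2 b, b \in S & e a b.
Proof.
move=> /eqP/cards1P[d Sa]; exists d; have : d \in nbrs e S a by rewrite Sa set11.
  by rewrite in_nbrs => /andP[].
by rewrite in_nbrs => /andP[].
Qed.

Lemma e_neq a b : e a b -> a != b.
Proof. by apply: contraTneq => ->; rewrite e_irr. Qed.

(* [a, b, c, d] is a 4-cycle of the complementary graph. *)
Lemma matching4 S a : #|S| = 4 -> {in S, forall u, #|nbrs e S u| = 1} -> a \in S ->
  exists b c d, [/\ S = [set a; b; c; d], uniq [:: a; b; c; d], e a c, e b d &
    [/\ ~~ e a b, ~~ e a d, ~~ e b c & ~~ e c d]].
Proof.
move=> cS mS aS; have [c cSin ac] := nbrs_ex (mS a aS).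
have : (0 < #|S :\ a :\ c|).
  have := cardsD1 a S; rewrite cS aS add1n => -[c3].
  by have := cardsD1 c (S :\ a); rewrite -c3 !inE cSin eq_sym (e_neq ac) add1n => -[<-].
case/card_gt0P=> b; rewrite !inE => /and3P[bc ba bS].
have [d dS bd] := nbrs_ex (mS b bS).
have ca : e c a by rewrite e_sym.
have db : e d b by rewrite e_sym.
have ab : ~~ e a b by apply: contra bc => ab; rewrite (nbrs_inj (mS a aS) cSin ac bS ab).
have cb : ~~ e c b by apply: contra ba => cb; rewrite (nbrs_inj (mS c cSin) aS ca bS cb).
have da : d != a by apply: contraNneq ab => <-.
have dc : d != c by apply: contraNneq cb => <-.
have ad : ~~ e a d by apply: contra dc => ad; rewrite (nbrs_inj (mS a aS) cSin ac dS ad).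
have cd : ~~ e c d by apply: contra da => cd; rewrite (nbrs_inj (mS c cSin) aS ca dS cd).
have un : uniq [:: a; b; c; d].
  by rewrite /= !inE !negb_or (e_neq ac) (e_neq bd) bc eq_sym ba eq_sym da eq_sym dc.
exists b, c, d; split=> //; last by split=> //; rewrite e_sym.
apply/esym/eqP; rewrite eqEcard !subUset !sub1set aS bS cSin dS cS /=.
rewrite -[X in (X <= _)]/(size [:: a; b; c; d]) -(card_uniqP un).
by apply/subset_leq_card/subsetP=> x; rewrite !inE -!orbA.
Qed.

Lemma double_count A B :
  \sum_(z in B) #|nbrs e A z| = \sum_(a in A) #|nbrs e B a|.
Proof.
under eq_bigr do rewrite -sum1_card (eq_bigl _ _ (fun x => in_nbrs _ x _)) big_mkcondr.
rewrite exchange_big /=; apply: eq_bigr => a _.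
rewrite -sum1_card [RHS](eq_bigl _ _ (fun x => in_nbrs _ x _)) [RHS]big_mkcondr /=.
by apply: eq_bigr => z _; rewrite e_sym.
Qed.

Lemma nbrsS A B a : A \subset B -> nbrs e A a \subset nbrs e B a.
Proof. by move=> /subsetP AB; apply/subsetP=> x; rewrite !in_nbrs => /andP[/AB-> ->]. Qed.

(** Each of the 6 vertices of [B] has a neighbour in [A], since it has only one in [B] and is not
    adjacent to [w]. Each of the at most 3 vertices of [A] has at most 2 neighbours in [B], since it
    has degree at most 3 and is adjacent to [w]. Double counting makes all this sharp, and [A]
    independent. For distinct [a], [b] in [A], the link of [a] then has 6 vertices and contains [b]
    with its two neighbours in [B], so it is not a matching. *)
Lemma link6_false X w : w \in X -> #|X| <= 10 ->
    {in X, forall v, 1 < #|nbrs e X v|} ->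
    {in X, forall v, 6 <= #|link e X v|} ->
    {in X, forall v, #|link e X v| = 6 ->
      {in link e X v, forall u, #|nbrs e (link e X v) u| = 1}} ->
  #|link e X w| = 6 -> False.
Proof.
move=> wX X10 n2 l6 m6 w6; set B := link e X w; set A := nbrs e X w.
have AX a : a \in A -> a \in X by rewrite in_nbrs => /andP[].
have BX a : a \in B -> a \in X by rewrite in_link => /andP[].
have cA : #|A| <= 3.
  by have := card_link e_irr wX; rewrite w6 -/A => cX; move: X10; rewrite cX.
have nX a : a \in X -> #|nbrs e X a| <= 3.
  by move=> aX; have := card_link e_irr aX; have := l6 a aX; lia.
have nAz z : z \in B -> 1 <= #|nbrs e A z|.
  move=> zB; have := n2 z (BX z zB); rewrite -(cardsID B (nbrs e X z)).
  have -> : #|nbrs e X z :&: B| = 1.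
    rewrite -(m6 w wX w6 z zB); apply: eq_card => x; rewrite !inE -/B.
    by case: (x \in X); rewrite ?andbF //= andbC.
  rewrite add1n ltnS => /leq_trans; apply; apply: subset_leq_card.
  apply/subsetP=> x; rewrite in_setD !in_nbrs /B in_link.
  case/andP=> + /andP[xX zx]; rewrite xX zx andbT /= negb_and !negbK.
  case/orP=> [/eqP xw|//]; move: zB zx; rewrite xw in_link => /and3P[_ _].
  by rewrite e_sym => /negPf->.
have nBa a : a \in A -> #|nbrs e B a| <= 2.
  move=> aA; have := nX a (AX a aA); rewrite (cardsD1 w) in_nbrs wX e_sym.
  move: (aA); rewrite in_nbrs => /andP[_ ->]; rewrite add1n ltnS; apply: leq_trans.
  apply: subset_leq_card; apply/subsetP=> x; rewrite !inE.
  by case/andP=> /and3P[-> -> _] ->.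
have dc := double_count A B.
have ge6 : 6 <= \sum_(z in B) #|nbrs e A z|.
  by rewrite -w6 -sum1_card; apply: leq_sum.
have nBa2 b : b \in A -> 2 <= #|nbrs e B b|.
  move=> bA; move: ge6; rewrite dc (big_setD1 b bA) /= => ge6.
  have : \sum_(a in A :\ b) #|nbrs e B a| <= \sum_(a in A :\ b) 2.
    by apply: leq_sum => a /setD1P[_ aA]; apply: nBa.
  by rewrite sum_nat_const; have := cardsD1 b A; rewrite bA; lia.
have A3 : 2 < #|A|.
  have : \sum_(a in A) #|nbrs e B a| <= \sum_(a in A) 2 by apply: leq_sum.
  by rewrite -dc sum_nat_const; lia.
have nAz1 z : z \in B -> #|nbrs e A z| <= 1.
  move=> zB; have le6 : \sum_(z in B) #|nbrs e A z| <= 6.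
    rewrite dc; apply: (@leq_trans (\sum_(a in A) 2)); first exact: leq_sum.
    by rewrite sum_nat_const -[6]/(3 * 2) leq_mul2r.
  move: le6; rewrite (big_setD1 z zB) /= => le6.
  have : \sum_(y in B :\ z) 1 <= \sum_(y in B :\ z) #|nbrs e A y|.
    by apply: leq_sum => y /setD1P[_ yB]; apply: nAz.
  by rewrite sum1_card; have := cardsD1 z B; rewrite zB w6; lia.
have [a [b [aA bA ab]]] := card_gt1P (ltnW A3).
have nXa3 c : c \in A -> #|nbrs e X c| = 3 /\ nbrs e X c = w |: nbrs e B c.
  move=> cAi; have sub : w |: nbrs e B c \subset nbrs e X c.
    rewrite subUset sub1set in_nbrs wX e_sym; move: (cAi); rewrite in_nbrs => /andP[_ ->].
    by apply: nbrsS; apply: link_subset.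
  have cw : #|w |: nbrs e B c| = 3.
    have n2' : #|nbrs e B c| = 2 by apply/eqP; rewrite eqn_leq nBa // nBa2.
    by rewrite cardsU1 n2' in_nbrs in_link eqxx andbF.
  have c3 : #|nbrs e X c| = 3.
    by apply/eqP; rewrite eqn_leq nX ?AX // -cw subset_leq_card.
  by split=> //; apply/esym/eqP; rewrite eqEcard sub c3 cw.
have AB x : x \in A -> x \notin B.
  by rewrite in_nbrs in_link => /andP[-> ->]; rewrite !andbF.
have nbA x : x \in A -> e b x = false.
  move=> xA; apply/negP=> bx; have : x \in nbrs e X b by rewrite in_nbrs AX.
  rewrite (nXa3 b bA).2 !inE => /orP[/eqP xw|/andP[/andP[_ H] _]].
    by move: xA; rewrite xw in_nbrs e_irr andbF.
  by move: xA H; rewrite in_nbrs => /andP[_ ->]; rewrite andbF.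
have la6 : #|link e X a| = 6.
  apply/eqP; rewrite eqn_leq l6 ?AX // andbT.
  by have := card_link e_irr (AX a aA); rewrite (nXa3 a aA).1; lia.
have bla : b \in link e X a by rewrite in_link AX // eq_sym ab e_sym nbA.
have := m6 a (AX a aA) la6 b bla => nb1.
have : 2 <= #|nbrs e (link e X a) b|.
  apply: leq_trans (nBa2 b bA) _; apply/subset_leq_card/subsetP=> z.
  rewrite !in_nbrs in_link => /andP[zB bz]; rewrite bz BX //= andbT.
  rewrite (contraTneq _ zB) /= => [|->]; last exact: AB.
  apply/negP=> az; have /negP[] := ab; apply/eqP.
  have z1 : #|nbrs e A z| = 1 by apply/eqP; rewrite eqn_leq nAz1 // nAz.
  by apply: (nbrs_inj z1); rewrite // e_sym.
by rewrite nb1.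
Qed.

End Combinatorics.

(** * Constraints on a minimal counterexample and their contradiction *)

Section MinimalCounterexample.
Variables (T : finType) (e : rel T).
Hypotheses (e_sym : symmetric e) (e_irr : irreflexive e).
Implicit Types (S A B : {set T}) (a b c d u v w x y z : T).

Variables (X : {set T}) (s : nat) (p : int).
Hypothesis p_neq0 : p != 0%R.
Hypothesis leX10 : #|X| <= 10.
Hypothesis IH : forall (Y : {set T}) t, #|Y| < #|X| -> cocycles_lift e p Y t.
Hypothesis nolift : ~ cocycles_lift e p X s.

Lemma face_size_gt1 : 1 < s.
Proof.
by rewrite ltnNge; apply/negP=> s1; apply: nolift => g; apply: liftable_small.
Qed.

Lemma link_card_lt v : v \in X -> #|link e X v| < #|X|.
Proof. by move/(card_link e_irr)->; rewrite ltnS leq_addr. Qed.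

Lemma link_not_acyclic v : v \in X -> ~ acyclic e 0 (link e X v) s.
Proof.
move=> vX acy; apply: nolift; move: acy; have := face_size_gt1; case: s => // t _ acy.
apply: (lifts_del_link e_sym e_irr p_neq0 vX) => //; apply: IH.
by rewrite [ltnRHS](cardsD1 v) vX.
Qed.

Lemma del_not_acyclic v : v \in X -> ~ acyclic e p (X :\ v) s.
Proof.
move=> vX acy; apply: nolift; move: acy; have := face_size_gt1; case: s => // t _ acy.
apply: (lifts_clique e_sym e_irr (N := [set v])); rewrite ?sub1set //.
  by move=> x y; rewrite !inE => /eqP-> /eqP->; rewrite eqxx.
by move=> y; rewrite inE => /eqP->; apply: IH; apply: link_card_lt.
Qed.

(** Without its neighbours, [v] becomes a cone apex. *)
Lemma acyclic_del_nbrs m v t : v \in X -> acyclic e m (X :\: nbrs e X v) t.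
Proof.
move=> vX; apply: (@acyclic_cone _ _ e_sym e_irr _ _ _ v).
  by rewrite in_setD in_nbrs e_irr andbF.
by apply/setP=> u; rewrite in_nbrs in_setD in_nbrs in_set0; case: (u \in X); case: (e v u).
Qed.

Lemma nbrs_not_clique v : v \in X ->
  exists x y, [/\ x \in nbrs e X v, y \in nbrs e X v, x != y & ~~ e x y].
Proof.
move=> vX.
have [/existsP[x /existsP[y /and4P[]]]|H] := boolP [exists x, exists y,
  [&& x \in nbrs e X v, y \in nbrs e X v, x != y & ~~ e x y]]; first by exists x, y.
case: nolift; have := face_size_gt1; case: s => // t _.
apply: (lifts_clique e_sym e_irr (N := nbrs e X v)).
- by apply/subsetP=> u; rewrite in_nbrs => /andP[].
- move=> x y xN yN xy; apply: contraNT H => exy.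
  by apply/existsP; exists x; apply/existsP; exists y; rewrite xN yN xy.
- exact: acyclic_del_nbrs.
by move=> y; rewrite in_nbrs => /andP[yX _]; apply: IH; apply: link_card_lt.
Qed.

Lemma nbrs_gt1 v : v \in X -> 1 < #|nbrs e X v|.
Proof.
by move/nbrs_not_clique=> [x [y [xN yN xy _]]]; apply/card_gt1P; exists x, y.
Qed.

Lemma link_card v : v \in X -> s.*2 <= #|link e X v|.
Proof.
move=> vX; rewrite leqNgt; apply/negP=> lt; apply: (link_not_acyclic vX).
exact: acyclic_small.
Qed.

Lemma not_acyclic_matching m S t : ~ acyclic e m S t -> #|S| = t.*2 ->
  {in S, forall u, #|nbrs e S u| = 1}.
Proof.
move=> nS cS u uS; apply/eqP; apply: contra_notT nS => nu.
exact: acyclic_matching nu.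
Qed.

Lemma X_neq0 : exists v, v \in X.
Proof.
have [X0|[v vX]] := set_0Vmem X; last by exists v.
case: nolift => g gX; exists (fun _ => 0%R) => F /and3P[FX _ /eqP cF].
  by have := subset_leq_card FX; rewrite cF X0 cards0.
by have := subset_leq_card FX; rewrite cF X0 cards0; have := face_size_gt1; case: s.
Qed.

Lemma nbrs2 S a b : #|nbrs e S a| = 2 -> b \in S -> e a b ->
  exists2 c, c != b & nbrs e S a = [set b; c].
Proof.
move=> c2 bS ab; have bN : b \in nbrs e S a by rewrite in_nbrs bS.
have := cardsD1 b (nbrs e S a); rewrite c2 bN add1n => -[/esym/eqP/cards1P[c cE]].
exists c; last by rewrite -(setD1K bN) cE.
by have : c \in nbrs e S a :\ b by [rewrite cE set11]; rewrite in_setD1 => /andP[].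
Qed.

(** Once links with 6 vertices are excluded, every vertex has exactly two neighbours, so the graph
    is a union of cycles, followed along [b], [v], [a], [h1], [h2], [h3]. On a long cycle [Y] would
    be a perfect matching on 4 vertices; the second neighbour of each must be [b] or [h3], and these
    have at most one neighbour each in [Y]. *)
Lemma face_size3_false : s = 3 -> False.
Proof.
move=> s3; have n2 v : v \in X -> 1 < #|nbrs e X v| := @nbrs_gt1 v.
have l6 v : v \in X -> 6 <= #|link e X v| by move=> /link_card; rewrite s3.
have [/existsP[w /andP[wX /eqP w6]]|no6] :=
    boolP [exists w, (w \in X) && (#|link e X w| == 6)].
  apply: (link6_false e_sym e_irr wX) => // v vX v6.
  by apply: (not_acyclic_matching (link_not_acyclic vX)); rewrite s3.
have card2 v : v \in X -> #|link e X v| = 7 /\ #|nbrs e X v| = 2.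
  move=> vX; have := l6 v vX; have := n2 v vX; have := card_link e_irr vX.
  have : #|link e X v| != 6.
    by apply: contraNneq no6 => v6; apply/existsP; exists v; rewrite vX v6.
  by split; lia.
have nb x u : x \in X -> (u \in X) && e x u = (u \in nbrs e X x) by rewrite in_nbrs.
have [v vX] := X_neq0; have [l7 v2] := card2 v vX.
have [a [b [aN bN ab eab]]] := nbrs_not_clique vX.
have [aX va] : a \in X /\ e v a by move: aN; rewrite in_nbrs => /andP[].
have [bX vb] : b \in X /\ e v b by move: bN; rewrite in_nbrs => /andP[].
have vN u : u \in X -> e v u -> u = a \/ u = b.
  move=> uX vu; have [c _ vE] := nbrs2 v2 aX va.
  move: bN; rewrite vE !inE eq_sym (negPf ab) => /eqP bc.
  have : u \in nbrs e X v by rewrite in_nbrs uX.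
  by rewrite vE -bc !inE => /orP[]/eqP; [left | right].
have [h1 h1v aE] := nbrs2 (card2 a aX).2 vX (etrans (e_sym a v) va).
have : h1 \in nbrs e X a by rewrite aE !inE eqxx orbT.
rewrite in_nbrs => /andP[h1X ah1].
have h1b : h1 != b by apply: contraNneq eab => <-.
have vh1 : ~~ e v h1.
  apply/negP=> /(vN _ h1X)[] h1E; first by rewrite h1E e_irr in ah1.
  by rewrite h1E eqxx in h1b.
have h1l : h1 \in link e X v by rewrite in_link h1X h1v.
have [h2 h2a h1E] := nbrs2 (card2 h1 h1X).2 aX (etrans (e_sym h1 a) ah1).
have : h2 \in nbrs e X h1 by rewrite h1E !inE eqxx orbT.
rewrite in_nbrs => /andP[h2X h12].
have al : a \notin link e X v by rewrite in_link va !andbF.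
have bl : b \notin link e X v by rewrite in_link vb !andbF.
(* A 4-cycle would leave [h1] isolated in the link of [v], which would be a cone. *)
have h2b : h2 != b.
  apply/negP=> /eqP h2E; apply: (link_not_acyclic vX).
  apply: (acyclic_cone e_sym e_irr h1l); apply/setP=> u; rewrite in_nbrs in_set0.
  apply/negP=> /andP[ul h1u]; have : u \in nbrs e X h1.
    by rewrite in_nbrs h1u andbT; move: ul; rewrite in_link => /andP[].
  by rewrite h1E h2E !inE => /orP[]/eqP uE; move: ul; rewrite uE ?(negPf al) ?(negPf bl).
have h2v : h2 != v by apply: contraNneq vh1 => <-; rewrite e_sym.
have vh2 : ~~ e v h2.
  apply/negP=> /(vN _ h2X)[] h2E; first by rewrite h2E eqxx in h2a.
  by rewrite h2E eqxx in h2b.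
have h2l : h2 \in link e X v by rewrite in_link h2X h2v.
have h1N : nbrs e (link e X v) h1 = [set h2].
  apply/setP=> u; rewrite in_nbrs in_set1; apply/andP/eqP => [[ul h1u]|->//].
  have : u \in nbrs e X h1.
    by rewrite in_nbrs h1u andbT; move: ul; rewrite in_link => /andP[].
  by rewrite h1E !inE => /orP[]/eqP // uE; rewrite uE (negPf al) in ul.
have nY : ~ acyclic e 0 (link e (link e X v) h2) 2.
  move=> acy; apply: (link_not_acyclic vX); rewrite s3.
  exact: (acyclic_pendant e_sym e_irr h1l h1N).
have [h3 h31 h2E] := nbrs2 (card2 h2 h2X).2 h1X (etrans (e_sym h2 h1) h12).
have : h3 \in nbrs e X h2 by rewrite h2E !inE eqxx orbT.
rewrite in_nbrs => /andP[h3X h23].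
(* On a 5-cycle, deleting [v] makes [a] pendant at [h1], and [b] is isolated in the link of [h1]. *)
have [h3b|h3b] := eqVneq h3 b.
  apply: (del_not_acyclic vX); rewrite s3.
  have aD : a \in X :\ v by rewrite in_setD1 aX eq_sym (e_neq e_irr va).
  apply: (acyclic_pendant (y := h1) e_sym e_irr aD).
    apply/setP=> u; rewrite in_nbrs in_setD1 in_set1.
    rewrite -andbA nb // aE !inE; apply/andP/eqP => [[uv /orP[]/eqP //]|->].
      by move=> uE; rewrite uE eqxx in uv.
    by rewrite h1v eqxx orbT.
  have bh1 : ~~ e h1 b.
    apply/negP=> h1b'; have : b \in nbrs e X h1 by rewrite in_nbrs bX.
    by rewrite h1E !inE eq_sym (negPf ab) eq_sym (negPf h2b).
  have bv : b != v by rewrite eq_sym (e_neq e_irr vb).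
  apply: (@acyclic_cone _ _ e_sym e_irr _ _ _ b).
    by rewrite in_link in_setD1 bX bv eq_sym h1b.
  have [h2' h2'v bE] := nbrs2 (card2 b bX).2 vX (etrans (e_sym b v) vb).
  have h2E' : h2' = h2.
    have : h2 \in nbrs e X b by rewrite in_nbrs h2X e_sym -h3b.
    by rewrite bE !inE (negPf h2v) => /eqP.
  apply/setP=> u; rewrite in_set0 in_nbrs in_link in_setD1; apply/negP.
  case/andP=> /and3P[/andP[uv uX] uh1 h1u] bu; have : u \in nbrs e X b by rewrite in_nbrs uX.
  by rewrite bE h2E' !inE (negPf uv) => /eqP uE; rewrite uE h12 in h1u.
have h3v : h3 != v by apply: contraNneq vh2 => <-; rewrite e_sym.
have h3a : h3 != a.
  apply/negP=> /eqP h3E; have : h2 \in nbrs e X a by rewrite in_nbrs h2X e_sym -h3E.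
  by rewrite aE !inE (negPf h2v) => /eqP h2E'; move: h12; rewrite h2E' e_irr.
have vh3 : ~~ e v h3.
  by apply/negP=> /(vN _ h3X)[] h3E; move: h3a h3b; rewrite h3E eqxx.
set Y := link e (link e X v) h2 in nY.
have cY : #|Y| = 4.
  have := card_link e_irr h2l; rewrite l7 -/Y.
  have -> : nbrs e (link e X v) h2 = [set h1; h3].
    apply/setP=> u; rewrite in_nbrs in_link andbAC nb // h2E !inE.
    have [->|uh1] := eqVneq u h1; first by rewrite h1v vh1.
    by have [->|uh3] := eqVneq u h3; rewrite ?h3v ?vh3.
  by rewrite cards2 eq_sym h31 addn2 => -[<-].
have mY := not_acyclic_matching nY cY.
have sub : Y \subset nbrs e Y b :|: nbrs e Y h3.
  apply/subsetP=> z zY; rewrite in_setU !in_nbrs zY /=.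
  have := zY; rewrite /Y in_link in_link => /and3P[/and3P[zX zv vz] zh2 h2z].
  have [t tN tY] : exists2 t, t \in nbrs e X z & t \notin Y.
    apply/subsetPn; apply/negP=> sub.
    suff /subset_leq_card : nbrs e X z \subset nbrs e Y z.
      by rewrite (card2 z zX).2 (mY z zY).
    apply/subsetP=> u uN; rewrite in_nbrs (subsetP sub) //.
    by move: uN; rewrite in_nbrs => /andP[].
  move: tN; rewrite in_nbrs e_sym => /andP[tX tz].
  suff : t = b \/ t = h3 by case=> <-; rewrite tz ?orbT.
  have at_ : t != a.
    apply/negP=> /eqP tE; have : z \in nbrs e X a by rewrite in_nbrs zX -tE.
    by rewrite aE !inE (negPf zv) => /eqP zE; rewrite zE e_sym h12 in h2z.
  move: tY; rewrite /Y in_link in_link tX /= !negb_and !negbK.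
  case/or3P=> [/orP[/eqP tE|vt]|/eqP tE|h2t].
  - by rewrite -tE tz in vz.
  - by case: (vN t tX vt) => tE; [rewrite tE eqxx in at_ | left].
  - by rewrite -tE tz in h2z.
  - have : t \in nbrs e X h2 by rewrite in_nbrs tX.
    rewrite h2E !inE => /orP[]/eqP tE; last by right.
    have : z \in nbrs e X h1 by rewrite in_nbrs zX -tE.
    rewrite h1E !inE (negPf zh2) orbF => /eqP zE.
    by move: vz; rewrite zE va.
have small x y : x \in X -> y \in X -> y \notin Y -> e x y -> #|nbrs e Y x| <= 1.
  move=> xX yX yY xy; have [_] := card2 x xX.
  rewrite (cardsD1 y) in_nbrs yX xy add1n => -[<-].
  apply/subset_leq_card/subsetP=> z; rewrite in_setD1 !in_nbrs => /andP[zY xz].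
  rewrite xz andbT (contraTneq _ zY) /= => [|->//].
  by move: zY; rewrite /Y in_link in_link => /andP[/andP[]].
have b1 : #|nbrs e Y b| <= 1.
  by apply: (small b v); rewrite // ?/Y 1?in_link 1?in_link ?eqxx ?andbF // e_sym.
have h1' : #|nbrs e Y h3| <= 1.
  by apply: (small h3 h2); rewrite // ?/Y 1?in_link ?eqxx ?andbF // e_sym.
have := leq_trans (subset_leq_card sub) (leq_card_setU _ _).
by rewrite cY => /leq_trans/(_ (leq_add b1 h1')).
Qed.

(** The partition used is the neighbourhood of [v] against the rest, a cone with apex [v]. *)
Lemma lift_from_nbrs v g : s = 2 -> v \in X -> cocycle e p X 2 g ->
  coboundary e p (nbrs e X v) 2 g -> liftable e p X 2 g.
Proof.
move=> s2 vX gX cob; apply: (liftable_split e_sym e_irr _ _ cob) => //.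
  by apply/subsetP=> u; rewrite in_nbrs => /andP[].
exact: acyclic_del_nbrs.
Qed.

Lemma nbrs_not_acyclic v : s = 2 -> v \in X -> ~ acyclic e p (nbrs e X v) 2.
Proof.
move=> s2 vX acy; apply: nolift; rewrite s2 => g gX; apply: (lift_from_nbrs s2 vX gX).
by apply/acy/(cocycle_subset _ gX)/subsetP=> u; rewrite in_nbrs => /andP[].
Qed.

(** The vertex [c] together with its link is a cone, so every cocycle would become a coboundary on
    it, and hence on the neighbourhood of [v]. *)
Lemma nbrs_not_sub_link v c : s = 2 -> v \in X -> c \in X ->
  ~~ (nbrs e X v \subset link e X c).
Proof.
move=> s2 vX cX; apply/negP=> sub; apply: nolift; rewrite s2 => g gX.
apply: (lift_from_nbrs s2 vX gX).
apply: (coboundary_subset (subset_trans sub (subsetUr [set c] _))).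
apply: (@acyclic_cone _ _ e_sym e_irr _ _ _ c); first by rewrite setU11.
  apply/setP=> u; rewrite in_nbrs !inE; case: eqP => [->|_]; rewrite ?e_irr //=.
  by case: (e c u); rewrite ?andbF.
by apply: cocycle_subset gX; rewrite subUset sub1set cX link_subset.
Qed.

(** Every link is a 4-cycle of non-edges. These close up to an octahedron [S] with antipodal pairs
    [v], [x]; [a], [c]; [b], [d], which is a union of components of the complementary graph. A
    vertex outside [S], which exists as |X| >= 9, would have its 4-element link among at most 3
    vertices. *)
Lemma link4_false : s = 2 -> (forall v, v \in X -> 4 <= #|nbrs e X v|) ->
  (forall v, v \in X -> #|link e X v| = 4) -> False.
Proof.
move=> s2 n4 l4.
have mX v : v \in X -> {in link e X v, forall u, #|nbrs e (link e X v) u| = 1}.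
  by move=> vX; apply: (not_acyclic_matching (link_not_acyclic vX)); rewrite s2 l4.
have [v vX] := X_neq0.
have /card_gt0P[a aL] : 0 < #|link e X v| by rewrite l4.
have [b [c [d [LE un ac bd [ab ad bc cd]]]]] := matching4 e_sym e_irr (l4 v vX) (mX v vX) aL.
have inL u : u \in [:: a; b; c; d] -> [/\ u \in X, u != v & ~~ e v u].
  by move=> uL; apply/and3P; rewrite -in_link LE !inE -!orbA; move: uL; rewrite !inE.
have [aX av va] := inL a (mem_head _ _).
have [bX bv vb] := inL b ltac:(by rewrite !inE eqxx ?orbT).
have [cX cv vc] := inL c ltac:(by rewrite !inE eqxx ?orbT).
have [dX dv vd] := inL d ltac:(by rewrite !inE eqxx ?orbT).
move: un; rewrite /= !inE !negb_or => /and4P[/and3P[nab nac nad] /andP[nbc nbd] ncd _].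
have four w x y z u : w \in X -> x \in link e X w -> y \in link e X w ->
    z \in link e X w -> u \in link e X w -> uniq [:: x; y; z; u] ->
    link e X w = [set x; y; z; u].
  move=> wX xl yl zl ul un; apply/esym/eqP; rewrite eqEcard !subUset !sub1set xl yl zl ul l4 //=.
  rewrite -[X in X <= _]/(size [:: x; y; z; u]) -(card_uniqP un).
  by apply/subset_leq_card/subsetP=> t; rewrite !inE -!orbA.
have vla : v \in link e X a by rewrite in_link vX eq_sym av e_sym.
have bla : b \in link e X a by rewrite in_link bX eq_sym nab ab.
have dla : d \in link e X a by rewrite in_link dX eq_sym nad ad.
have [x xla vx] := nbrs_ex (mX a aX v vla).
have := xla; rewrite in_link => /and3P[xX xa ax].
have xv : x != v by rewrite eq_sym (e_neq e_irr vx).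
have xb : x != b by apply: contraTneq vx => ->.
have xd : x != d by apply: contraTneq vx => ->.
have xc : x != c by apply: contraTneq vx => ->.
have bx : ~~ e b x.
  by apply: contra xd => bx; rewrite (nbrs_inj (mX a aX b bla) xla bx dla bd).
have dx : ~~ e d x.
  by apply: contra xb => dx; rewrite (nbrs_inj (mX a aX d dla) xla dx bla _) // e_sym.
have xlb : x \in link e X b by rewrite in_link xX xb.
have vlb : v \in link e X b by rewrite in_link vX eq_sym bv e_sym.
have alb : a \in link e X b by rewrite in_link aX nab e_sym.
have clb : c \in link e X b by rewrite in_link cX eq_sym nbc.
have cx : ~~ e c x.
  apply: contra nac => cx; apply/eqP.
  by rewrite -(nbrs_inj (mX b bX c clb) xlb cx alb _) ?eqxx // 1?e_sym // in xa.
have la := four a v b d x aX vla bla dla xla.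
have lb := four b v a c x bX vlb alb clb xlb.
have lc : link e X c = [set v; b; d; x].
  apply: four; rewrite ?in_link ?vX ?bX ?dX ?xX //=.
  - by rewrite eq_sym cv e_sym.
  - by rewrite nbc e_sym.
  - by rewrite eq_sym ncd cd.
  - by rewrite xc cx.
  by rewrite !inE !negb_or eq_sym bv eq_sym dv eq_sym xv nbd eq_sym xb eq_sym xd.
have ld : link e X d = [set v; a; c; x].
  apply: four; rewrite ?in_link ?vX ?aX ?cX ?xX //=.
  - by rewrite eq_sym dv e_sym.
  - by rewrite nad e_sym.
  - by rewrite ncd e_sym.
  - by rewrite xd dx.
  by rewrite !inE !negb_or eq_sym av eq_sym cv eq_sym xv nac eq_sym xa eq_sym xc.
have lx : link e X x = [set a; b; c; d].
  apply: four; rewrite ?in_link ?aX ?bX ?cX ?dX //=.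
  - by rewrite eq_sym xa e_sym.
  - by rewrite eq_sym xb e_sym.
  - by rewrite eq_sym xc e_sym.
  - by rewrite eq_sym xd e_sym.
  by rewrite !inE !negb_or nab nac nad nbc nbd ncd.
have {}la : link e X a = [set v; b; d; x].
  by apply: la; rewrite /= !inE !negb_or eq_sym bv eq_sym dv eq_sym xv nbd eq_sym xb eq_sym xd.
have {}lb : link e X b = [set v; a; c; x].
  by apply: lb; rewrite /= !inE !negb_or eq_sym av eq_sym cv eq_sym xv nac eq_sym xa eq_sym xc.
pose S := x |: (v |: link e X v).
have SX : S \subset X by rewrite !subUset !sub1set xX vX link_subset.
have cS : #|S| = 6.
  by rewrite cardsU1 cardsU1 l4 // in_setU1 !in_link (negPf xv) vx eqxx !andbF.
have closed u y : u \in S -> y \in link e X u -> y \in S.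
  have SE z : (z \in S) = [|| z == x, z == v, z == a, z == b, z == c | z == d].
    by rewrite !in_setU1 LE !inE -!orbA.
  rewrite !SE => /or4P[|||/or3P[]] /eqP->; rewrite ?lx ?LE ?la ?lb ?lc ?ld !inE -!orbA.
  - by case/or4P=> ->; rewrite ?orbT.
  - by case/or4P=> ->; rewrite ?orbT.
  - by case/or4P=> ->; rewrite ?orbT.
  - by case/or4P=> ->; rewrite ?orbT.
  - by case/or4P=> ->; rewrite ?orbT.
  - by case/or4P=> ->; rewrite ?orbT.
have cX9 : 9 <= #|X| by rewrite (card_link e_irr vX) l4 // !addSn !ltnS n4.
have /card_gt0P[y] : 0 < #|X :\: S|.
  by rewrite cardsD (setIidPr SX) cS subn_gt0; apply: leq_trans cX9.
rewrite in_setD => /andP[yS yX].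
have sub : link e X y \subset (X :\: S) :\ y.
  apply/subsetP=> u uy; have := uy; rewrite in_link !in_setD1 in_setD => /and3P[-> -> yu].
  rewrite !andbT /=; apply: contra yS => uS; apply: closed uS _.
  move: uy; rewrite !in_link yX => /and3P[_ uy _]; by rewrite eq_sym uy e_sym.
have := subset_leq_card sub; rewrite l4 //.
have := cardsD1 y (X :\: S); rewrite in_setD yS yX cardsD (setIidPr SX) cS add1n.
by move=> E L; have := leq_sub2r 6 leX10; rewrite E => /(leq_ltn_trans L).
Qed.

(** The 4 neighbours [M] of [v] form a perfect matching, hence a 4-cycle m, q, m', q' of non-edges.
    [A m] collects the non-neighbours of m among the 5 vertices of [N]. The link of m is [A m] with
    q and q', so [A m] has 2 or 3 elements, and either size restricts how these sets overlap. *)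
Lemma link5_false v : s = 2 -> (forall v, v \in X -> 4 <= #|nbrs e X v|) ->
  v \in X -> #|link e X v| = 5 -> False.
Proof.
move=> s2 n4 vX v5; have l4 u : u \in X -> 4 <= #|link e X u|.
  by move/link_card; rewrite s2.
have mL u : u \in X -> #|link e X u| = 4 ->
    {in link e X u, forall z, #|nbrs e (link e X u) z| = 1}.
  by move=> uX u4; apply: (not_acyclic_matching (link_not_acyclic uX)); rewrite s2.
have mN u : u \in X -> #|nbrs e X u| = 4 ->
    {in nbrs e X u, forall z, #|nbrs e (nbrs e X u) z| = 1}.
  by move=> uX u4; apply: (not_acyclic_matching (nbrs_not_acyclic s2 uX)).
have X10 : #|X| = 10.
  have := card_link e_irr vX; have := n4 v vX; rewrite v5.
  by move: leX10; clear; lia.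
have v4 : #|nbrs e X v| = 4.
  by have := card_link e_irr vX; rewrite X10 v5 => -[/esym].
set N := link e X v in v5; set M := nbrs e X v in v4.
have NX z : z \in N -> [/\ z \in X, z != v & ~~ e v z] by rewrite in_link => /and3P.
have MX z : z \in M -> [/\ z \in X, z != v & e v z].
  by rewrite in_nbrs => /andP[zX vz]; rewrite zX vz eq_sym (e_neq e_irr vz).
pose cyc m q m' q' := [/\ M = [set m; q; m'; q'], uniq [:: m; q; m'; q'], e m m', e q q' &
    [/\ ~~ e m q, ~~ e m q', ~~ e q m' & ~~ e m' q']].
have mem m q m' q' : cyc m q m' q' -> [/\ m \in M, q \in M, m' \in M & q' \in M].
  by case=> ->; rewrite !inE !eqxx ?orbT.
have rot m q m' q' : cyc m q m' q' -> cyc q m' q' m.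
  case=> ME un mm qq [mq mq' qm mq'']; split.
  - by rewrite ME -!setUA setUC -!setUA.
  - by rewrite -(rot_uniq 1) in un.
  - by [].
  - by rewrite e_sym.
  by split; rewrite // e_sym.
have refl a b c d : cyc a b c d -> cyc a d c b.
  case=> ME' un' mm' qq' [mq mq' qm mq'']; split => //; last by split; rewrite // e_sym.
  - rewrite ME'; apply/setP=> z; rewrite !inE.
    by case: (z == a); case: (z == b); case: (z == c); case: (z == d).
  - move: un'; rewrite /= !inE !negb_or => /and4P[/and3P[-> -> ->] /andP[bc bd] cd _] /=.
    by rewrite eq_sym cd eq_sym bd eq_sym bc.
  by rewrite e_sym.
pose A m := link e N m.
have AN m : A m \subset N by apply: link_subset.
have inA m c : m \in M -> c \in N -> (c \in A m) = ~~ e m c.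
  move=> mM cN; rewrite in_link cN /=; case: eqP => // cm.
  have [_ _] := NX c cN; have [_ _] := MX m mM.
  by rewrite cm => ->.
have linkA m q m' q' : cyc m q m' q' -> link e X m = q |: (q' |: A m).
  move=> C; have [mM qM mM' qM'] := mem _ _ _ _ C; case: C => ME un mm qq [mq mq' qm mq''].
  have [mX mv vm] := MX m mM.
  apply/setP=> c; rewrite in_link !in_setU1.
  move: un; rewrite /= !inE !negb_or => /and4P[/and3P[nmq nmm nmq'] _ _ _].
  have [->|cq] := eqVneq c q; first by have [-> _ _] := MX q qM; rewrite eq_sym nmq mq.
  have [->|cq'] := eqVneq c q'; first by have [-> _ _] := MX q' qM'; rewrite eq_sym nmq' mq'.
  rewrite /=; have [cX|] := boolP (c \in X) => //=.
  have [cv|cv] := eqVneq c v; first by rewrite cv e_sym vm andbF.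
  have [vc|//] := boolP (e v c); rewrite /=.
  have : c \in M by rewrite in_nbrs cX vc.
  rewrite ME !inE (negPf cq) (negPf cq') orbF orbF => /orP[]/eqP->.
    by rewrite eqxx.
  by rewrite mm andbF.
have cardA m q m' q' : cyc m q m' q' -> #|link e X m| = #|A m|.+2.
  move=> C; have [mM qM mM' qM'] := mem _ _ _ _ C.
  rewrite (linkA _ _ _ _ C) !cardsU1 in_setU1 !in_link.
  have [_ _ ->] := MX q qM; have [_ _ ->] := MX q' qM'; rewrite !andbF orbF.
  case: C => _ un _ _ _; move: un; rewrite /= !inE !negb_or => /and4P[_ /andP[_ ->] _ _].
  by rewrite addnA.
have rangeA m q m' q' : cyc m q m' q' -> #|A m| = 2 \/ #|A m| = 3.
  move=> C; have [mM _ _ _] := mem _ _ _ _ C; have [mX _ _] := MX m mM.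
  have := l4 m mX; have := n4 m mX; have := card_link e_irr mX.
  rewrite X10 (cardA _ _ _ _ C); clear; case: #|A m| => [|[|[|[|k]]]]; [lia|lia|by left|by right|lia].
(* Here the link of m is a perfect matching in which q is paired with q', so q has no neighbour in
   [A m]. *)
have claim1 m q m' q' : cyc m q m' q' -> #|A m| = 2 -> A m \subset A q.
  move=> C Am2; have [mM qM mM' qM'] := mem _ _ _ _ C; have [mX _ _] := MX m mM.
  have m4 : #|link e X m| = 4 by rewrite (cardA _ _ _ _ C) Am2.
  have lE := linkA _ _ _ _ C.
  have qL : q \in link e X m by rewrite lE setU11.
  have qL' : q' \in link e X m by rewrite lE !in_setU1 eqxx orbT.
  apply/subsetP=> c cA; have cN := subsetP (AN m) c cA; rewrite inA //.
  have cL : c \in link e X m by rewrite lE !in_setU1 cA !orbT.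
  case: C => _ _ _ qq _; apply/negP=> qc.
  have cq := nbrs_inj (mL m mX m4 q qL) cL qc qL' qq.
  by have [_ _ /negP[]] := NX c cN; have [_ _] := MX q' qM'; rewrite cq.
(* Here the neighbourhood of m is a perfect matching pairing [v] with m'; a common neighbour of m
   and m' in [N] would be a second partner of m'. *)
have claim2 m q m' q' : cyc m q m' q' -> #|A m| = 3 -> N :\: A m \subset A m'.
  move=> C Am3; have [mM qM mM' qM'] := mem _ _ _ _ C; have [mX mv vm] := MX m mM.
  have m4 : #|nbrs e X m| = 4.
    by have := card_link e_irr mX; rewrite X10 (cardA _ _ _ _ C) Am3 => -[/esym].
  have [mX' mv' vm'] := MX m' mM'.
  case: C => _ _ mm _ _; apply/subsetP=> c; rewrite in_setD => /andP[cA cN].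
  have [cX cv vc] := NX c cN; rewrite inA //; apply/negP=> mc.
  move: cA; rewrite inA // negbK => emc.
  have mNm : m' \in nbrs e X m by rewrite in_nbrs mX'.
  have cNm : c \in nbrs e X m by rewrite in_nbrs cX.
  have vNm : v \in nbrs e X m by rewrite in_nbrs vX e_sym.
  have := nbrs_inj (mN m mX m4 m' mNm) cNm mc vNm.
  by rewrite e_sym vm' => /(_ isT) cv'; rewrite cv' eqxx in cv.
have noall c m q m' q' : cyc m q m' q' -> c \in N ->
    c \in A m -> c \in A q -> c \in A m' -> c \in A q' -> False.
  move=> C cN cm cq cm' cq'; have [cX _ _] := NX c cN.
  have [mM qM mM' qM'] := mem _ _ _ _ C; case: C => ME _ _ _ _.
  have /negP[] := nbrs_not_sub_link s2 vX cX.
  rewrite -/M ME !subUset !sub1set.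
  have sub u : u \in M -> c \in A u -> u \in link e X c.
    by move=> uM; have [uX _ _] := MX u uM; rewrite !in_link uX => /and3P[_ cu uc];
      rewrite eq_sym cu e_sym uc.
  by rewrite !sub.
have no2 m q m' q' : cyc m q m' q' -> #|A m| = 2 -> False.
  move=> C Am2; have Cq := rot _ _ _ _ C; have Cm' := rot _ _ _ _ Cq; have Cq' := rot _ _ _ _ Cm'.
  (* If [A b] had 3 elements, [A d] would contain the disjoint two-element sets [A a] and
     [N :\: A b]. Spreading size 2 in this way puts each element of [A m] into all four sets. *)
  have sub3 a b c d : cyc a b c d -> #|A a| = 2 -> A a \subset A d -> #|A b| = 2.
    move=> D Aa2 ad; have Db := rot _ _ _ _ D; have ab := claim1 _ _ _ _ D Aa2.
    have [//|Ab3] := rangeA _ _ _ _ Db.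
    have bd := claim2 _ _ _ _ Db Ab3.
    have Dd := rot _ _ _ _ (rot _ _ _ _ Db).
    have : #|A a :|: (N :\: A b)| <= #|A d| by apply: subset_leq_card; rewrite subUset ad bd.
    have -> : #|A a :|: (N :\: A b)| = 4.
      have dis : A a :&: (N :\: A b) = set0.
        apply/setP=> z; rewrite !in_setI in_setD in_set0; apply/negP=> /and3P[za zb _].
        by rewrite (subsetP ab) in zb.
      have := cardsUI (A a) (N :\: A b); rewrite dis cards0 addn0 => ->.
      by rewrite cardsD (setIidPr (AN b)) Aa2 Ab3 v5.
    by case: (rangeA _ _ _ _ Dd) => ->.
  have Am_q' := claim1 _ _ _ _ (refl _ _ _ _ C) Am2.
  have Am_q := claim1 _ _ _ _ C Am2.
  have Aq2 := sub3 _ _ _ _ C Am2 Am_q'.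
  have Aq_m' := claim1 _ _ _ _ Cq Aq2.
  have /card_gt0P[c cA] : 0 < #|A m| by rewrite Am2.
  apply: (noall c _ _ _ _ C) => //; first exact: (subsetP (AN m)).
  - exact: (subsetP Am_q).
  - by apply: (subsetP Aq_m'); apply: (subsetP Am_q).
  exact: (subsetP Am_q').
have all3 m q m' q' : cyc m q m' q' -> #|A m| = 3.
  by move=> C; have [/(no2 _ _ _ _ C)|] := rangeA _ _ _ _ C.
have opp m q m' q' c : cyc m q m' q' -> c \in N -> c \notin A m -> c \in A m'.
  move=> C cN cm; apply: (subsetP (claim2 _ _ _ _ C (all3 _ _ _ _ C))).
  by rewrite in_setD cm.
have one m q m' q' x y : cyc m q m' q' -> x \in A m -> x \in A m' ->
    y \in A m -> y \in A m' -> x = y.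
  move=> C xm xm' ym ym'.
  have : #|A m :&: A m'| = 1.
    have := cardsUI (A m) (A m').
    have -> : A m :|: A m' = N.
      apply/eqP; rewrite eqEsubset subUset !AN /=; apply/subsetP=> z zN; rewrite in_setU.
      by have [//|/(opp _ _ _ _ z C zN)->] := boolP (z \in A m); rewrite orbT.
    by rewrite (all3 _ _ _ _ C) (all3 _ _ _ _ (rot _ _ _ _ (rot _ _ _ _ C))) v5 => -[].
  move=> /eqP/cards1P[z zE].
  have : x \in A m :&: A m' by rewrite in_setI xm.
  have : y \in A m :&: A m' by rewrite in_setI ym.
  by rewrite zE !inE => /eqP-> /eqP->.
(* In the link of c, [v] has three neighbours, so the link has 5 vertices and a single x not
   adjacent to [v]. Without [v] it is still a perfect matching, and m is paired with m', so x lies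
   in [A m] and [A m']. By [one], x = c, which is not in its own link. *)
have mid m q m' q' c : cyc m q m' q' -> c \in A m -> c \in A m' -> c \in A q ->
    c \notin A q' -> False.
  move=> C cm cm' cq cq'; have cN := subsetP (AN m) c cm; have [cX cv vc] := NX c cN.
  have [mM qM mM' qM'] := mem _ _ _ _ C.
  have inl u : u \in M -> (u \in link e X c) = (c \in A u).
    move=> uM; have [uX _ vu] := MX u uM; rewrite inA // in_link uX e_sym /=.
    by case: eqP => // uc; move: vc; rewrite -uc vu.
  have vl : v \in link e X c by rewrite in_link vX eq_sym cv e_sym.
  have [ml ql ml' ql'] : [/\ m \in link e X c, q \in link e X c, m' \in link e X c &
      q' \notin link e X c] by rewrite !inl.
  have [_ _ vm] := MX m mM; have [_ _ vq] := MX q qM; have [_ _ vm'] := MX m' mM'.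
  case: (C) => ME + mm qq [mq mq' qm mq''].
  rewrite /= !inE !negb_or => /and4P[/and3P[nmq nmm nmq'] /andP[nqm nqq] nmq'' _].
  have nbv : nbrs e (link e X c) v = [set m; q; m'].
    apply/setP=> u; rewrite in_nbrs !in_setU !in_set1; apply/andP/idP => [[ul vu]|].
      have : u \in M by rewrite in_nbrs vu andbT; move: ul; rewrite in_link => /andP[].
      rewrite ME !inE => /orP[//|/eqP uq]; by rewrite uq (negPf ql') in ul.
    by move=> /orP[/orP[]|] /eqP->.
  have c3 : #|nbrs e (link e X c) v| = 3.
    by rewrite nbv cardsU cards2 nmq cards1 (_ : _ :&: _ = set0) ?cards0 //; apply/setP=> u;
      rewrite !inE; apply/negP=> /andP[/orP[]/eqP->]; rewrite ?(negPf nmm) ?(negPf nqm).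
  have [c4|c5] : #|link e X c| = 4 \/ #|link e X c| = 5.
    have := l4 c cX; have := n4 c cX; have := card_link e_irr cX; rewrite X10; clear.
    by case: #|link e X c| => [|[|[|[|[|[|k]]]]]]; [lia|lia|lia|lia|by left|by right|lia].
    by have := mL c cX c4 v vl; rewrite c3.
  have := link_not_acyclic cX; rewrite s2 => nac.
  have := card_link e_irr vl; rewrite c5 c3 addn3 => -[/esym/eqP/cards1P[x xE]].
  have : x \in link e (link e X c) v by rewrite xE set11.
  rewrite in_link => /and3P[xl xv vx].
  have nacy : ~ acyclic e 0 (link e X c :\ v) 2.
    move=> acy; apply: nac; apply: (acyclic_del_link e_sym e_irr vl acy).
    by apply: acyclic_small; rewrite ?xE ?cards1.
  have cd4 : #|link e X c :\ v| = 4.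
    by have := cardsD1 v (link e X c); rewrite c5 vl add1n => -[<-].
  have mat := not_acyclic_matching nacy cd4.
  have dl u : u \in link e X c -> e v u -> u \in link e X c :\ v.
    by move=> ul vu; rewrite in_setD1 ul eq_sym (e_neq e_irr vu).
  have xd : x \in link e X c :\ v by rewrite in_setD1 xv.
  have xN : x \in N.
    by rewrite in_link xv vx !andbT; move: xl; rewrite in_link => /andP[].
  have mx : ~~ e m x.
    apply/negP=> mx; have := nbrs_inj (mat m (dl m ml vm)) xd mx (dl m' ml' vm') mm => xm.
    by rewrite xm vm' in vx.
  have mx' : ~~ e m' x.
    apply/negP=> mx'; have := nbrs_inj (mat m' (dl m' ml' vm')) xd mx' (dl m ml vm).
    by rewrite e_sym => /(_ mm) xm; rewrite xm vm in vx.
  have xc := one _ _ _ _ x c C; rewrite !inA // mx mx' in xc.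
  have {}xc : x = c by apply: xc => //; rewrite -inA.
  by move: xl; rewrite xc in_link eqxx andbF.
have /card_gt0P[m mM] : 0 < #|M| by rewrite v4.
have [q [m' [q' [ME un mm qq nn]]]] := matching4 e_sym e_irr v4 (mN v vX v4) mM.
have C : cyc m q m' q' by [].
have Cq := rot _ _ _ _ C; have Cm' := rot _ _ _ _ Cq; have Cq' := rot _ _ _ _ Cm'.
have /card_gt0P[c] : 0 < #|A m :&: A m'|.
  have := cardsUI (A m) (A m'); rewrite (all3 _ _ _ _ C) (all3 _ _ _ _ Cm').
  have : #|A m :|: A m'| <= 5 by rewrite -v5; apply: subset_leq_card; rewrite subUset !AN.
  by clear; lia.
rewrite in_setI => /andP[cm cm']; have cN := subsetP (AN m) c cm.
have [cq|cq] := boolP (c \in A q); last first.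
  by apply: (mid _ _ _ _ c (refl _ _ _ _ C)) => //; exact: (opp _ _ _ _ c Cq cN cq).
have [cq'|cq'] := boolP (c \in A q'); first exact: (noall c _ _ _ _ C).
exact: (mid _ _ _ _ c C).
Qed.

Lemma no_minimal_counterexample : False.
Proof.
have [s2|s2] := eqVneq s 2.
  have n4 v : v \in X -> 4 <= #|nbrs e X v|.
    move=> vX; rewrite leqNgt; apply/negP=> lt; apply: (nbrs_not_acyclic s2 vX).
    exact: acyclic_small.
  have [/existsP[v /andP[vX /eqP v5]]|no5] :=
      boolP [exists v, (v \in X) && (#|link e X v| == 5)]; first exact: (link5_false s2 n4 vX).
  apply: (link4_false s2 n4) => v vX; have := link_card vX; rewrite s2 => l4.
  have : #|link e X v| != 5.
    by apply: contraNneq no5 => v5; apply/existsP; exists v; rewrite vX v5.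
  by have := n4 v vX; have := card_link e_irr vX; move: leX10 l4; clear; lia.
have [s3|s3] := eqVneq s 3; first exact: face_size3_false.
(* For s >= 4 the count 1 + 2 s + 2 exceeds 10. *)
have [v vX] := X_neq0; have := link_card vX; have := nbrs_gt1 vX.
have := card_link e_irr vX; have := face_size_gt1.
by move: leX10 s2 s3; clear; lia.
Qed.

End MinimalCounterexample.

Theorem cocycles_lift_card_le10 (T : finType) (e : rel T) (X : {set T}) s p :
    symmetric e -> irreflexive e -> p != 0%R -> #|X| <= 10 ->
  cocycles_lift e p X s.
Proof.
move=> e_sym e_irr p0; move: {2}#|X| (leqnn #|X|) => n.
elim: n X s => [|n IHn] X s leX X10; apply: NNPP => nX.
  apply: (no_minimal_counterexample e_sym e_irr p0 X10 _ nX) => Y t.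
  by move/leq_trans/(_ leX).
apply: (no_minimal_counterexample e_sym e_irr p0 X10 _ nX) => Y t YX.
by apply: IHn; [rewrite -ltnS; apply: leq_trans leX | apply: leq_trans (ltnW YX) X10].
Qed.

(** * Ranks of integer matrices *)

Section IntegerRank.
Local Open Scope ring_scope.

Lemma dvdz_row0 p m n (A : 'M[int]_(m, n)) (u : 'rV_m) :
  (forall i, (p %| u 0%R i)%Z) -> forall j, (p %| (u *m A)%R 0%R j)%Z.
Proof. by move=> pu j; rewrite mxE rpred_sum // => i _; rewrite dvdz_mulr. Qed.

(* Taking for [p] an elementary divisor shows that all of them are units. *)
Lemma rank_map_int m n (A : 'M[int]_(m, n)) :
    (forall (p : int) (u : 'rV_m), p != 0 -> (forall j, (p %| (u *m A)%R 0%R j)%Z) ->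
      exists2 u' : 'rV_m, u' *m A = 0 & forall i, (p %| (u' 0%R i - u 0%R i)%R)%Z) ->
  exists r, forall K : fieldType, \rank (map_mx intr A : 'M[K]_(m, n)) = r.
Proof.
move=> liftA; have [L uL [R uR [d sd AE]]] := int_Smith_normal_form A.
pose D := \matrix_(i < m, j < n) (d`_i *+ (i == j :> nat)).
(* The row [u] is chosen so that [u *m L] is the i-th unit vector; then d_i divides [u *m A]. For a
   lift [u'] in the kernel the i-th coordinate of [u' *m L] is 0, and comparison modulo d_i shows
   that d_i divides 1. *)
have dunit (i : nat) : (i < m)%N -> (i < n)%N -> d`_i != 0 -> d`_i \is a GRing.unit.
  move=> im i_n di0; pose im' := Ordinal im; pose in' := Ordinal i_n.
  pose u : 'rV_m := delta_mx 0 im' *m invmx L.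
  have uA : u *m A = d`_i *: (delta_mx 0 in' *m R).
    rewrite AE /u -mulmxA !mulmxA mulmxKV // -/D scalemxAl; congr (_ *m _).
    apply/rowP=> j; rewrite -rowE !mxE eqxx /= -val_eqE /=.
    by rewrite eq_sym; case: eqP; rewrite ?mulr1 ?mulr0 ?mulr1n ?mulr0n.
  have [|u' u'A u'u] := liftA d`_i u di0.
    by move=> j; rewrite uA mxE dvdz_mulr.
  have u'L : (u' *m L) 0 im' = 0.
    have /matrixP/(_ 0 in') : u' *m L *m D = 0.
      by apply: (can_inj (mulmxK uR)); rewrite mul0mx -!mulmxA (mulmxA L) -AE.
    rewrite [LHS]mxE [RHS]mxE (bigD1 im') //= big1 ?addr0 => [|k ki].
      by rewrite [D _ _]mxE eqxx mulr1n => /eqP; rewrite mulf_eq0 (negPf di0) orbF => /eqP.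
    rewrite [D _ _]mxE (_ : (k == i :> nat) = false) ?mulr0n ?mulr0 //.
    by apply: contraNF ki => /eqP ki; apply/eqP/val_inj.
  have := @dvdz_row0 d`_i _ _ L (u' - u) _ im'; rewrite mulmxBl mulmxKV //.
  have -> : (u' *m L - delta_mx 0 im') 0 im' = -1.
    by rewrite mxE u'L !mxE !eqxx sub0r.
  rewrite rpredN => H.
  suff : (d`_i %| 1)%Z by case/dvdzP=> q qE; apply/unitrP; exists q; rewrite -qE mulrC -qE.
  by apply: H => k; have := u'u k; rewrite !mxE.
pose N := minn m n.
pose r := find (fun i => d`_i == 0) (iota 0 N).
have rN : (r <= N)%N by have := find_size (fun i => d`_i == 0) (iota 0 N); rewrite size_iota.
have d_lt i : (i < r)%N -> d`_i != 0.
  move=> ir; have := before_find 0%N ir; rewrite nth_iota ?add0n => [->//|].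
  exact: leq_trans ir rN.
(* Each divisor divides the next, so the zeros come last; beyond the end of [d] the default value is
   0 as well. *)
have d_ge i : (r <= i)%N -> (i < N)%N -> d`_i = 0.
  move=> ri iN; have rN' := leq_ltn_trans ri iN.
  have dr : d`_r = 0.
    have hs : has (fun i => d`_i == 0) (iota 0 N) by rewrite has_find -/r size_iota.
    by have := nth_find 0%N hs; rewrite -/r nth_iota // add0n => /eqP.
  have [isz|isz] := ltnP i (size d); last by rewrite nth_default.
  have tr : transitive dvdz by move=> x y z; apply: dvdz_trans.
  have := sorted_leq_nth tr dvdzz 0 sd; move/(_ r i); rewrite !inE isz (leq_ltn_trans ri isz).
  move=> /(_ isT isT ri) ri_dvd; have {ri_dvd} : (d`_r %| d`_i)%Z := ri_dvd.
  by rewrite dr dvd0z => /eqP.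
exists r => K; rewrite AE !map_mxM.
have unitK k (M : 'M[int]_k) : M \in unitmx -> map_mx (intr : int -> K) M \in unitmx.
  by rewrite !unitmxE det_map_mx; apply: rmorph_unit.
rewrite mxrankMfree ?row_free_unit ?unitK // (eqmxMfull _ _) ?row_full_unit ?unitK //.
(* The entries 1 past [r] make the diagonal factor invertible without changing the product. *)
pose U : 'rV[K]_m := \row_i if (i < r)%N then (d`_i)%:~R else 1.
have -> : map_mx intr D = diag_mx U *m pid_mx r.
  apply/matrixP=> i j; rewrite mul_diag_mx !mxE rmorphMn /=.
  case: (eqVneq (i : nat) j) => [ij|]; rewrite ?mulr0n ?mulr0 //= mulr1n.
  case: ltnP => ir; rewrite ?mulr1 // mulr0 d_ge //.
  by rewrite leq_min ltn_ord ij ltn_ord.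
rewrite (eqmxMfull _ _); last first.
  rewrite row_full_unit unitmxE det_diag unitfE prodf_seq_neq0; apply/allP=> i _ /=.
  rewrite mxE; case: ifP => ir; rewrite ?oner_eq0 // -unitfE.
  apply: rmorph_unit; apply: dunit (d_lt _ ir) => //.
  by apply: leq_trans ir (leq_trans rN (geq_minr _ _)).
by rewrite rank_pid_mx // (leq_trans rN) ?geq_minl ?geq_minr.
Qed.

End IntegerRank.

(** * Graded resolutions *)

Section GradedParts.
Local Open Scope ring_scope.
Variables (K : fieldType) (n : nat).
Local Notation R := {mpoly K[n]}.
Implicit Types (p q : R) (a b c : nat).

(* Homogeneous of degree [a - b], hence zero when [a < b]. *)
Definition hdeg a b p := forall m, m \in msupp p -> (mdeg m + b = a)%N.

Definition hpart a b p : R :=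
  \sum_(m <- msupp p | (mdeg m + b == a)%N) p@_m *: 'X_[m].

Lemma mcoeff_hpart a b p m :
  (hpart a b p)@_m = if (mdeg m + b == a)%N then p@_m else 0.
Proof.
have sumE (S : pred 'X_{1..n}) : (\sum_(m <- msupp p | S m) p@_m *: 'X_[m])@_m
    = \sum_(k <- msupp p | S k) p@_k * (k == m)%:R.
  by rewrite raddf_sum; apply: eq_bigr => k _; rewrite /= mcoeffZ mcoeffX.
rewrite /hpart sumE; case: ifP => mS.
  rewrite [in RHS](mpolyE p) sumE big_mkcond; apply: eq_bigr => k _.
  by case: (eqVneq k m) => [->|_]; rewrite ?mS ?mulr0 ?if_same.
rewrite big1 // => k kS; case: eqP => [km|_]; last by rewrite mulr0.
by rewrite km mS in kS.
Qed.

Lemma hpartD a b p q : hpart a b (p + q) = hpart a b p + hpart a b q.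
Proof.
by apply/mpolyP=> m; rewrite mcoeffD !mcoeff_hpart mcoeffD; case: ifP; rewrite ?addr0.
Qed.

Lemma hpart0 a b : hpart a b 0 = 0.
Proof. by apply/mpolyP=> m; rewrite mcoeff_hpart mcoeff0 if_same. Qed.

Lemma hpartN a b p : hpart a b (- p) = - hpart a b p.
Proof. by apply/mpolyP=> m; rewrite mcoeffN !mcoeff_hpart mcoeffN; case: ifP; rewrite ?oppr0. Qed.

Lemma hpart_sum a b (I : finType) (F : I -> R) :
  hpart a b (\sum_i F i) = \sum_i hpart a b (F i).
Proof. by rewrite (big_morph _ (hpartD a b) (hpart0 a b)). Qed.

Lemma hdeg_hpart a b p : hdeg a b (hpart a b p).
Proof. by move=> m; rewrite mcoeff_msupp mcoeff_hpart; case: ifP => [/eqP|]; rewrite ?eqxx. Qed.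

Lemma hdegP a b p : hdeg a b p <-> hpart a b p = p.
Proof.
split=> [pH|<-]; last exact: hdeg_hpart.
apply/mpolyP=> m; rewrite mcoeff_hpart; case: eqP => // mab.
by apply/esym/memN_msupp_eq0/negP=> /pH.
Qed.

Lemma hpartM a b c p q : hdeg b c q -> hpart a c (p * q) = hpart a b p * q.
Proof.
move=> qH; rewrite -{1}[p](subrK (hpart a b p)) mulrDl hpartD.
rewrite [X in X + _](_ : _ = 0) ?add0r.
  apply/hdegP=> m /msuppM_le /allpairsP[[m1 m2] /= [m1p m2q ->]].
  by rewrite mdegD -addnA (qH m2) // (hdeg_hpart m1p).
apply/mpolyP=> m; rewrite mcoeff0 mcoeff_hpart; case: eqP => // ma.
apply/memN_msupp_eq0/negP=> /msuppM_le /allpairsP[[m1 m2] /= [+ m2q mE]].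
rewrite mcoeff_msupp mcoeffB mcoeff_hpart -ma mE mdegD -addnA (qH m2) // eqxx.
by rewrite subrr eqxx.
Qed.

Lemma hdegD a b p q : hdeg a b p -> hdeg a b q -> hdeg a b (p + q).
Proof. by rewrite !hdegP hpartD => -> ->. Qed.

Lemma hdegN a b p : hdeg a b p -> hdeg a b (- p).
Proof. by rewrite !hdegP hpartN => ->. Qed.

Lemma hdegB a b p q : hdeg a b p -> hdeg a b q -> hdeg a b (p - q).
Proof. by move=> pH qH; apply: hdegD => //; apply: hdegN. Qed.

Lemma hdeg_sum a b (I : finType) (F : I -> R) :
  (forall i, hdeg a b (F i)) -> hdeg a b (\sum_i F i).
Proof.
move=> FH; apply/hdegP; rewrite hpart_sum; apply: eq_bigr => i _.
by rewrite ((hdegP _ _ _).1 (FH i)).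
Qed.

Lemma hdegM a b c p q : hdeg a b p -> hdeg b c q -> hdeg a c (p * q).
Proof. by move=> pH qH; apply/hdegP; rewrite (hpartM _ _ qH) ((hdegP _ _ _).1 pH). Qed.

Lemma hdeg0 a b : hdeg a b 0.
Proof. by apply/hdegP; rewrite hpart0. Qed.

Lemma hdeg1 a : hdeg a a 1.
Proof. by move=> m; rewrite msupp1 inE => /eqP->; rewrite mdeg0. Qed.

Lemma hdeg_mcoeff0 a b p : hdeg a b p -> a != b -> p@_0%MM = 0.
Proof.
move=> pH ab; apply/memN_msupp_eq0/negP=> /pH; rewrite mdeg0 => /esym/eqP.
by rewrite (negPf ab).
Qed.

Definition hmx k l (da : 'I_k -> nat) (db : 'I_l -> nat) (A : 'M[R]_(k, l)) :=
  forall i j, hdeg (da i) (db j) (A i j).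

Lemma hmxM k l h (da : 'I_k -> nat) (db : 'I_l -> nat) (dc : 'I_h -> nat) A B :
  hmx da db A -> hmx db dc B -> hmx da dc (A *m B).
Proof. by move=> AH BH i j; rewrite mxE; apply: hdeg_sum => x; apply: hdegM. Qed.

Lemma hmxB k l (da : 'I_k -> nat) (db : 'I_l -> nat) A B :
  hmx da db A -> hmx da db B -> hmx da db (A - B).
Proof. by move=> AH BH i j; rewrite !mxE; apply: hdegB. Qed.

Lemma hmx1 k (da : 'I_k -> nat) : hmx da da 1%:M.
Proof.
by move=> i j; rewrite mxE; case: eqP => [->|_]; [apply: hdeg1 | apply: hdeg0].
Qed.

(** Each row is lifted with no regard to degrees, and then only the homogeneous parts of the entries
    are kept; as [D] is homogeneous, the product is still [V]. *)
Lemma hmx_factor k l h (da : 'I_k -> nat) (db : 'I_l -> nat) (dc : 'I_h -> nat)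
    (V : 'M[R]_(k, h)) (D : 'M_(l, h)) :
    hmx db dc D -> hmx da dc V -> (forall i, exists w, row i V = w *m D) ->
  exists2 W : 'M[R]_(k, l), hmx da db W & V = W *m D.
Proof.
move=> DH VH /fin_all_exists[w wE].
exists (\matrix_(i, j) hpart (da i) (db j) (w i 0 j)).
  by move=> i j; rewrite mxE; apply: hdeg_hpart.
apply/matrixP=> i j; rewrite mxE -((hdegP _ _ _).1 (VH i j)).
have /rowP/(_ j) := wE i; rewrite !mxE => ->; rewrite hpart_sum.
by apply: eq_bigr => x _; rewrite mxE (hpartM _ _ (DH x j)).
Qed.

End GradedParts.

(** * Comparison of graded free resolutions *)

Section Resolutions.
Local Open Scope ring_scope.
Variables (K : fieldType) (n : nat) (I : {mpoly K[n]} -> Prop).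
Local Notation R := {mpoly K[n]}.

Record graded_free_resolution := GradedFreeResolution {
  gr_rank : nat -> nat;
  gr_deg : forall i, 'I_(gr_rank i) -> nat;
  gr_aug : 'cV[R]_(gr_rank 0);
  gr_diff : forall i, 'M[R]_(gr_rank i.+1, gr_rank i);
  gr_aug_hdeg : forall j, hdeg (gr_deg j) 0 (gr_aug j 0);
  gr_diff_hmx : forall i, hmx (@gr_deg i.+1) (@gr_deg i) (gr_diff i);
  gr_aug_surj : forall p, exists v : 'rV_(gr_rank 0), I (p - (v *m gr_aug) 0 0);
  gr_exact0 : forall v : 'rV_(gr_rank 0),
    I ((v *m gr_aug) 0 0) <-> exists w, v = w *m gr_diff 0;
  gr_exact : forall i (v : 'rV_(gr_rank i.+1)),
    v *m gr_diff i = 0 <-> exists w, v = w *m gr_diff i.+1 }.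

Lemma minimal_hdeg (F : graded_minimal_free_resolution I) j :
  hdeg (res_deg j) 0 (res_aug F j 0).
Proof. by move=> m mF; rewrite addn0; move/dhomogP: (res_aug_homog j); apply. Qed.

Definition resolution_of_minimal (F : graded_minimal_free_resolution I) :=
  @GradedFreeResolution (res_rank F) (@res_deg _ _ _ F) (res_aug F) (@res_diff _ _ _ F)
    (@minimal_hdeg F) (@res_diff_homog _ _ _ F) (@res_aug_surj _ _ _ F)
    (@res_exact0 _ _ _ F) (@res_exact _ _ _ F).

Hypothesis I_D : forall p q, I p -> I q -> I (p + q).
Hypothesis I_M : forall p q, I q -> I (p * q).
Hypothesis I_hpart : forall a p, I p -> I (hpart a 0 p).

Lemma I_N p : I p -> I (- p).
Proof. by rewrite -mulN1r; apply: I_M. Qed.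

Lemma I_B p q : I p -> I q -> I (p - q).
Proof. by move=> Ip Iq; apply/I_D/I_N. Qed.

Definition mxI k l (A : 'M[R]_(k, l)) := forall i j, I (A i j).

Lemma mxI_M k l h (A : 'M[R]_(k, l)) (B : 'M_(l, h)) : I 0 -> mxI B -> mxI (A *m B).
Proof.
by move=> I0 BI i j; rewrite mxE; apply: big_ind => // x _; apply/I_M/BI.
Qed.

Lemma mxI_B k l (A B : 'M[R]_(k, l)) : mxI A -> mxI B -> mxI (A - B).
Proof. by move=> AI BI i j; rewrite !mxE; apply: I_B. Qed.

Section Lifting.
Variable H : graded_free_resolution.

Lemma gr_I0 : I 0.
Proof.
have [_ H0] := gr_exact0 (0 : 'rV_(gr_rank H 0)).
by have := H0 (ex_intro _ 0 (esym (mul0mx _ _))); rewrite mul0mx mxE.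
Qed.

Lemma diff_diff i : gr_diff H i.+1 *m gr_diff H i = 0.
Proof.
apply/row_matrixP=> j; rewrite row_mul row0.
by apply/gr_exact; exists (delta_mx 0 j); rewrite -rowE.
Qed.

Lemma diff_aug : mxI (gr_diff H 0 *m gr_aug H).
Proof.
move=> i j; rewrite ord1.
have -> : (gr_diff H 0 *m gr_aug H) i 0 = (row i (gr_diff H 0) *m gr_aug H) 0 0.
  by rewrite -row_mul [RHS]mxE.
by apply/gr_exact0; exists (delta_mx 0 i); rewrite -rowE.
Qed.

Lemma lift_aug k (da : 'I_k -> nat) (P : 'cV[R]_k) :
  (forall j, hdeg (da j) 0 (P j 0)) ->
  exists2 V, hmx da (@gr_deg H 0) V & mxI (P - V *m gr_aug H).
Proof.
move=> PH; have [v vP] := fin_all_exists (fun j => gr_aug_surj H (P j 0)).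
exists (\matrix_(i, j) hpart (da i) (gr_deg j) (v i 0 j)).
  by move=> i j; rewrite mxE; apply: hdeg_hpart.
move=> i j; rewrite ord1; have := I_hpart (da i) (vP i).
rewrite hpartD hpartN ((hdegP _ _ _).1 (PH i)) !mxE hpart_sum; congr (I (_ - _)).
by apply: eq_bigr => x _; rewrite mxE (hpartM _ _ (gr_aug_hdeg (j := x))).
Qed.

Lemma lift_diff0 k (da : 'I_k -> nat) (V : 'M_(k, gr_rank H 0)) :
  hmx da (@gr_deg H 0) V -> mxI (V *m gr_aug H) ->
  exists2 W, hmx da (@gr_deg H 1) W & V = W *m gr_diff H 0.
Proof.
move=> VH VI; apply: (hmx_factor (gr_diff_hmx (i := 0)) VH) => i.
by apply/gr_exact0; rewrite -row_mul [row _ _ _ _]mxE.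
Qed.

Lemma lift_diff k (da : 'I_k -> nat) i (V : 'M_(k, gr_rank H i.+1)) :
  hmx da (@gr_deg H i.+1) V -> V *m gr_diff H i = 0 ->
  exists2 W, hmx da (@gr_deg H i.+2) W & V = W *m gr_diff H i.+1.
Proof.
move=> VH V0; apply: (hmx_factor (gr_diff_hmx (i := i.+1)) VH) => j.
by apply/gr_exact; rewrite -row_mul V0 row0.
Qed.

End Lifting.

(** Dependent choice in types that vary with the degree: lifting is a mere existence statement, and
    resolutions may be infinite. *)
Lemma dependent_sequence (A : nat -> Type) (P : forall i, A i -> Prop)
    (Q : forall i, A i -> A i.+1 -> Prop) :
  (exists x, P 0 x) -> (forall i x, P i x -> exists2 y, Q i x y & P i.+1 y) ->
  exists x : forall i, A i, (forall i, P i (x i)) /\ forall i, Q i (x i) (x i.+1).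
Proof.
move=> P0 PS.
have PS' i (x : {x | P i x}) : exists y, Q i (sval x) y /\ P i.+1 y.
  by have [y] := PS i _ (svalP x); exists y.
pose x0 : {x | P 0%N x} := constructive_indefinite_description _ P0.
pose step i (x : {x | P i x}) : {y | P i.+1 y} :=
  let y := constructive_indefinite_description _ (PS' i x) in
  exist _ (sval y) (svalP y).2.
pose x := fix x i : {x | P i x} := if i is j.+1 then step j (x j) else x0.
exists (fun i => sval (x i)); split=> i; first exact: svalP.
exact: (svalP (constructive_indefinite_description _ (PS' i (x i)))).1.
Qed.

Section ChainMaps.
Variables G H : graded_free_resolution.

Record chain_map := ChainMap {
  cm :> forall i, 'M[R]_(gr_rank G i, gr_rank H i);
  cm_hmx : forall i, hmx (@gr_deg G i) (@gr_deg H i) (cm i);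
  cm_aug : mxI (gr_aug G - cm 0 *m gr_aug H);
  cm_diff : forall i, gr_diff G i *m cm i = cm i.+1 *m gr_diff H i }.

Lemma chain_map_exists : exists f : chain_map, True.
Proof.
have I0 := gr_I0 G.
have [f0 f0H f0I] := lift_aug H (@gr_aug_hdeg G).
(* The invariant is what makes the next composite a cycle of [H], hence liftable; in degree 0 the
   augmentation plays this role. *)
pose P i : 'M[R]_(gr_rank G i, gr_rank H i) -> Prop :=
  match i with
  | 0 => fun f => hmx (@gr_deg G 0) (@gr_deg H 0) f /\ mxI (gr_aug G - f *m gr_aug H)
  | j.+1 => fun f => hmx (@gr_deg G j.+1) (@gr_deg H j.+1) f /\
              gr_diff G j.+1 *m f *m gr_diff H j = 0
  end.
pose Q i f f' := gr_diff G i *m f = f' *m gr_diff H i.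
have [|i f Pf|f [fP fQ]] := @dependent_sequence _ P Q; first by exists f0.
  have fH : hmx (@gr_deg G i) (@gr_deg H i) f by case: i f Pf => [|i] f [].
  have [f' f'H f'E] : exists2 W, hmx (@gr_deg G i.+1) (@gr_deg H i.+1) W &
      gr_diff G i *m f = W *m gr_diff H i.
    have DfH := hmxM (gr_diff_hmx (i := i)) fH.
    case: i f Pf fH DfH => [|i] f [_ fP] fH DfH; last exact: lift_diff.
    apply: lift_diff0 => //; rewrite -mulmxA.
    have -> : gr_diff G 0 *m (f *m gr_aug H) =
        gr_diff G 0 *m gr_aug G - gr_diff G 0 *m (gr_aug G - f *m gr_aug H).
      by rewrite mulmxBr opprB addrC subrK.
    by apply: mxI_B; [apply: diff_aug | apply: mxI_M].
  by exists f' => //; split=> //; rewrite -mulmxA -f'E mulmxA diff_diff mul0mx.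
have fH i : hmx (@gr_deg G i) (@gr_deg H i) (f i) by case: i (fP i) => [|i] [].
by exists (@ChainMap f fH (fP 0).2 fQ).
Qed.

End ChainMaps.

(** Both the composite and the identity lift the identity of R/I, so their difference is
    null-homotopic. Matrices act on rows from the right: [f *m g] is [f] followed by [g]. *)
Lemma comp_homotopic_id (G H : graded_free_resolution) (f : chain_map G H) (g : chain_map H G) :
  exists s : forall i, 'M[R]_(gr_rank G i, gr_rank G i.+1),
  [/\ forall i, hmx (@gr_deg G i) (@gr_deg G i.+1) (s i),
      f 0 *m g 0 - 1%:M = s 0 *m gr_diff G 0 &
      forall i, f i.+1 *m g i.+1 - 1%:M = gr_diff G i *m s i + s i.+1 *m gr_diff G i.+1].
Proof.
have I0 := gr_I0 G.
pose h i := f i *m g i - 1%:M.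
have hH i : hmx (@gr_deg G i) (@gr_deg G i) (h i).
  by apply: hmxB; [apply: hmxM; apply: cm_hmx | apply: hmx1].
have hD i : gr_diff G i *m h i = h i.+1 *m gr_diff G i.
  rewrite mulmxBr mulmxBl mulmx1 mul1mx; congr (_ - _).
  by rewrite mulmxA cm_diff -mulmxA cm_diff mulmxA.
have hI : mxI (h 0 *m gr_aug G).
  have -> : h 0 *m gr_aug G =
      0 - (gr_aug G - f 0 *m gr_aug H) - f 0 *m (gr_aug H - g 0 *m gr_aug G).
    by rewrite mulmxBl mul1mx mulmxBr mulmxA sub0r !opprB [RHS]addrC subrKA.
  apply: mxI_B; [apply: mxI_B|]; last by apply: mxI_M => //; apply: cm_aug.
    by move=> i j; rewrite mxE.
  exact: cm_aug.
have [s0 s0H s0E] := lift_diff0 (hH 0%N) hI.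
(* After composition with the differential the preceding homotopy drops out, so this invariant
   mentions only the current [s]; the last clause keeps the equation in degree 0. *)
pose P i s := [/\ hmx (@gr_deg G i) (@gr_deg G i.+1) s,
  gr_diff G i *m (h i - s *m gr_diff G i) = 0 &
  i = 0%N -> h i = s *m gr_diff G i].
pose Q i s s' := h i.+1 - gr_diff G i *m s = s' *m gr_diff G i.+1.
have [|i s [sH sP _]|s [sP sQ]] := @dependent_sequence _ P Q.
- by exists s0; split=> //; rewrite -s0E subrr mulmx0.
- have [||s' s'H s'E] := @lift_diff G _ (@gr_deg G i.+1) i (h i.+1 - gr_diff G i *m s).
  + by apply: hmxB => //; apply: hmxM sH; apply: gr_diff_hmx.
  + by rewrite mulmxBl -hD -mulmxA -mulmxBr sP.
  exists s' => //; split=> //; rewrite -s'E opprB addrC subrK mulmxA.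
  by rewrite diff_diff mul0mx.
exists s; split=> [i||i]; [by have [] := sP i | by have [_ _ sE] := sP 0%N; apply: sE |].
by rewrite -[_ - _]/(h i.+1) -sQ addrC subrK.
Qed.

End Resolutions.

(** * Betti numbers from ranks modulo the variables *)

Section MinimalRank.
Local Open Scope ring_scope.

(** The homotopy places every cycle in the sum of the row spaces of [f] and [P]; applying [g], which
    kills [P] and inverts [f], shows that the sum is direct. *)
Lemma rank_homology (K : fieldType) r a b c (f : 'M[K]_(r, b)) (g : 'M_(b, r))
    (P : 'M_(c, b)) (Q : 'M_(b, a)) t1 t2 :
    f *m g = 1%:M -> f *m Q = 0 -> P *m g = 0 -> P *m Q = 0 ->
    g *m f - 1%:M = Q *m t1 + t2 *m P ->
  (r + \rank P + \rank Q = b)%N.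
Proof.
move=> fg fQ Pg PQ hom.
have kerE : (kermx Q :=: f + P)%MS.
  apply/eqmxP/andP; split; last first.
    by rewrite addsmx_sub; apply/andP; split; apply/sub_kermxP.
  apply/rV_subP=> u /sub_kermxP uQ.
  have -> : u = u *m g *m f - u *m t2 *m P.
    have := congr1 (mulmx u) hom.
    rewrite mulmxBr mulmx1 mulmxDr !mulmxA uQ mul0mx add0r => <-.
    by rewrite opprB addrC subrK.
  by rewrite addmx_sub_adds ?eqmx_opp ?submxMl.
have cap0 : (f :&: P)%MS = 0.
  apply/eqP/rowV0P=> u; rewrite sub_capmx => /andP[/submxP[v uE] /submxP[w wE]].
  have vE : v = u *m g by rewrite uE -mulmxA fg mulmx1.
  by rewrite uE vE wE -(mulmxA w) Pg mulmx0 mul0mx.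
have rf : \rank f = r.
  apply/eqP; rewrite eqn_leq rank_leq_row /=.
  by rewrite -{1}(mxrank1 K r) -fg mxrankM_maxl.
have := mxrank_ker Q; rewrite kerE mxrank_disjoint_sum // rf => ->.
by rewrite subnK // rank_leq_row.
Qed.

Definition degree_set k (da : 'I_k -> nat) (d : nat) := [set j | da j == d].

(* For [A] a differential of a free complex [G], the degree [d] part of the
   differential of [G / (x_0, ..., x_(n-1)) G]. *)
Definition const_part (K : fieldType) n k l (da : 'I_k -> nat) (db : 'I_l -> nat) d
    (A : 'M[{mpoly K[n]}]_(k, l)) : 'M[K]_(#|degree_set da d|, #|degree_set db d|) :=
  \matrix_(i, j) (A (enum_val i) (enum_val j))@_0%MM.

Section ConstPart.
Variables (K : fieldType) (n d : nat).

Lemma const_partM k l h (da : 'I_k -> nat) (db : 'I_l -> nat) (dc : 'I_h -> nat)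
    (A : 'M[{mpoly K[n]}]_(k, l)) B : hmx da db A ->
  const_part da dc d (A *m B) = const_part da db d A *m const_part db dc d B.
Proof.
move=> AH; apply/matrixP=> i j; rewrite !mxE rmorph_sum /=.
under [RHS]eq_bigr do rewrite !mxE.
rewrite -(big_enum_val (fun x => (A (enum_val i) x)@_0%MM * (B x (enum_val j))@_0%MM)).
rewrite [RHS]big_mkcond /=; apply: eq_bigr => x _; rewrite rmorphM /=.
case: ifPn; rewrite inE // => dx.
rewrite (hdeg_mcoeff0 (AH _ _)) ?mul0r //.
by have := enum_valP i; rewrite inE => /eqP->; rewrite eq_sym.
Qed.

Lemma const_partD k l (da : 'I_k -> nat) (db : 'I_l -> nat) (A B : 'M[{mpoly K[n]}]_(k, l)) :
  const_part da db d (A + B) = const_part da db d A + const_part da db d B.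
Proof. by apply/matrixP=> i j; rewrite !mxE mcoeffD. Qed.

Lemma const_partB k l (da : 'I_k -> nat) (db : 'I_l -> nat) (A B : 'M[{mpoly K[n]}]_(k, l)) :
  const_part da db d (A - B) = const_part da db d A - const_part da db d B.
Proof. by apply/matrixP=> i j; rewrite !mxE mcoeffB. Qed.

Lemma const_part1 k (da : 'I_k -> nat) : const_part da da d (1%:M : 'M[{mpoly K[n]}]_k) = 1%:M.
Proof.
apply/matrixP=> i j; rewrite !mxE (inj_eq enum_val_inj).
by rewrite raddfMn /= mcoeff1 eqxx.
Qed.

End ConstPart.

Lemma graded_betti_rank (K : fieldType) n (I : {mpoly K[n]} -> Prop)
    (I_D : forall p q, I p -> I q -> I (p + q)) (I_M : forall p q, I q -> I (p * q))
    (I_hpart : forall a p, I p -> I (hpart a 0 p))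
    (F : graded_minimal_free_resolution I) (G : graded_free_resolution I) (i d : nat) :
  let rk j := \rank (const_part (@gr_deg _ _ _ G j.+1) (@gr_deg _ _ _ G j) d (gr_diff G j)) in
  (graded_betti F i d + rk i + (if i is j.+1 then rk j else 0)
    = #|degree_set (@gr_deg _ _ _ G i) d|)%N.
Proof.
pose F' := resolution_of_minimal F.
have [f _] := chain_map_exists I_D I_M I_hpart F' G.
have [g _] := chain_map_exists I_D I_M I_hpart G F'.
have [s [sH s0 sS]] := comp_homotopic_id I_D I_M f g.
have [t [tH t0 tS]] := comp_homotopic_id I_D I_M g f.
pose dF j := @gr_deg _ _ _ F' j; pose dG j := @gr_deg _ _ _ G j.
have min j : const_part (dF j.+1) (dF j) d (gr_diff F' j) = 0.
  by apply/matrixP=> x y; rewrite !mxE; apply: res_minimal.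
have DFH j : hmx (dF j.+1) (dF j) (gr_diff F' j) := gr_diff_hmx (i := j).
have DGH j : hmx (dG j.+1) (dG j) (gr_diff G j) := gr_diff_hmx (i := j).
have fH j : hmx (dF j) (dG j) (f j) := cm_hmx (c := f) (i := j).
have gH j : hmx (dG j) (dF j) (g j) := cm_hmx (c := g) (i := j).
pose fb j := const_part (dF j) (dG j) d (f j).
pose gb j := const_part (dG j) (dF j) d (g j).
pose Db j := const_part (dG j.+1) (dG j) d (gr_diff G j).
have fg j : fb j *m gb j = 1%:M.
  (* Each homotopy term contains a differential of [F'], whose constant part is 0, so the composite
     is exactly the identity. *)
  apply/eqP; rewrite -subr_eq0 -(const_partM d _ _ (fH j)) -[1%:M](const_part1 K n) -const_partB.
  case: j => [|j]; first by rewrite s0 (const_partM _ _ _ (sH 0%N)) min mulmx0.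
  rewrite sS const_partD (const_partM _ _ _ (DFH j)) (const_partM _ _ _ (sH j.+1)).
  by rewrite !min mul0mx mulmx0 addr0.
have fD j : fb j.+1 *m Db j = 0.
  by rewrite -(const_partM d _ _ (fH j.+1)) -cm_diff (const_partM d _ _ (DFH j)) min mul0mx.
have Dg j : Db j *m gb j = 0.
  by rewrite -(const_partM d _ _ (DGH j)) cm_diff (const_partM d _ _ (gH j.+1)) min mulmx0.
have DD j : Db j.+1 *m Db j = 0.
  rewrite -(const_partM d _ _ (DGH j.+1)) diff_diff; apply/matrixP=> x y.
  by rewrite !mxE; apply: mcoeff0.
have gf0 : gb 0%N *m fb 0%N - 1%:M = const_part (dG 0) (dG 1) d (t 0%N) *m Db 0%N.
  rewrite -(const_partM d _ _ (gH 0)) -[1%:M](const_part1 K n) -const_partB t0.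
  exact: const_partM (tH 0%N).
have gfS j : gb j.+1 *m fb j.+1 - 1%:M = Db j *m const_part (dG j) (dG j.+1) d (t j)
    + const_part (dG j.+1) (dG j.+2) d (t j.+1) *m Db j.+1.
  rewrite -(const_partM d _ _ (gH j.+1)) -[1%:M](const_part1 K n) -const_partB tS const_partD.
  by rewrite (const_partM d _ _ (DGH j)) (const_partM d _ _ (tH j.+1)).
rewrite /= /graded_betti; case: i => [|i]; last exact: rank_homology (fg _) _ _ _ (gfS i).
(* In degree 0 the missing outgoing differential is replaced by the map to a space of dimension
   0. *)
rewrite -[X in (_ + X)%N](mxrank0 K #|degree_set (dG 0%N) d| 0).
apply: (rank_homology (fg 0%N) (mulmx0 _ _) (Dg 0%N) (mulmx0 _ _)
  (t1 := (0 : 'M_(0, _))) (t2 := const_part (dG 0%N) (dG 1%N) d (t 0%N))).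
by rewrite mul0mx add0r.
Qed.

End MinimalRank.

(** * An explicit resolution *)

Section Operator.
Local Open Scope ring_scope.
Variables (T : finType) (e : rel T).
Local Notation indep := (independence_complex e).
Implicit Types (W F A : {set T}) (k l v : T).

Section OverRing.
Variable R : comNzRingType.
Implicit Types (c b : {set T} -> {set T} -> R) (y z : T -> R) (g : {set T} -> R).

Lemma contract0 k g W : (forall W', W' != set0 -> g W' = 0) -> contract k g W = 0.
Proof.
move=> g0; rewrite /contract; case: ifP => // _; rewrite g0 ?mulr0 //.
by apply/set0Pn; exists k; rewrite setU11.
Qed.

Lemma contractM k (a : R) g W : contract k (fun W' => a * g W') W = a * contract k g W.
Proof. by rewrite /contract; case: ifP; rewrite ?mulr0 // mulrCA. Qed.

Lemma contractD k g h W :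
  contract k (fun W' => g W' + h W') W = contract k g W + contract k h W.
Proof. by rewrite /contract; case: ifP; rewrite ?addr0 // mulrDr. Qed.

Lemma contractN k g W : contract k (fun W' => - g W') W = - contract k g W.
Proof. by rewrite /contract; case: ifP; rewrite ?oppr0 // mulrN. Qed.

(* The differential sends the generator [(W, F)], with [W] disjoint from the
   face [F], to the alternating sum over [k] in [W] of
   [y_k (W - k, F) - (W - k, F + k)]; here it acts on coefficient functions. *)
Definition twist y k c W F := y k * c W F - (if k \in F then c W (F :\ k) else 0).
Definition tdiff y c W F :=
  if F \in indep then \sum_k contract k (fun W' => twist y k c W' F) W else 0.

Lemma twistC y k l c W F : twist y k (twist y l c) W F = twist y l (twist y k c) W F.
Proof.
rewrite /twist !mulrBr !in_setD1 eq_sym [F :\ k :\ l]setDDl [F :\ l :\ k]setDDl setUC.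
rewrite [y l * (y k * _)]mulrCA; set P := y k * (y l * _).
have [->|lk] := eqVneq l k; first by [].
case: (k \in F); case: (l \in F); rewrite ?mulr0 ?subr0 //=.
by rewrite !opprB -!addrA; congr (_ + _); rewrite addrCA [RHS]addrCA; congr (_ + _); rewrite addrC.
Qed.

Lemma eq_tdiff y z c b W F : y =1 z -> (forall W' F', c W' F' = b W' F') ->
  tdiff y c W F = tdiff z b W F.
Proof.
move=> yz cb; rewrite /tdiff; case: ifP => // _; apply: eq_bigr => k _.
by apply: eq_contract => W'; rewrite /twist !cb yz.
Qed.

Lemma tdiff_sum y (I : finType) (a : I -> R) (c : I -> {set T} -> {set T} -> R) W F :
  tdiff y (fun W' F' => \sum_i a i * c i W' F') W F = \sum_i a i * tdiff y (c i) W F.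
Proof.
rewrite /tdiff; case: ifP => _; last by rewrite big1 // => i _; rewrite mulr0.
under [RHS]eq_bigr do rewrite mulr_sumr.
rewrite exchange_big; apply: eq_bigr => k _ /=.
under [RHS]eq_bigr do rewrite -contractM.
rewrite -contract_sum; apply: eq_contract => W'; rewrite /twist mulr_sumr.
case: ifP => _; rewrite ?subr0; last by apply: eq_bigr => i _; rewrite subr0 mulrCA.
by rewrite -sumrB; apply: eq_bigr => i _; rewrite mulrBr mulrCA.
Qed.

Lemma tdiffD y c b W F :
  tdiff y (fun W' F' => c W' F' + b W' F') W F = tdiff y c W F + tdiff y b W F.
Proof.
rewrite /tdiff; case: ifP => _; rewrite ?addr0 // -big_split; apply: eq_bigr => k _ /=.
rewrite -contractD; apply: eq_contract => W'; rewrite /twist.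
by case: ifP => _; rewrite ?subr0 mulrDr // addrACA opprD.
Qed.

Lemma tdiffN y c W F : tdiff y (fun W' F' => - c W' F') W F = - tdiff y c W F.
Proof.
rewrite /tdiff; case: ifP => _; rewrite ?oppr0 // -sumrN; apply: eq_bigr => k _ /=.
rewrite -contractN; apply: eq_contract => W'; rewrite /twist.
by case: ifP => _; rewrite ?subr0 mulrN // opprB opprK addrC.
Qed.

(** Contractions anticommute and twists commute, so the terms for (k, l) and (l, k) cancel. *)
Lemma tdiff_tdiff y c W F : tdiff y (tdiff y c) W F = 0.
Proof.
rewrite /tdiff; case: ifP => // FI.
under eq_bigr => k _.
  rewrite (@eq_contract _ _ _ _
    (fun W' => \sum_l contract l (fun W'' => twist y k (twist y l c) W'' F) W')).
    by rewrite contract_sum; over.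
  move=> W'; rewrite /twist FI mulr_sumr.
  case: ifP => kF; last first.
    by rewrite subr0; apply: eq_bigr => l _; rewrite -contractM; apply: eq_contract => ?; rewrite subr0.
  rewrite (indepS (subsetDl F [set k]) FI) -sumrB; apply: eq_bigr => l _.
  by rewrite -contractM -contractN -contractD.
apply: antisym_sum0 => [k|k l]; last first.
  rewrite contractC; congr (- _); apply: eq_contract => W'; apply: eq_contract => W''.
  exact: twistC.
by rewrite /contract !inE eqxx /= mulr0 if_same.
Qed.

Definition tsupp c := forall W F, ~~ ([disjoint W & F] && (F \in indep)) -> c W F = 0.

Lemma tdiff_tsupp y c : tsupp c -> tsupp (tdiff y c).
Proof.
move=> cS W F; rewrite /tdiff; case: ifP => [FI|]; rewrite ?andbT ?andbF //.
rewrite -setI_eq0 => /set0Pn[j]; rewrite inE => /andP[jW jF].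
rewrite big1 // => k _; rewrite /contract; case: ifPn => // kW.
have jk : j != k by apply: contraNneq kW => <-.
rewrite /twist cS ?mulr0 ?sub0r.
  case: ifP => kF; rewrite ?oppr0 ?mulr0 // cS ?oppr0 ?mulr0 // negb_and -setI_eq0.
  by apply/orP; left; apply/set0Pn; exists j; rewrite !inE jW jk jF orbT.
by rewrite negb_and -setI_eq0; apply/orP; left; apply/set0Pn; exists j; rewrite !inE jW jF orbT.
Qed.

(* Exactness is checked one face at a time: on the coefficients [c ^~ F] the
   part of [tdiff] keeping [F] fixed is the Koszul differential on the
   variables outside [F]. *)
Definition koszul y g W := \sum_k y k * contract k g W.

Lemma koszul_koszul y g W : koszul y (koszul y g) W = 0.
Proof.
rewrite /koszul; under eq_bigr => k _.
  rewrite (@contract_sum _ _ _ k (fun l W' => y l * contract l g W')) mulr_sumr.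
  under eq_bigr => l _ do rewrite contractM mulrA.
  over.
apply: antisym_sum0 => [k|k l]; last by rewrite contractC mulrN mulrC [y l * y k]mulrC mulrC.
by rewrite /contract !inE eqxx /= mulr0 if_same mulr0.
Qed.

Lemma koszulD y g h W : koszul y (fun W' => g W' + h W') W = koszul y g W + koszul y h W.
Proof. by rewrite -big_split; apply: eq_bigr => k _; rewrite contractD mulrDr. Qed.

Lemma koszulB y g h W : koszul y (fun W' => g W' - h W') W = koszul y g W - koszul y h W.
Proof.
rewrite koszulD; congr (_ + _); rewrite -sumrN; apply: eq_bigr => k _.
by rewrite contractN mulrN.
Qed.

Lemma koszul_wedge y v g W : koszul y (wedge v g) W = y v * g W - wedge v (koszul y g) W.
Proof.
rewrite /koszul (bigD1 v) //= wedge_sum [in RHS](bigD1 v) //=.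
rewrite (_ : wedge v (fun W' => y v * contract v g W') W = y v * wedge v (contract v g) W); last first.
  by rewrite /wedge; case: ifP; rewrite ?mulr0 // mulrCA.
rewrite opprD addrA -mulrBr -[g W](contract_wedge_id v) addrK; congr (_ + _).
rewrite -sumrN; apply: eq_bigr => k kv; rewrite contract_wedge // mulrN; congr (- _).
by rewrite /wedge; case: ifP; rewrite ?mulr0 // mulrCA.
Qed.

End OverRing.

Lemma rmorph_contract (R S : comNzRingType) (f : {rmorphism R -> S}) k (g : {set T} -> R) W :
  f (contract k g W) = contract k (fun W' => f (g W')) W.
Proof. by rewrite /contract; case: ifP; rewrite ?rmorph0 // rmorphM rmorph_sign. Qed.

Lemma rmorph_tdiff (R S : comNzRingType) (f : {rmorphism R -> S}) y
    (c : {set T} -> {set T} -> R) W F :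
  f (tdiff y c W F) = tdiff (fun k => f (y k)) (fun W' F' => f (c W' F')) W F.
Proof.
rewrite /tdiff; case: ifP; rewrite ?rmorph0 // rmorph_sum => _; apply: eq_bigr => k _.
rewrite rmorph_contract; apply: eq_contract => W'.
by rewrite /twist rmorphB rmorphM; case: ifP; rewrite ?rmorph0.
Qed.

Lemma rmorph_koszul (R S : comNzRingType) (f : {rmorphism R -> S}) y (g : {set T} -> R) W :
  f (koszul y g W) = koszul (fun k => f (y k)) (fun W' => f (g W')) W.
Proof.
by rewrite rmorph_sum; apply: eq_bigr => k _; rewrite rmorphM rmorph_contract.
Qed.

End Operator.

(** * Setting variables to zero and exactness of the Koszul complex *)

Section Killing.
Local Open Scope ring_scope.
Variables (K : fieldType) (T : finType).
Local Notation R := {mpoly K[#|T|]}.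
Local Notation x := (@vertex_var K T).
Implicit Types (A B W : {set T}) (a k v : T) (p q : R).

Definition kill A p : R :=
  p \mPo [tuple (if enum_val i \in A then 0 else 'X_i) | i < #|T|].

Lemma kill_rmorph A : exists f : {rmorphism R -> R}, forall p, f p = kill A p.
Proof. by exists (comp_mpoly [tuple (if enum_val i \in A then 0 else 'X_i) | i < #|T|]). Qed.

Lemma killX A v : kill A (x v) = if v \in A then 0 else x v.
Proof. by rewrite /kill comp_mpolyXU -tnth_nth tnth_mktuple enum_rankK. Qed.

Lemma vertex_var_neq0 v : x v != 0.
Proof.
apply/eqP=> /(congr1 (mcoeff U_(enum_rank v))); rewrite mcoeffX eqxx mcoeff0.
by move/eqP; rewrite oner_eq0.
Qed.

Lemma kill_kill A B p : kill A (kill B p) = kill (A :|: B) p.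
Proof.
have [f fE] := kill_rmorph A; rewrite -fE /kill !comp_mpolyE raddf_sum /=.
apply: eq_bigr => m _; rewrite -[in LHS]mul_mpolyC rmorphM fE /kill comp_mpolyC mul_mpolyC.
congr (_ *: _); rewrite rmorph_prod; apply: eq_bigr => i _; rewrite rmorphXn; congr (_ ^+ _).
rewrite !tnth_mktuple in_setU fE; case: ifP => iB; rewrite ?orbT ?orbF.
  by rewrite -fE rmorph0.
by have := killX A (enum_val i); rewrite /vertex_var enum_valK.
Qed.

Lemma kill0 p : kill set0 p = p.
Proof.
rewrite /kill -[RHS]comp_mpoly_id; congr (_ \mPo _); apply: eq_from_tnth => i.
by rewrite !tnth_mktuple inE.
Qed.

Lemma kill_division a p : exists q, p = kill [set a] p + x a * q.
Proof.
have [f fE] := kill_rmorph [set a].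
pose S p := exists q, p = f p + x a * q.
have SM p1 p2 : S p1 -> S p2 -> S (p1 * p2).
  move=> [q1 E1] [q2 E2]; exists (q1 * f p2 + p1 * q2).
  rewrite rmorphM {1}E1 {1}E2 mulrDr mulrDl -addrA; congr (_ + _).
  by rewrite mulrDr -mulrA; congr (_ + _); rewrite -E1 mulrCA.
have S1 : S 1 by exists 0; rewrite rmorph1 mulr0 addr0.
have SX i : S 'X_i.
  have iE : 'X_i = x (enum_val i) by rewrite /vertex_var enum_valK.
  rewrite /S iE fE killX inE; case: eqP => [->|_]; first by exists 1; rewrite add0r mulr1.
  by exists 0; rewrite mulr0 addr0.
suff [q qE] : S p by exists q; rewrite -fE.
rewrite (mpolyE p); apply: (big_ind S).
- by exists 0; rewrite rmorph0 mulr0 addr0.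
- by move=> p1 p2 [q1 E1] [q2 E2]; exists (q1 + q2); rewrite rmorphD mulrDr {1}E1 {1}E2 addrACA.
move=> m _; rewrite -mul_mpolyC; apply: (SM).
  by exists 0; rewrite fE /kill comp_mpolyC mulr0 addr0.
rewrite mpolyXE_id; apply: (big_ind S) => [//|p1 p2 S1p S2p|i _]; first exact: (SM).
by elim: (m i) => [|j IHj]; rewrite ?expr0 // exprS; apply: SM.
Qed.

Definition var_in A k : R := if k \in A then x k else 0.

Lemma kill_var_in A B k : [disjoint A & B] -> kill A (var_in B k) = var_in B k.
Proof.
move=> AB; rewrite /var_in; case: ifP => kB.
  by rewrite killX ifF //; apply: (disjointFl AB).
by have [f <-] := kill_rmorph A; rewrite rmorph0.
Qed.

(** The variables of [A] form a regular sequence, so homology survives only at [set0], where a class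
    is represented by a polynomial [r] free of these variables. Induction removes one variable at a
    time. *)
Lemma koszul_exact A (g : {set T} -> R) :
    (forall W, ~~ (W \subset A) -> g W = 0) -> (forall W, koszul (var_in A) g W = 0) ->
  exists b r, [/\ forall W, ~~ (W \subset A) -> b W = 0, kill A r = r &
    forall W, g W = koszul (var_in A) b W + (if W == set0 then r else 0)].
Proof.
move: {2}#|A| (erefl #|A|) => n; elim: n A g => [|n IHn] A g cA gA gK.
  exists (fun _ => 0), (g set0).
  move/eqP: cA; rewrite cards_eq0 => /eqP A0; rewrite A0 kill0; split=> // W.
  rewrite /koszul big1 ?add0r => [|k _]; last by rewrite contract0 // mulr0.
  by case: eqP => [->//|/eqP W0]; apply: gA; rewrite A0 subset0.
have /card_gt0P[a aA] : (0 < #|A|)%N by rewrite cA.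
have cA' : #|A :\ a| = n by apply: succn_inj; rewrite -cA (cardsD1 a A) aA.
have [f fE] := kill_rmorph [set a].
have ff p : f (f p) = f p by rewrite !fE kill_kill setUid.
have fa : f (x a) = 0 by rewrite fE killX set11.
have [dv dvE] := fin_all_exists (fun W => kill_division a (g W)).
(* Subtracting the boundary of [b1] removes the multiples of [x a] from the coefficients at sets
   without [a]; the cycle condition then forces the coefficients at sets with [a] to vanish. *)
pose b1 := wedge a dv.
pose g2 W := g W - koszul (var_in A) b1 W.
have g2a W : a \notin W -> g2 W = f (g W).
  move=> aW; rewrite /g2 koszul_wedge /wedge (negPf aW) subr0 /var_in aA.
  by rewrite {1}(dvE W) addrK fE.
have g2K W : koszul (var_in A) g2 W = 0 by rewrite koszulB gK koszul_koszul subr0.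
have KA' h W : koszul (var_in A) h W = x a * contract a h W + koszul (var_in (A :\ a)) h W.
  rewrite /koszul (bigD1 a) //= [in RHS](bigD1 a) //= /var_in aA !inE eqxx mul0r add0r.
  by congr (_ + _); apply: eq_bigr => k ka; rewrite !inE ka.
have ca h W : (forall W', a \in W' -> h W' = 0) -> contract a h W = 0.
  by move=> ha; rewrite /contract ha ?setU11 // mulr0 if_same.
have fA' k : f (var_in (A :\ a) k) = var_in (A :\ a) k.
  by rewrite fE kill_var_in // disjoints1 !inE eqxx.
have g20 W : a \in W -> g2 W = 0.
  move=> aW; have aWa : a \notin W :\ a by rewrite !inE eqxx.
  have E2 : koszul (var_in (A :\ a)) g2 (W :\ a) = f (koszul (var_in (A :\ a)) g (W :\ a)).
    rewrite rmorph_koszul; apply: eq_bigr => k _; rewrite fA' /var_in in_setD1.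
    have [->|ka] := eqVneq k a; rewrite ?mul0r //=; congr (_ * _).
    rewrite /contract; case: ifP => // kW; congr (_ * _); apply: g2a.
    by rewrite !inE eqxx eq_sym (negPf ka).
  have := g2K (W :\ a); rewrite KA' E2 => E.
  have f0 : f (koszul (var_in (A :\ a)) g (W :\ a)) = 0.
    by have := congr1 f E; rewrite rmorphD rmorphM fa mul0r add0r ff rmorph0.
  move: E; rewrite f0 addr0 /contract (negPf aWa) setD1K // => /eqP.
  by rewrite !mulf_eq0 signr_eq0 (negPf (vertex_var_neq0 a)) => /eqP.
have [||b' [r' [b'A r'E g2E]]] := IHn _ g2 cA'.
- move=> W WA; have [aW|aW] := boolP (a \in W); first exact: g20.
  rewrite g2a // gA ?rmorph0 //; apply: contra WA => WA.
  by rewrite subsetD1 WA aW.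
- by move=> W; rewrite -(g2K W) KA' ca ?mulr0 ?add0r.
have b'a W : a \in W -> f (b' W) = 0.
  by move=> aW; rewrite b'A ?rmorph0 // subsetD1 aW andbF.
have fr' : f r' = kill A r' by rewrite fE -{1}r'E kill_kill setD1K.
(* Since [f] fixes [g2], it can be applied to the inductive decomposition, which frees the remainder
   of [x a] as well. *)
exists (fun W => b1 W + f (b' W)), (f r'); split.
- move=> W WA; rewrite b'A ?rmorph0 ?addr0; last first.
    by apply: contra WA => /subset_trans; apply; apply: subsetDl.
  rewrite /b1 /wedge; case: ifP => // aW.
  have gW0 : g (W :\ a) = 0.
    by apply: gA; apply: contra WA => WA; rewrite -(setD1K aW) subUset sub1set aA.
  have := dvE (W :\ a); rewrite gW0 -fE rmorph0 add0r => /esym/eqP.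
  by rewrite mulf_eq0 (negPf (vertex_var_neq0 a)) => /eqP->; rewrite mulr0.
- by rewrite fr' kill_kill setUid.
move=> W; have fg2 : f (g2 W) = g2 W.
  have [aW|aW] := boolP (a \in W); first by rewrite g20 ?rmorph0.
  by rewrite g2a // ff.
rewrite koszulD [koszul _ (fun _ => f _) _]KA' ca // mulr0 add0r -addrA.
have -> : koszul (var_in (A :\ a)) (fun W' => f (b' W')) W = f (koszul (var_in (A :\ a)) b' W).
  by rewrite rmorph_koszul; apply: eq_bigr => k _; rewrite fA'.
have -> : (if W == set0 then f r' else 0) = f (if W == set0 then r' else 0).
  by case: ifP; rewrite ?rmorph0.
by rewrite -rmorphD -g2E fg2 addrC subrK.
Qed.

End Killing.

Section Ideals.
Local Open Scope ring_scope.

Lemma ideal_genD (R : comNzRingType) (A : R -> Prop) p q :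
  ideal_gen A p -> ideal_gen A q -> ideal_gen A (p + q).
Proof.
move=> [m1 [c1 [g1 [A1 ->]]]] [m2 [c2 [g2 [A2 ->]]]].
pose h (f1 : 'I_m1 -> R) (f2 : 'I_m2 -> R) k := match split k with inl i => f1 i | inr j => f2 j end.
exists (m1 + m2)%N, (h c1 c2), (h g1 g2); split=> [k|].
  by rewrite /h; case: (split k).
rewrite big_split_ord; congr (_ + _); apply: eq_bigr => i _ /=.
  by rewrite /h (unsplitK (inl i : 'I_m1 + 'I_m2)).
by rewrite /h (unsplitK (inr i : 'I_m1 + 'I_m2)).
Qed.

Lemma ideal_genM (R : comNzRingType) (A : R -> Prop) p q : ideal_gen A q -> ideal_gen A (p * q).
Proof.
move=> [m [c [g [Ag ->]]]]; exists m, (fun k => p * c k), g; split=> //.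
by rewrite mulr_sumr; apply: eq_bigr => k _; rewrite mulrA.
Qed.

Lemma ideal_gen_mem (R : comNzRingType) (A : R -> Prop) p : A p -> ideal_gen A p.
Proof.
move=> Ap; exists 1%N, (fun _ => 1), (fun _ => p); split=> //.
by rewrite big_ord1 mul1r.
Qed.

Lemma ideal_gen0 (R : comNzRingType) (A : R -> Prop) : ideal_gen A 0.
Proof.
by exists 0%N, (fun _ => 0), (fun _ => 0); split=> [[]|] //; rewrite big_ord0.
Qed.

Lemma ideal_gen_hpart (K : fieldType) n (A : {mpoly K[n]} -> Prop) d a p :
  (forall g, A g -> hdeg d 0 g) -> ideal_gen A p -> ideal_gen A (hpart a 0 p).
Proof.
move=> Ad [m [c [g [Ag ->]]]].
exists m, (fun k => hpart a d (c k)), g; split=> //.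
by rewrite hpart_sum; apply: eq_bigr => k _; apply/hpartM/Ad.
Qed.

End Ideals.

(** * Exactness of the explicit complex *)

Section TotalComplex.
Local Open Scope ring_scope.
Variables (K : fieldType) (T : finType) (e : rel T).
Hypotheses (e_sym : symmetric e) (e_irr : irreflexive e).
Local Notation R := {mpoly K[#|T|]}.
Local Notation x := (@vertex_var K T).
Local Notation indep := (independence_complex e).
Local Notation I := (edge_ideal K e).
Implicit Types (W F G : {set T}) (k : T) (c b : {set T} -> {set T} -> R).

Lemma hdeg_vertex_var k a : hdeg a.+1 a (x k).
Proof. by move=> m; rewrite msuppX inE => /eqP->; rewrite mdeg1 add1n. Qed.

Lemma edge_idealD p q : I p -> I q -> I (p + q).
Proof. exact: ideal_genD. Qed.

Lemma edge_idealM p q : I q -> I (p * q).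
Proof. exact: ideal_genM. Qed.

Lemma edge_idealB p q : I p -> I q -> I (p - q).
Proof. by move=> Ip Iq; rewrite -mulN1r; apply/edge_idealD/edge_idealM. Qed.

Lemma edge_ideal_hpart a p : I p -> I (hpart a 0 p).
Proof.
apply: (@ideal_gen_hpart _ _ _ 2) => g [u [v [_ ->]]].
by apply: hdegM; apply: hdeg_vertex_var.
Qed.

Lemma edge_ideal_nonface F : F \notin indep -> I (\prod_(v in F) x v).
Proof.
move=> nF; apply: (stanley_reisner_edge_ideal e_irr _).1.
by apply: ideal_gen_mem; exists F.
Qed.

(** Every edge has an endpoint outside the independent set [F]. *)
Lemma kill_edge_ideal F p : F \in indep -> I p -> kill (~: F) p = 0.
Proof.
move=> /indepP FI [m [c [g [Ag ->]]]]; have [f fE] := kill_rmorph K (~: F).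
rewrite -fE rmorph_sum big1 // => i _; rewrite rmorphM.
have [u [v [euv ->]]] := Ag i; rewrite rmorphM !fE !killX !in_setC.
have [uF|] := boolP (u \in F); last by rewrite mul0r mulr0.
have [vF|] := boolP (v \in F); last by rewrite !mulr0.
by have := FI u v uF vF; rewrite euv.
Qed.

Definition taug c := \sum_(F in indep) c set0 F * \prod_(v in F) x v.

(* Up to a boundary, the coefficient at a face [F] can be made a polynomial in
   the vertices of [F] only. *)
Lemma tdiff_exact c : tsupp e c -> (forall W F, tdiff e x c W F = 0) ->
  exists b r, [/\ tsupp e b, forall F, F \notin indep -> r F = 0,
    forall F, kill (~: F) (r F) = r F &
    forall W F, c W F = tdiff e x b W F + (if W == set0 then r F else 0)].
Proof.
move=> cS c0.
(* Induction on the size of the face: once smaller faces are settled, only their remainders at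
   [set0] are left there. *)
suff layer t : exists b r, [/\ tsupp e b, forall F, F \notin indep -> r F = 0,
    forall F, kill (~: F) (r F) = r F &
    forall W F, (#|F| < t)%N -> c W F = tdiff e x b W F + (if W == set0 then r F else 0)].
  have [b [r [bS r0 rE cE]]] := layer #|T|.+1.
  by exists b, r; split=> // W F; apply: cE; rewrite ltnS max_card.
have kill00 A : kill A (0 : R) = 0 by have [f <-] := kill_rmorph K A; rewrite rmorph0.
elim: t => [|t [b [r [bS r0 rE cE]]]].
  by exists (fun _ _ => 0), (fun _ => 0); split.
pose c' W F := c W F - tdiff e x b W F.
have c'S : tsupp e c' by move=> W F nS; rewrite /c' cS // (tdiff_tsupp _ bS) // subrr.
have c'0 W F : tdiff e x c' W F = 0.
  by rewrite /c' tdiffD tdiffN c0 tdiff_tdiff subrr.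
have c'lt W F : (#|F| < t)%N -> c' W F = if W == set0 then r F else 0.
  by move=> Ft; rewrite /c' cE // addrC addKr.
have H F : exists bF : ({set T} -> R) * R, F \in indep -> #|F| = t ->
    [/\ forall W, ~~ (W \subset ~: F) -> bF.1 W = 0, kill (~: F) bF.2 = bF.2 &
      forall W, c' W F = koszul (var_in K (~: F)) bF.1 W + (if W == set0 then bF.2 else 0)].
  have [FI|] := boolP (F \in indep); last by exists (fun _ => 0, 0).
  have [Ft|nFt] := eqVneq #|F| t; last by exists (fun _ => 0, 0) => _ Ft; rewrite Ft eqxx in nFt.
  have [||bF [rF HF]] := @koszul_exact K T (~: F) (fun W => c' W F).
  - by move=> W WF; apply: c'S; rewrite disjoints_subset (negPf WF).
  - move=> W; have := c'0 W F; rewrite /tdiff FI => E; rewrite -[RHS]E.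
    apply: eq_bigr => k _; rewrite -contractM /contract; case: ifP => // kW.
    congr (_ * _); rewrite /twist /var_in in_setC; case: ifP => [kF|/negbFE kF].
      by rewrite (negPf kF) subr0.
    (* For [k] in [F] both terms of the twist vanish: the first because [k |: W] meets [F], the
       second because remainders sit at [set0]. *)
    rewrite kF mul0r [c' _ (F :\ k)]c'lt; last by rewrite -Ft [in X in (_ < X)%N](cardsD1 k) kF.
    rewrite ifF ?subr0; last by apply/eqP/eqP/set0Pn; exists k; rewrite setU11.
    rewrite c'S ?mulr0 // negb_and -setI_eq0; apply/orP; left.
    by apply/set0Pn; exists k; rewrite inE setU11 kF.
  by exists (bF, rF).
have [bF bFP] := fin_all_exists H.
pose top F := (F \in indep) && (#|F| == t).
pose b2 W F := if top F then (bF F).1 W else 0.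
have topP F : top F -> [/\ forall W, ~~ (W \subset ~: F) -> (bF F).1 W = 0,
      kill (~: F) (bF F).2 = (bF F).2 &
      forall W, c' W F = koszul (var_in K (~: F)) (bF F).1 W + (if W == set0 then (bF F).2 else 0)].
  by case/andP=> FI /eqP; apply: bFP.
have b2S : tsupp e b2.
  move=> W F; rewrite /b2; case: ifP => // tF; have [bS' _ _] := topP F tF.
  by case/andP: tF => -> _; rewrite andbT disjoints_subset => /bS'.
exists (fun W F => b W F + b2 W F),
  (fun F => if top F then (bF F).2 else if #|F| == t then 0 else r F).
split.
- by move=> W F nS; rewrite bS // b2S // addr0.
- by move=> F nF; rewrite /top (negPf nF) /=; case: ifP => // _; apply: r0.
- move=> F; case: ifP => [tF|_]; first by have [] := topP F tF.
  by case: ifP => // _; apply: kill00.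
move=> W F; rewrite ltnS leq_eqVlt tdiffD => /predU1P[Ft|Ft]; last first.
  have -> : tdiff e x b2 W F = 0.
    rewrite /tdiff; case: ifP => // FI; rewrite big1 // => k _.
    rewrite /contract; case: ifP => // kW; rewrite /twist /b2 /top (ltn_eqF Ft) andbF mulr0 sub0r.
    case: ifP => kF; rewrite ?oppr0 ?mulr0 // ifF ?oppr0 ?mulr0 //.
    apply/negP=> /andP[_ /eqP Fk].
    by move: Ft; rewrite -Fk ltnNge subset_leq_card // subsetDl.
  by rewrite addr0 /top (ltn_eqF Ft) andbF cE.
apply/eqP; rewrite -addrA addrC -subr_eq -/(c' W F); apply/eqP.
rewrite {1}/tdiff /top Ft eqxx andbT; case: ifP => FI; last first.
  by rewrite c'S ?FI ?andbF // if_same addr0.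
have tF : top F by rewrite /top FI Ft eqxx.
have [bFS _ ->] := topP F tF; congr (_ + _); apply: eq_bigr => k _.
rewrite -contractM /contract; case: ifP => // kW; congr (_ * _).
rewrite /twist /b2 tF /var_in in_setC; case: ifP => [kF|/negbFE kF].
  by rewrite (negPf kF) subr0.
rewrite kF mul0r ifF ?subr0; last first.
  apply/negP=> /andP[_ /eqP]; rewrite -Ft [X in _ = X](cardsD1 k) kF => /eqP.
  by rewrite -[X in X == _]add0n eqn_add2r.
rewrite bFS ?mulr0 //; apply/subsetPn; exists k; rewrite ?setU11 //.
by rewrite in_setC kF.
Qed.

Lemma edge_ideal_sum (J : finType) (f : J -> R) : (forall j, I (f j)) -> I (\sum_j f j).
Proof. by move=> fI; apply: big_ind => //; [apply: ideal_gen0 | apply: edge_idealD]. Qed.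

Lemma contract_set0 k (g : {set T} -> R) : contract k g set0 = g [set k].
Proof.
rewrite /contract in_set0 setU0 /num_before (_ : [set f in set0 | _] = set0) ?cards0 ?mul1r //.
by apply/setP=> f; rewrite !inE.
Qed.

(** In the image of a generator [([set k], F)], the terms x_k x_F and x_(F + k) cancel if F + k is a
    face; otherwise x_k x_F lies in the ideal. *)
Lemma taug_tdiff b : tsupp e b -> I (taug (tdiff e x b)).
Proof.
move=> bS; rewrite /taug.
have -> : \sum_(F in indep) tdiff e x b set0 F * \prod_(v in F) x v =
    \sum_k (\sum_(F in indep) x k * b [set k] F * \prod_(v in F) x v
          - \sum_(F in indep) (if k \in F then b [set k] (F :\ k) else 0) * \prod_(v in F) x v).
  under [RHS]eq_bigr do rewrite -sumrB.
  rewrite exchange_big; apply: eq_bigr => F FI /=; rewrite /tdiff FI mulr_suml.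
  by apply: eq_bigr => k _; rewrite contract_set0 /twist mulrBl.
apply: edge_ideal_sum => k.
rewrite (bigID (fun F : {set T} => k \in F)) /= big1 ?add0r => [|F /andP[_ kF]]; last first.
  rewrite bS ?mulr0 ?mul0r // negb_and disjoints1 kF //.
rewrite [X in _ - X](bigID (fun F : {set T} => k \in F)) /= [X in _ - (_ + X)]big1 ?addr0; last first.
  by move=> F /andP[_ /negPf->]; rewrite mul0r.
rewrite [X in _ - X](reindex_onto (fun G => k |: G) (fun F => F :\ k)) /=; last first.
  by move=> F /andP[_ kF]; apply: setD1K.
rewrite big_mkcond [X in _ - X]big_mkcond -sumrB; apply: edge_ideal_sum => G.
rewrite setU11 andbT; have [kG|kG] := boolP (k \in G).
  rewrite andbF ifF ?subr0; first exact: ideal_gen0.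
  by apply/negP=> /andP[_ /eqP E]; move: kG; rewrite -E !inE eqxx.
rewrite setU1K // eqxx !andbT.
have prodE : \prod_(v in k |: G) x v = x k * \prod_(v in G) x v by rewrite big_setU1.
case: ifPn => GI; case: ifPn => kGI.
- by rewrite prodE -mulrA mulrCA subrr; apply: ideal_gen0.
- by rewrite subr0 -mulrA mulrCA -prodE; apply/edge_idealM/edge_ideal_nonface.
- by have := indepS (subsetUr [set k] G) kGI; rewrite (negPf GI).
- by rewrite subrr; apply: ideal_gen0.
Qed.

Lemma taug_exact c : tsupp e c -> (forall W F, W != set0 -> c W F = 0) -> I (taug c) ->
  exists2 b, tsupp e b & forall W F, c W F = tdiff e x b W F.
Proof.
move=> cS c0 cI; have [|b [r [bS r0 rE cE]]] := tdiff_exact cS.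
  move=> W F; rewrite /tdiff; case: ifP => // _; rewrite big1 // => k _.
  by apply: contract0 => W' W'0; rewrite /twist !c0 // if_same mulr0 subr0.
exists b => // W F; rewrite cE; suff -> : r F = 0 by rewrite if_same addr0.
have rI : I (\sum_(G in indep) r G * \prod_(v in G) x v).
  have -> : \sum_(G in indep) r G * \prod_(v in G) x v = taug c - taug (tdiff e x b).
    rewrite /taug -sumrB; apply: eq_bigr => G _; rewrite -mulrBl; congr (_ * _).
    by rewrite cE eqxx addrC addKr.
  by apply: edge_idealB => //; apply: taug_tdiff.
(* Setting the variables outside [F] to 0 kills the ideal and all faces not contained in [F]. By
   induction smaller faces contribute nothing, so r_F x_F = 0. *)
move: {2}#|F|.+1 (ltnSn #|F|) => n; elim: n F => // n IHn F Fn.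
have [FI|] := boolP (F \in indep); last exact: r0.
have := kill_edge_ideal FI rI; have [f fE] := kill_rmorph K (~: F).
rewrite -fE rmorph_sum (bigD1 F) //= [X in _ + X]big1 ?addr0 => [|G /andP[GI GF]].
  rewrite rmorphM fE rE rmorph_prod.
  have -> : \prod_(v in F) f (x v) = \prod_(v in F) x v.
    by apply: eq_bigr => v vF; rewrite fE killX in_setC vF.
  move=> /eqP; rewrite mulf_eq0 => /orP[/eqP //|].
  rewrite prodf_seq_eq0 => /hasP[v _ /andP[_]].
  by rewrite (negPf (vertex_var_neq0 _ _)).
rewrite rmorphM; have [GsubF|/subsetPn[v vG vF]] := boolP (G \subset F).
  rewrite IHn ?rmorph0 ?mul0r // -ltnS; apply: leq_trans Fn.
  by rewrite ltnS; apply: proper_card; rewrite properEneq GF.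
by rewrite rmorph_prod (bigD1 v) //= [f (x v)]fE killX in_setC vF mul0r mulr0.
Qed.

End TotalComplex.

(** * The explicit complex in matrix form *)

Section Matrices.
Local Open Scope ring_scope.
Variables (T : finType) (e : rel T).
Hypotheses (e_sym : symmetric e) (e_irr : irreflexive e).
Local Notation indep := (independence_complex e).
Implicit Types (W F : {set T}).

Definition tbasis (i : nat) : {set {set T} * {set T}} :=
  [set b : {set T} * {set T} | [&& [disjoint b.1 & b.2], b.2 \in indep & #|b.1| == i]].

Definition gen i (j : 'I_#|tbasis i|) : {set T} * {set T} := enum_val j.

Lemma gen_inj i : injective (@gen i).
Proof. exact: enum_val_inj. Qed.

Lemma genP i (j : 'I_#|tbasis i|) : gen j \in tbasis i.
Proof. exact: enum_valP. Qed.

(** This is the size of X = W + F, so the part of degree [d] collects the sets X with [d] elements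
    in Hochster's formula. *)
Definition tdeg i (j : 'I_#|tbasis i|) := (#|(gen j).1| + #|(gen j).2|)%N.

Section OverRing.
Variable R : comNzRingType.
Implicit Types (y : T -> R) (c : {set T} -> {set T} -> R).

Definition basis_fun b W F : R := ((W, F) == b)%:R.

Definition tmx y i : 'M[R]_(#|tbasis i.+1|, #|tbasis i|) :=
  \matrix_(j, l) tdiff e y (basis_fun (gen j)) (gen l).1 (gen l).2.

Definition cfun i (v : 'rV[R]_#|tbasis i|) W F := \sum_j v 0 j * basis_fun (gen j) W F.

Definition crow i c : 'rV[R]_#|tbasis i| := \row_j c (gen j).1 (gen j).2.

Lemma cfunE i (v : 'rV[R]_#|tbasis i|) l : cfun v (gen l).1 (gen l).2 = v 0 l.
Proof.
rewrite /cfun (bigD1 l) //= big1 => [|j jl]; rewrite /basis_fun -surjective_pairing.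
  by rewrite eqxx mulr1 addr0.
by rewrite (inj_eq (@gen_inj _)) eq_sym (negPf jl) mulr0.
Qed.

Lemma cfun_out i (v : 'rV[R]_#|tbasis i|) W F : (W, F) \notin tbasis i -> cfun v W F = 0.
Proof.
move=> nb; rewrite /cfun big1 // => j _; rewrite /basis_fun; case: eqP => [E|]; rewrite ?mulr0 //.
by move: nb; rewrite E genP.
Qed.

Lemma cfun_tsupp i (v : 'rV[R]_#|tbasis i|) : tsupp e (cfun v).
Proof. by move=> W F nS; rewrite cfun_out // inE /= andbA (negPf nS). Qed.

Lemma tmxE y i (v : 'rV_#|tbasis i.+1|) l :
  (v *m tmx y i) 0 l = tdiff e y (cfun v) (gen l).1 (gen l).2.
Proof. by rewrite mxE tdiff_sum; apply: eq_bigr => j _; rewrite mxE. Qed.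

Lemma cfun_crow i c W F : (forall W F, (W, F) \notin tbasis i -> c W F = 0) ->
  cfun (crow i c) W F = c W F.
Proof.
move=> c0; have [b|nb] := boolP ((W, F) \in tbasis i); last by rewrite cfun_out // c0.
have [j bj] : exists j : 'I_#|tbasis i|, gen j = (W, F)
    by exists (enum_rank_in b (W, F)); rewrite /gen enum_rankK_in.
by have := cfunE (crow i c) j; rewrite bj mxE bj.
Qed.

Lemma eq_tdiff_card y c b W F i : #|W| = i -> (forall W F, #|W| = i.+1 -> c W F = b W F) ->
  tdiff e y c W F = tdiff e y b W F.
Proof.
move=> Wi cb; rewrite /tdiff; case: ifP => // _; apply: eq_bigr => k _.
rewrite /contract; case: ifPn => // kW; congr (_ * _).
by rewrite /twist !cb // cardsU1 kW Wi.
Qed.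

Lemma tdiff_tbasis y i (v : 'rV_#|tbasis i.+1|) W F :
  (W, F) \notin tbasis i -> tdiff e y (cfun v) W F = 0.
Proof.
rewrite inE /= andbA negb_and => /orP[|Wi]; first exact/tdiff_tsupp/cfun_tsupp.
rewrite (@eq_tdiff_card y _ (fun _ _ => 0) W F #|W|) // => [|W' F' W'i].
  rewrite /tdiff; case: ifP => // _; rewrite big1 // => k _.
  by apply: contract0 => W' _; rewrite /twist if_same mulr0 subr0.
by rewrite cfun_out // inE /= W'i eqSS (negPf Wi) !andbF.
Qed.

Lemma cfun_tmx y i (v : 'rV_#|tbasis i.+1|) W F :
  cfun (v *m tmx y i) W F = tdiff e y (cfun v) W F.
Proof.
have -> : v *m tmx y i = crow i (tdiff e y (cfun v)).
  by apply/rowP=> l; rewrite tmxE mxE.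
by rewrite cfun_crow // => W' F'; apply: tdiff_tbasis.
Qed.

Lemma cfun0 i W F : cfun (0 : 'rV[R]_#|tbasis i|) W F = 0.
Proof. by rewrite /cfun big1 // => j _; rewrite mxE mul0r. Qed.

End OverRing.

Section OverField.
Variable K : fieldType.
Local Notation R := {mpoly K[#|T|]}.
Local Notation x := (@vertex_var K T).
Local Notation I := (edge_ideal K e).

Definition taug_mx : 'cV[R]_#|tbasis 0| := \col_j \prod_(v in (gen j).2) x v.

Lemma tbasis0 (j : 'I_#|tbasis 0|) : (gen j).1 = set0 /\ (gen j).2 \in indep.
Proof. by have := genP j; rewrite inE => /and3P[_ ->]; rewrite cards_eq0 => /eqP. Qed.

Lemma taug_mxE (v : 'rV_#|tbasis 0|) : (v *m taug_mx) 0 0 = taug e (cfun v).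
Proof.
rewrite mxE /taug /cfun; under [RHS]eq_bigr do rewrite mulr_suml.
rewrite exchange_big; apply: eq_bigr => j _ /=; have [W0 FI] := tbasis0 j.
rewrite (bigD1 _ FI) /= [X in _ + X]big1 ?addr0 => [|F /andP[_ FE]].
  by rewrite /basis_fun -W0 -surjective_pairing eqxx mulr1 mxE.
rewrite /basis_fun; case: eqP => [E|]; rewrite ?mulr0 ?mul0r //.
by rewrite -E eqxx in FE.
Qed.

Lemma taug_mx_hdeg j : hdeg (tdeg j) 0 (taug_mx j 0).
Proof.
rewrite /tdeg mxE; have [-> _] := tbasis0 j; rewrite cards0 add0n -sum1_card.
by elim/big_rec2: _ => [|k p a _ pH]; [apply: hdeg1 | apply: hdegM pH; apply: hdeg_vertex_var].
Qed.

Lemma hdegMsign p a b n : hdeg a b p -> hdeg a b ((-1) ^+ n * p : R).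
Proof. by rewrite -signr_odd; case: odd; rewrite ?expr0 ?expr1 ?mul1r ?mulN1r //; apply: hdegN. Qed.

Lemma tmx_hmx i : hmx (@tdeg i.+1) (@tdeg i) (tmx x i).
Proof.
move=> j l; rewrite mxE /tdiff; case: ifP => _; last exact: hdeg0.
apply: hdeg_sum => k; rewrite /contract; case: ifPn => kW; first exact: hdeg0.
apply: hdegMsign; rewrite /twist /basis_fun /tdeg; apply: hdegB.
  case: eqP => [<-|_]; last by rewrite mulr0; apply: hdeg0.
  rewrite mulr1 /= cardsU1 kW add1n addSn; exact: hdeg_vertex_var.
case: ifP => kF; last exact: hdeg0.
case: eqP => [<-|_]; last exact: hdeg0.
by rewrite /= cardsU1 kW (cardsD1 k (gen l).2) kF addnCA addnA; apply: hdeg1.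
Qed.

Lemma taug_mx_surj p : exists v : 'rV_#|tbasis 0|, I (p - (v *m taug_mx) 0 0).
Proof.
have I0 : set0 \in indep by apply/indepP=> u v; rewrite inE.
exists (crow 0 (fun W F => p *+ (F == set0) *+ (W == set0))).
rewrite taug_mxE /taug (bigD1 _ I0) /= [X in _ - (_ + X)]big1 ?addr0 => [|F /andP[FI F0]].
  rewrite big_set0 mulr1 cfun_crow ?eqxx ?mulr1n ?subrr; first exact: ideal_gen0.
  move=> W F; rewrite inE /= cards_eq0; case: eqP => [->|]; case: eqP => [->|] //.
  by rewrite disjoints_subset sub0set I0.
rewrite cfun_crow ?(negPf F0) ?mulr0n ?mul0rn ?mul0r //.
move=> W F'; rewrite inE /= cards_eq0; case: eqP => [->|]; case: eqP => [->|] //.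
by rewrite disjoints_subset sub0set I0.
Qed.

Lemma tmx_exact0 (v : 'rV_#|tbasis 0|) :
  I ((v *m taug_mx) 0 0) <-> exists w, v = w *m tmx x 0.
Proof.
rewrite taug_mxE; split=> [vI|[w ->]]; last first.
  have -> : taug e (cfun (w *m tmx x 0)) = taug e (tdiff e x (cfun w)).
    by apply: eq_bigr => F _; rewrite cfun_tmx.
  exact/(taug_tdiff e_irr)/cfun_tsupp.
have [|b bS bE] := taug_exact e_irr (@cfun_tsupp _ _ v) _ vI.
  by move=> W F W0; rewrite cfun_out // inE /= cards_eq0 (negPf W0) !andbF.
(* At [set0] the differential uses only one-element [W]; dropping the rest puts [b] in the span of
   [tbasis 1]. *)
pose b1 W F := if #|W| == 1%N then b W F else 0.
exists (crow 1 b1); apply/rowP=> l; rewrite tmxE -cfunE bE.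
have [W0 _] := tbasis0 l.
rewrite (@eq_tdiff_card _ _ _ b1 _ _ 0) ?W0 ?cards0 // => [|W F W1]; last by rewrite /b1 W1.
apply: eq_tdiff => // W F; rewrite cfun_crow // => {}W {}F nb; rewrite /b1; case: ifP => // W1.
by apply: bS; move: nb; rewrite inE /= W1 andbT.
Qed.

Lemma tmx_exact i (v : 'rV_#|tbasis i.+1|) :
  v *m tmx x i = 0 <-> exists w, v = w *m tmx x i.+1.
Proof.
split=> [v0|[w ->]]; last first.
  apply/rowP=> l; rewrite tmxE mxE -[RHS](tdiff_tdiff e x (cfun w) (gen l).1 (gen l).2).
  by apply: eq_tdiff => // W F; rewrite cfun_tmx.
have [|b [r [bS _ _ bE]]] := tdiff_exact (@cfun_tsupp _ _ v).
  by move=> W F; rewrite -cfun_tmx v0 cfun0.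
pose b1 W F := if #|W| == i.+2 then b W F else 0.
exists (crow i.+2 b1); apply/rowP=> l; rewrite tmxE -cfunE bE.
have := genP l; rewrite inE => /and3P[_ _ /eqP Wl].
rewrite ifF ?addr0; last by rewrite -cards_eq0 Wl.
rewrite (@eq_tdiff_card _ _ _ b1 _ _ i.+1) // => [|W F W1]; last by rewrite /b1 W1 eqxx.
apply: eq_tdiff => // W F; rewrite cfun_crow // => {}W {}F nb; rewrite /b1; case: ifP => // W1.
by apply: bS; move: nb; rewrite inE /= W1 andbT.
Qed.

Definition total_resolution : graded_free_resolution I :=
  @GradedFreeResolution K #|T| I (fun i => #|tbasis i|) tdeg taug_mx (tmx x)
    taug_mx_hdeg tmx_hmx taug_mx_surj tmx_exact0 tmx_exact.

(** Taking the constant coefficient is a ring morphism that sends the variables to 0, and [tdiff]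
    commutes with ring morphisms; the field thus enters only through reduction of an integer
    matrix. *)
Lemma const_part_tmx i d :
  const_part (@tdeg i.+1) (@tdeg i) d (tmx x i)
  = map_mx intr (\matrix_(j < #|degree_set (@tdeg i.+1) d|, l < #|degree_set (@tdeg i) d|)
      tmx (fun _ => 0 : int) i (enum_val j) (enum_val l)).
Proof.
apply/matrixP=> j l; rewrite !mxE rmorph_tdiff [RHS](rmorph_tdiff e (intmul 1)).
apply: eq_tdiff => [k|W F]; last by rewrite /basis_fun !rmorph_nat.
by rewrite rmorph0 /= mcoeffX mnm1_eq0.
Qed.

End OverField.
End Matrices.

(** * Reduction to cohomology *)

Section ConstantPart.
Local Open Scope ring_scope.
Variables (T : finType) (e : rel T).
Hypotheses (e_sym : symmetric e) (e_irr : irreflexive e).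
Local Notation indep := (independence_complex e).
Implicit Types (W F X : {set T}) (k : T).

(** The number of pairs w < f with w in [W] and f in [F]: the exponent of the shuffle sign that
    identifies the generator (W, F) with the face [F] of W + F. *)
Definition inversions W F := (\sum_(f in F) num_before f W)%N.

Lemma sign_inversions k W F : k \in F -> k \notin W ->
  (-1) ^+ (num_before k W + inversions (k |: W) (F :\ k))
    = (-1) ^+ (inversions W F + #|F|.-1 + num_before k F) :> int.
Proof.
move=> kF kW; have cF : #|F|.-1 = #|F :\ k| by rewrite (cardsD1 k F) kF.
have -> : inversions (k |: W) (F :\ k) = (#|[set f in F :\ k | (enum_rank k < enum_rank f)%N]|
    + \sum_(f in F :\ k) num_before f W)%N.
  rewrite /inversions; under eq_bigr do rewrite num_beforeU //.
  rewrite big_split; congr (_ + _)%N; rewrite -[RHS]sum1_card [LHS]big_mkcond [RHS]big_mkcond.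
  by apply: eq_bigr => f _; rewrite !inE; case: (_ && _).
have -> : num_before k F = #|[set f in F :\ k | (enum_rank f < enum_rank k)%N]|.
  by rewrite (num_beforeD1 k kF) ltnn.
have -> : #|F|.-1 = (#|[set f in F :\ k | (enum_rank f < enum_rank k)%N]|
    + #|[set f in F :\ k | (enum_rank k < enum_rank f)%N]|)%N.
  rewrite cF -(cardsID [set f | (enum_rank f < enum_rank k)%N] (F :\ k)).
  congr (_ + _)%N; apply: eq_card => f; rewrite !inE // andbC -leqNgt.
  have [//|fk] := eqVneq f k.
  by rewrite [in RHS]ltn_neqAle (inj_eq val_inj) (inj_eq enum_rank_inj) eq_sym fk.
rewrite /inversions (big_setD1 k kF) /=.
set a := num_before k W; set b := #|_|; set s := (\sum_(f in F :\ k) _)%N; set c := #|_|.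
have -> : (a + s + (c + b) + c = (a + (b + s)) + c.*2)%N.
  by rewrite -addnn; ring.
by rewrite [RHS]exprD -[X in _ * X]signr_odd odd_double mulr1.
Qed.

(** With the variables set to 0 only the move of [k] between [W] and [F] survives. It preserves
    their union, so up to the shuffle sign it is the coboundary there. *)
Lemma tdiff0_cobd (c : {set T} -> {set T} -> int) (g : {set T} -> int) W F :
    F \in indep -> [disjoint W & F] ->
    {in F, forall k, c (k |: W) (F :\ k) = (-1) ^+ inversions (k |: W) (F :\ k) * g (F :\ k)} ->
  tdiff e (fun _ => 0) c W F = - ((-1) ^+ (inversions W F + #|F|.-1) * cobd g F).
Proof.
move=> FI WF cg; rewrite /tdiff FI /cobd mulr_sumr -sumrN [RHS]big_mkcond.
apply: eq_bigr => k _; rewrite /contract /twist mul0r sub0r.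
have [kF|kF] := boolP (k \in F); last by rewrite oppr0 mulr0 if_same.
have kW : k \notin W by rewrite (disjointFl WF kF).
rewrite (negPf kW) cg // mulrN !mulrA -!exprD.
by rewrite sign_inversions // addnAC.
Qed.

Lemma degree_index i d W F : (W, F) \in tbasis e i -> (#|W| + #|F|)%N = d ->
  exists l : 'I_#|degree_set (@tdeg _ e i) d|, gen (enum_val l) = (W, F).
Proof.
move=> b bd; pose j : 'I_#|tbasis e i| := enum_rank_in b (W, F).
have jE : gen j = (W, F) by rewrite /gen enum_rankK_in.
have jd : j \in degree_set (@tdeg _ e i) d by rewrite inE /tdeg jE bd.
by exists (enum_rank_in jd j); rewrite enum_rankK_in.
Qed.

(** The degree [d] part splits over the sets X with [d] elements; on each, [u] is a cochain on faces
    of size d - (i + 1), which is lifted separately. *)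
Lemma tmx_lift i d (p : int) (u : 'rV[int]_#|degree_set (@tdeg _ e i.+1) d|) :
    let Z := \matrix_(j < #|degree_set (@tdeg _ e i.+1) d|, l < #|degree_set (@tdeg _ e i) d|)
      tmx e (fun _ => 0 : int) i (enum_val j) (enum_val l) in
    (forall X s, cocycles_lift e p X s) -> (forall l, (p %| (u *m Z)%R 0%R l)%Z) ->
  exists2 u' : 'rV[int]_#|degree_set (@tdeg _ e i.+1) d|, u' *m Z = 0 & forall j, (p %| (u' 0%R j - u 0%R j)%R)%Z.
Proof.
move=> Z lift pu.
pose comb (v : 'rV[int]_#|degree_set (@tdeg _ e i.+1) d|) W F :=
  \sum_j v 0 j * basis_fun int (gen (enum_val j)) W F.
have combZ v l : (v *m Z) 0 l =
    tdiff e (fun _ => 0) (comb v) (gen (enum_val l)).1 (gen (enum_val l)).2.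
  by rewrite mxE tdiff_sum; apply: eq_bigr => j _; rewrite !mxE.
have combE v j : comb v (gen (enum_val j)).1 (gen (enum_val j)).2 = v 0 j.
  rewrite /comb (bigD1 j) //= big1 => [|k kj]; rewrite /basis_fun -surjective_pairing.
    by rewrite eqxx mulr1 addr0.
  by rewrite (inj_eq (@gen_inj _ _ _)) (inj_eq enum_val_inj) eq_sym (negPf kj) mulr0.
have genD (n : nat) (j : 'I_#|degree_set (@tdeg _ e n) d|) :
    [/\ [disjoint (gen (enum_val j)).1 & (gen (enum_val j)).2], (gen (enum_val j)).2 \in indep,
     #|(gen (enum_val j)).1| = n & (n + #|(gen (enum_val j)).2|)%N = d].
  have := genP (enum_val j); rewrite inE => /and3P[dj FI /eqP Wk]; split=> //.
  by have := enum_valP j; rewrite inE /tdeg Wk => /eqP.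
(* No generator with i + 1 elements in [W] has degree below i + 1, so here the index set is
   empty. *)
have [di|di] := ltnP d i.+1.
  exists 0 => [|j]; first exact: mul0mx.
  have [_ _ _ dE] := genD _ j.
  by suff : (i.+1 <= d)%N by [rewrite leqNgt di]; rewrite -dE leq_addr.
pose s := (d - i.+1)%N.
pose g X F := (-1) ^+ inversions (X :\: F) F * comb u (X :\: F) F.
have moveE k W F : k \in F -> [disjoint W & F] -> (W :|: F) :\: (F :\ k) = k |: W.
  move=> kF WF; apply/setP=> z; rewrite !inE; have [->|zk] := eqVneq z k.
    by rewrite kF orbT.
  have [zF|zF] := boolP (z \in F); last by rewrite orbF.
  by rewrite (disjointFl WF zF).
have gX X : #|X| = d -> cocycle e p X s (g X).
  move=> Xd F /and3P[FX FI /eqP Fs]; pose W := X :\: F.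
  have WFX : W :|: F = X by rewrite setUC /W -[X in X :|: _](setIidPr FX) setID.
  have WF : [disjoint W & F] by rewrite -setI_eq0 setIC setIDA setDIl setDv set0I.
  have Wi : #|W| = i by rewrite cardsD (setIidPr FX) Xd Fs /s subnSK // subKn // ltnW.
  have [||l lE] := @degree_index i d W F; first by rewrite inE /= WF FI Wi eqxx.
    by rewrite Wi Fs /s subnSK // subnKC // ltnW.
  have := pu l; rewrite combZ lE /= (@tdiff0_cobd _ (g X)) ?rpredN ?dvdz_sign // => k kF.
  by rewrite /g -WFX moveE // mulrA -expr2 sqrr_sign mul1r.
have H X : exists g', #|X| = d -> cocycle e 0 X s g' /\
    forall F, face e X s F -> (p %| (g' F - g X F)%R)%Z.
  have [Xd|nX] := eqVneq #|X| d; last by exists (fun _ => 0) => Xd; rewrite Xd eqxx in nX.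
  by have [g' g0 g'g] := lift X s (g X) (gX X Xd); exists g'.
have [g' g'P] := fin_all_exists H.
pose u' : 'rV[int]_#|degree_set (@tdeg _ e i.+1) d| := \row_j
  ((-1) ^+ inversions (gen (enum_val j)).1 (gen (enum_val j)).2 *
    g' ((gen (enum_val j)).1 :|: (gen (enum_val j)).2) (gen (enum_val j)).2).
have unionD (n : nat) (j : 'I_#|degree_set (@tdeg _ e n) d|) :
    #|(gen (enum_val j)).1 :|: (gen (enum_val j)).2| = d.
  have [dj _ Wk dE] := genD n j.
  by rewrite cardsU (eqP (_ : _ :&: _ == set0)) ?setI_eq0 // cards0 subn0 Wk.
exists u' => [|j].
  apply/rowP=> l; rewrite combZ mxE; have [WF FI Wi dE] := genD _ l.
  have Xd := unionD _ l; move: WF FI Wi dE Xd.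
  set W := (gen _).1; set F := (gen _).2 => WF FI Wi dE Xd.
  rewrite (@tdiff0_cobd _ (g' (W :|: F))) // => [|k kF].
    have : (0 %| cobd (g' (W :|: F)) F)%Z.
      apply: (g'P _ Xd).1; apply/and3P; split=> //; first exact: subsetUr.
      by rewrite /s -dE subnS addKn prednK //; move: di; rewrite -dE -addn1 leq_add2l.
    by rewrite dvd0z => /eqP ->; rewrite mulr0 oppr0.
  have kW : k \notin W by rewrite (disjointFl WF kF).
  have [||j jE] := @degree_index i.+1 d (k |: W) (F :\ k).
  - rewrite inE /= cardsU1 kW Wi eqxx (indepS (subsetDl _ _) FI) /= andbT.
    rewrite disjoint_sym disjoints_subset; apply/subsetP=> z; rewrite !inE negb_or => /andP[-> zF].
    by rewrite (disjointFl WF zF).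
  - by rewrite cardsU1 kW Wi -dE (cardsD1 k F) kF addnCA addnA.
  have := combE u' j; rewrite jE /= => ->; rewrite mxE jE /=; congr (_ * g' _ _).
  apply/setP=> z; rewrite !inE; case: (eqVneq z k) => [->|_] /=; first by rewrite kF orbT.
  by [].
have [WF FI Wi dE] := genD _ j; have Xd := unionD _ j.
rewrite mxE -[u 0 j]combE; move: WF FI Wi dE Xd.
set W := (gen _).1; set F := (gen _).2 => WF FI Wi dE Xd.
have -> : comb u W F = (-1) ^+ inversions W F * g (W :|: F) F.
  have WE : (W :|: F) :\: F = W.
    rewrite setDUl setDv setU0; apply/setDidPl; exact: WF.
  by rewrite /g WE mulrA -expr2 sqrr_sign mul1r.
rewrite -mulrBr dvdz_sign; apply: (g'P _ Xd).2; apply/and3P; split=> //.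
  exact: subsetUr.
by rewrite /s -dE addKn.
Qed.

End ConstantPart.

Theorem theorem4p1 (T : finType) (e : rel T)
    (e_sym : symmetric e) (e_irr : irreflexive e) (leT10 : #|T| <= 10)
    (K L : fieldType)
    (F : graded_minimal_free_resolution (edge_ideal K e))
    (F' : graded_minimal_free_resolution (edge_ideal L e))
    (i d : nat) :
  graded_betti F i d = graded_betti F' i d.
Proof.
have rk j : exists r, forall K : fieldType,
    \rank (const_part (@tdeg _ e j.+1) (@tdeg _ e j) d (tmx e (@vertex_var K T) j)) = r.
  pose Z := (\matrix_(k < #|degree_set (@tdeg _ e j.+1) d|, l < #|degree_set (@tdeg _ e j) d|)
      tmx e (fun _ => 0%R : int) j (enum_val k) (enum_val l))%R.
  have [|r rE] := @rank_map_int _ _ Z.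
    move=> p u p0 pu; apply: tmx_lift => // X s.
    by apply: cocycles_lift_card_le10 => //; apply: leq_trans leT10; apply: max_card.
  by exists r => M; rewrite -(rE M) const_part_tmx.
have bettiE (M : fieldType) (G : graded_minimal_free_resolution (edge_ideal M e)) :=
  graded_betti_rank (@edge_idealD M T e) (@edge_idealM M T e) (@edge_ideal_hpart M T e) G
    (total_resolution e_irr M) i d.
have := bettiE K F; have := bettiE L F'; rewrite /=.
have [r rE] := rk i; rewrite !rE.
case: i bettiE rE => [|j] _ rE.
  by rewrite !addn0 => <- /addIn.
by have [r' r'E] := rk j; rewrite !r'E => <- /addIn/addIn.
Qed.
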